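(* Let $E\subset\mathbb{C}$ be a closed set and let $w$ be an admissible weight on $E$. Let $P_1,\dots,P_m$ be polynomials of degrees $n_1,\dots,n_m$ respectively, and $n=\sum_{j=1}^m n_j$. Then \[ \prod_{j=1}^m\|w^{n_j}P_j\|_E \le e^{nC_E^w(m)}\left\|w^n\prod_{j=1}^m P_j\right\|_E \le e^{nC_E^w}\left\|w^n\prod_{j=1}^m P_j\right\|_E, \] where \[ C_E^w(m):=\sup_{c_1,\dots,c_m\in E}\int\log\max_{1\le k\le m} w(c_k)|z-c_k|\,d\mu_w(z)+F_w, \qquad C_E^w:=\int\log d_E^w(z)\,d\mu_w(z)+F_w . \] For each fixed $m\ge 2$, the constant $C_E^w(m)$ cannot be replaced by a smaller value; and $C_E^w$ cannot be replaced by a smaller value independent of $m$.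
   Context: $\|f\|_E:=\sup_{z\in E}|f(z)|$. A weight $w:E\to[0,\infty)$ is admissible if $w$ is upper semicontinuous on $E$, the set $\{z\in E: w(z)>0\}$ has positive logarithmic capacity, and, if $E$ is unbounded, $|z|w(z)\to 0$ as $|z|\to\infty$, $z\in E$. The weighted equilibrium measure $\mu_w$ is the (unique) positive unit Borel measure with compact support $S_w\subset E$, and $F_w$ the (unique) constant, such that $\int\log|z-t|\,d\mu_w(t)+\log w(z)+F_w\ge 0$ for $z\in S_w$ and $\int\log|z-t|\,d\mu_w(t)+\log w(z)+F_w\le 0$ for quasi every $z\in E$ (i.e. except on a set of zero logarithmic capacity); $F_w$ is the modified Robin constant. The weighted farthest-point distance function is $d_E^w(z):=\sup_{t\in E}w(t)|z-t|$, $z\in\mathbb{C}$. *)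

(* Defs.v *)
From HB Require Import structures.
From mathcomp Require Import all_boot all_order all_algebra.
From mathcomp Require Import all_classical all_reals all_analysis.
From mathcomp Require Import complex.
Import Order.TTheory GRing.Theory Num.Theory.
Import numFieldNormedType.Exports.

Set Implicit Arguments.
Unset Strict Implicit.
Unset Printing Implicit Defensive.

Local Open Scope classical_set_scope.
Local Open Scope ring_scope.

(* The complex plane is modelled as R * R (product topology and product
   (= Borel) sigma-algebra); z = (x, y) corresponds to x +i* y in R[i]. *)
Section WeightedPotential.
Context {R : realType}.
Local Notation CC := (R * R)%type.

Definition toC (z : CC) : R[i] := (z.1 +i* z.2)%C.

Definition cabs (z : CC) : R := Num.sqrt (z.1 ^+ 2 + z.2 ^+ 2).
Definition cdist (z t : CC) : R := cabs (z.1 - t.1, z.2 - t.2).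

(* logarithm on [0, +oo], with log 0 = -oo (and log of negatives = -oo) *)
Definition elog (x : \bar R) : \bar R :=
  match x with
  | EFin r => if r <= 0 then -oo%E else (ln r)%:E
  | EPInf => +oo%E
  | ENInf => -oo%E
  end.

Definition log_energy (mu : probability CC R) : \bar R :=
  (\int[mu]_z (\int[mu]_t (- elog (cdist z t)%:E)))%E.

Definition pos_log_cap (A : set CC) : Prop :=
  exists (mu : probability CC R) (K : set CC),
    [/\ compact K, K `<=` A, mu K = 1%E & (log_energy mu < +oo)%E].

Definition quasi_every (E : set CC) (P : CC -> Prop) : Prop :=
  exists N : set CC, ~ pos_log_cap N /\ forall z, E z -> ~ N z -> P z.

Definition usc_on (E : set CC) (w : CC -> R) : Prop :=
  forall z, E z -> forall a : R, w z < a ->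
    \forall y \near z, E y -> w y < a.

Definition bounded_set (E : set CC) : Prop :=
  exists M : R, forall z, E z -> cabs z <= M.

Definition admissible (E : set CC) (w : CC -> R) : Prop :=
  [/\ (forall z, E z -> 0 <= w z),
      usc_on E w,
      pos_log_cap [set z | E z /\ 0 < w z] &
      (~ bounded_set E ->
        forall eps : R, 0 < eps -> exists M : R,
          forall z, E z -> M < cabs z -> cabs z * w z < eps)].

Definition msupp (mu : probability CC R) : set CC :=
  [set z | forall U : set CC, open U -> U z -> (0 < mu U)%E].

Definition logpot (mu : probability CC R) (z : CC) : \bar R :=
  (\int[mu]_t elog (cdist z t)%:E)%E.

(* (mu, F) is the weighted equilibrium measure of (E, w) and F its modified
   Robin constant (characterized as in the paper; they are unique) *)
Definition weighted_equilibrium (E : set CC) (w : CC -> R)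
    (mu : probability CC R) (F : R) : Prop :=
  [/\ compact (msupp mu), msupp mu `<=` E,
      (forall z, msupp mu z -> (0 <= logpot mu z + elog (w z)%:E + F%:E)%E) &
      quasi_every E (fun z => (logpot mu z + elog (w z)%:E + F%:E <= 0)%E)].

Definition wsnorm (E : set CC) (w : CC -> R) (n : nat) (P : {poly R[i]}) : \bar R :=
  ereal_sup [set ((w z) ^+ n * Normc.normc P.[toC z])%:E | z in E].

Definition farthest_dist (E : set CC) (w : CC -> R) (z : CC) : \bar R :=
  ereal_sup [set (w t * cdist z t)%:E | t in E].

Definition CEwm (E : set CC) (w : CC -> R) (mu : probability CC R) (F : R)
    (m : nat) : \bar R :=
  ereal_sup [set x | exists c : 'I_m -> CC, (forall k, E (c k)) /\
     x = (\int[mu]_z elog (\big[Num.max/0]_(k < m) (w (c k) * cdist z (c k)))%:E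
          + F%:E)%E].

Definition CEw (E : set CC) (w : CC -> R) (mu : probability CC R) (F : R) : \bar R :=
  (\int[mu]_z elog (farthest_dist E w z) + F%:E)%E.

Definition prod_norms (E : set CC) (w : CC -> R) (m : nat) (n : 'I_m -> nat)
    (P : 'I_m -> {poly R[i]}) : \bar R :=
  (\prod_(j < m) wsnorm E w (n j) (P j))%E.

Definition bound_with (E : set CC) (w : CC -> R) (m : nat) (n : 'I_m -> nat)
    (P : 'I_m -> {poly R[i]}) (c : \bar R) : \bar R :=
  (expeR ((\sum_(j < m) n j)%N%:R%:E * c)
     * wsnorm E w (\sum_(j < m) n j)%N (\prod_(j < m) P j))%E.

End WeightedPotential.

(* Main.v *)
Require Import Defs.
From HB Require Import structures.
From mathcomp Require Import all_boot all_order all_algebra.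
From mathcomp Require Import all_classical all_reals all_analysis.
From mathcomp Require Import measurable_realfun complex.
From mathcomp Require Import ring lra.
Import Order.TTheory GRing.Theory Num.Theory.
Import numFieldNormedType.Exports.

Set Implicit Arguments.
Unset Strict Implicit.
Unset Printing Implicit Defensive.

Local Open Scope classical_set_scope.
Local Open Scope ring_scope.

(** Bernstein-Walsh: since the weighted potential of [mu] is nonnegative on the
support, the norm of [w^n P] bounds [|P|] by [e^{n (U + F)}] first on the support
and then, by a maximum principle, on the whole plane, where [U] is the logarithmic
potential of [mu].  Given centers [c_k] with [W = max_k w(c_k) |z - c_k|], a
polynomial [Q_N] with [|Q_N|^(1/N)] close to [W] at the zeros of [P] is obtained
from the [N]-th powers of the [z - c_k]; the symmetry of the resultant of [P] and
[Q_N] then bounds the product of [W] over the zeros of [P] by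
[exp (n (\int log W dmu + F))] times the norm, and the left-hand side of the
theorem is a supremum of such products.

Sharpness: zeros distributed like [mu], completed by a small proportion of zeros
of a polynomial that is tiny on the (capacity zero) set where the equilibrium
inequality fails, give polynomials with weighted norm at most [e^{n (ep - F)}].
Sharing these zeros among [P_1, ..., P_m] according to the center realizing [W]
makes the inequality nearly an equality.  Zero capacity enters only through the
existence of that tiny polynomial, which comes from Leja points. *)

(** The logarithmic potential is only upper semicontinuous and may take the value -oo. It is
    therefore handled through the truncations [tpot d], which are Lipschitz and decrease to it as
    [d] tends to 0: inequalities are proved for every [d > 0], and integrals against [mu] reduce to
    means of continuous functions over the compact support. Harmonicity off the support enters only
    through means over four points: these are exact for ln|z - t| up to order r^4, and a
    perturbation of order r^2 beats that error. Classically [ln wmax] is, up to a constant, the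
    potential of a measure, and the upper bound follows by Fubini. The polynomials Q_N discretise
    that measure, the resultant plays the role of Fubini, and constants independent of N disappear
    with the N-th root. All this needs [wmax] bounded away from 0, which fails when all centers of
    positive weight coincide. The measure [mu] is no point mass, so for m >= 2 two points of its
    support can repair degenerate centers without lowering [wmax]; for m = 1 only the sign of the
    constant matters. *)

Section plane.
Context {R : realType}.
Local Notation CC := (R * R)%type.
Implicit Types (z t u : CC).

Lemma cdistE z t : cdist z t = Normc.normc (toC z - toC t).
Proof. by case: z t => [a b] [c d]. Qed.

Lemma cdist_ge0 z t : 0 <= cdist z t.
Proof. exact: sqrtr_ge0. Qed.

Lemma cdistC z t : cdist z t = cdist t z.
Proof. by rewrite !cdistE -opprB normcN. Qed.

Lemma cdistxx z : cdist z z = 0.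
Proof. by rewrite cdistE subrr Normc.normc0. Qed.

Lemma cdist_triangle u z t : cdist z t <= cdist z u + cdist u t.
Proof. by rewrite !cdistE (le_trans _ (le_normcD _ _))// subrKA. Qed.

Lemma cdist_eq0 z t : cdist z t = 0 -> z = t.
Proof.
rewrite cdistE => /Normc.eq0_normc/eqP; rewrite subr_eq0.
by case: z t => [a b] [c d] /eqP[-> ->].
Qed.

Lemma cdist_gt0 z t : z <> t -> 0 < cdist z t.
Proof.
by move=> zt; rewrite lt_def cdist_ge0 andbT; apply/eqP => /cdist_eq0.
Qed.

Lemma cabs_cdist z : cabs z = cdist z (0, 0).
Proof. by rewrite /cdist/= !subr0; case: z. Qed.

Lemma cabs_ge0 z : 0 <= cabs z.
Proof. exact: sqrtr_ge0. Qed.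

Lemma cdist_cabs z t : cdist z t <= cabs z + cabs t.
Proof. by rewrite !cabs_cdist (cdistC t) cdist_triangle. Qed.

Lemma cabs_sub_cdist z t : cabs z - cabs t <= cdist z t.
Proof. by rewrite lerBlDr !cabs_cdist cdist_triangle. Qed.

Lemma cdist_sup_le z t (e : R) : `|z.1 - t.1| <= e -> `|z.2 - t.2| <= e ->
  cdist z t <= 2 * e.
Proof.
move=> h1 h2; have e0 : 0 <= e by exact: le_trans h1.
rewrite /cdist /cabs/= -[leRHS]ger0_norm ?mulr_ge0// -sqrtr_sqr ler_wsqrtr//.
have h3 : (z.1 - t.1) ^+ 2 <= e ^+ 2 by rewrite -real_normK ?num_real// lerXn2r.
have h4 : (z.2 - t.2) ^+ 2 <= e ^+ 2 by rewrite -real_normK ?num_real// lerXn2r.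
have : 0 <= e ^+ 2 by exact: sqr_ge0.
by lra.
Qed.

Lemma le_cdist1 z t : `|z.1 - t.1| <= cdist z t.
Proof. by rewrite -sqrtr_sqr ler_wsqrtr// lerDl sqr_ge0. Qed.

Lemma le_cdist2 z t : `|z.2 - t.2| <= cdist z t.
Proof. by rewrite -sqrtr_sqr ler_wsqrtr// lerDr sqr_ge0. Qed.

Lemma near_cdist z (e : R) : 0 < e -> \forall y \near z, cdist z y < e.
Proof.
move=> e0; have e4 : 0 < e / 4 by lra.
near=> y.
have : ball z (e / 4) y by near: y; exact: nbhsx_ballx.
move=> [/= b1 b2]; rewrite (le_lt_trans (@cdist_sup_le _ _ (e / 4) _ _))//.
- exact: ltW.
- exact: ltW.
- by lra.
Unshelve. all: end_near. Qed.

Lemma nbhs_cdist z (A : set CC) : nbhs z A ->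
  exists2 e : R, 0 < e & forall y, cdist z y < e -> A y.
Proof.
move=> /nbhs_ballP[e /= e0 eA]; exists e => // y zy; apply: eA; split => /=.
- exact: le_lt_trans (le_cdist1 _ _) zy.
- exact: le_lt_trans (le_cdist2 _ _) zy.
Qed.

Lemma lipschitz_cdist_continuous (f : CC -> R) (k : R) :
  (forall z t, f z - f t <= k * cdist z t) -> continuous f.
Proof.
move=> fk z; apply/cvgrPdist_lt => e e0.
near=> y; have : cdist z y < e / (`|k| + 1).
  by near: y; apply: near_cdist; rewrite divr_gt0// ltr_wpDl.
rewrite ltr_pdivlMr ?ltr_wpDl// => zy.
have k1 : k * cdist z y <= cdist z y * (`|k| + 1).
  rewrite mulrC ler_wpM2l ?cdist_ge0// (le_trans (ler_norm _))// lerDl//.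
rewrite ltr_norml; apply/andP; split.
  have := fk y z; rewrite (cdistC y); lra.
by have := fk z y; lra.
Unshelve. all: end_near. Qed.

Lemma continuous_cdistl t : continuous (fun z => cdist z t).
Proof.
by apply: (@lipschitz_cdist_continuous _ 1) => z u; rewrite mul1r lerBlDr
  cdist_triangle.
Qed.

Lemma continuous_cdistr z : continuous (fun t => cdist z t).
Proof. under [X in continuous X]funext do rewrite cdistC; exact: continuous_cdistl. Qed.

Lemma continuous_cabs : continuous (@cabs R).
Proof.
rewrite [X in continuous X](_ : _ = fun z => cdist z (0, 0)).
  exact: continuous_cdistl.
by apply/funext => z; rewrite cabs_cdist.
Qed.

Lemma compact_disc (M : R) : compact [set z : CC | cabs z <= M].
Proof.
apply: (@subclosed_compact _ _ (`[-M, M] `*` `[-M, M])).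
- exact: ((continuous_closedP _).1 continuous_cabs _ (@closed_le _ M)).
- by apply: compact_setX; exact: segment_compact.
- move=> z /= zM; rewrite cabs_cdist in zM.
  have := le_trans (le_cdist1 _ _) zM; have := le_trans (le_cdist2 _ _) zM.
  by rewrite /= !subr0 !ler_norml !in_itv/=.
Qed.

Lemma closed_disc_compact (A : set CC) (M : R) : closed A ->
  (forall z, A z -> cabs z <= M) -> compact A.
Proof. by move=> cA AM; exact: (subclosed_compact cA (@compact_disc M) AM). Qed.

Lemma compact_cabs_bounded (A : set CC) : compact A ->
  exists2 M : R, 0 < M & forall z, A z -> cabs z <= M.
Proof.
move=> /compact_near_coveringP/(_ R (pinfty_nbhs R) (fun M z => cabs z <= M)).
case=> //.
  move=> z Az; exists ([set y | cdist z y < 1], [set M : R | cabs z + 1 < M]).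
    split; first exact: near_cdist.
    exists (cabs z + 1); split => //; exact: num_real.
  move=> [y M] /= [zy zM].
  have := cabs_sub_cdist y z; rewrite cdistC; lra.
move=> M [Mr h]; exists (Num.max M 0 + 1).
  by rewrite ltr_wpDl// le_max lexx orbT.
by apply: h; rewrite ltr_pwDr// le_max lexx.
Qed.

End plane.

(** * Borel sets of the plane and the support of a measure *)

Section borel_plane.
Context {R : realType}.
Local Notation CC := (R * R)%type.

(** A countable base of the topology, indexed by codes of quadruples of rationals. Countability is
    what makes open sets measurable for the product sigma-algebra, and the complement of the support
    null. *)
Definition rat_box (k : nat) : set CC :=
  if @unpickle (rat * rat * rat * rat)%type k is Some (a, b, c, d) then
    `]ratr a, ratr b[ `*` `]ratr c, ratr d[ else set0.

Lemma measurable_rat_box k : measurable (rat_box k).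
Proof.
rewrite /rat_box; case: unpickle => [[[[a b] c] d]|//].
exact: measurableX.
Qed.

Lemma rat_box_basis (U : set CC) z : open U -> U z ->
  exists2 k, rat_box k z & rat_box k `<=` U.
Proof.
move=> oU Uz; have /nbhs_ballP[e /= e0 eU] : nbhs z U by exact: open_nbhs_nbhs.
have near_rat (x : R) : exists a b : rat,
    [/\ x - e < ratr a, ratr a < x, x < ratr b & ratr b < x + e].
  have [|a] := @rat_in_itvoo R (x - e) x; first lra.
  have [|b] := @rat_in_itvoo R x (x + e); first lra.
  rewrite !in_itv/= => /andP[h1 h2] /andP[h3 h4].
  by exists a, b.
have [a [b [a1 a2 b1 b2]]] := near_rat z.1.
have [c [d [c1 c2 d1 d2]]] := near_rat z.2.
exists (pickle (a, b, c, d)); rewrite /rat_box pickleK.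
  by split => /=; rewrite in_itv/=; apply/andP.
move=> y [/=]; rewrite !in_itv/= => /andP[h1 h2] /andP[h3 h4].
by apply: eU; split => /=; rewrite /ball/= ltr_norml; apply/andP; split; lra.
Qed.

Lemma open_measurable_plane (U : set CC) : open U -> measurable U.
Proof.
move=> oU; rewrite (_ : U = \bigcup_(k in [set k | rat_box k `<=` U]) rat_box k).
  by apply: bigcup_measurable => k _; exact: measurable_rat_box.
apply/seteqP; split=> [z Uz|z [k /= kU]]; last exact: kU.
by have [k kz kU] := rat_box_basis oU Uz; exists k.
Qed.

Lemma closed_measurable_plane (A : set CC) : closed A -> measurable A.
Proof.
by move=> /closed_openC/open_measurable_plane/measurableC; rewrite setCK.
Qed.

Lemma compact_closed_plane (A : set CC) : compact A -> closed A.
Proof. apply: compact_closed; exact: norm_hausdorff. Qed.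

Lemma continuous_measurable_plane (f : CC -> R) :
  continuous f -> measurable_fun setT f.
Proof.
move=> /continuousP cf; apply: (measurability _ (RGenOpens.measurableE R)).
move=> _ [_ [a [b ->] <-]]; rewrite setTI.
by apply: open_measurable_plane; apply: cf; exact: interval_open.
Qed.

End borel_plane.

Section support.
Context {R : realType} (mu : probability (R * R)%type R).
Local Notation CC := (R * R)%type.

Lemma msupp_closed : closed (msupp mu).
Proof.
move=> z clz U oU Uz; have [y [Sy Uy]] := clz _ (open_nbhs_nbhs (conj oU Uz)).
exact: Sy.
Qed.

Lemma measurable_msupp : measurable (msupp mu).
Proof. exact: closed_measurable_plane msupp_closed. Qed.

(** Every point off the support has a null open neighbourhood, hence lies in a null box of the base,
    and there are only countably many of these. *)
Lemma msuppC0 : mu (~` msupp mu) = 0%E.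
Proof.
pose F k : set CC := if mu (rat_box k) == 0%E then rat_box k else set0.
have mF k : measurable (F k).
  by rewrite /F; case: ifP => // _; exact: measurable_rat_box.
have F0 k : mu (F k) = 0%E by rewrite /F; case: ifPn => [/eqP|_]; rewrite ?measure0.
apply/eqP; rewrite eq_le measure_ge0 andbT.
have <- : mu (\bigcup_k F k) = 0%E.
  apply/negligibleP; first exact: bigcupT_measurable.
  by apply: negligible_bigcup => k; apply/negligibleP; [exact: mF|exact: F0].
apply: le_measure; rewrite ?inE.
- exact: (measurableC measurable_msupp).
- exact: bigcupT_measurable.
move=> z /existsNP[U /not_implyP[oU /not_implyP[Uz /negP]]].
rewrite -leNgt => U0.
have [k kz kU] := rat_box_basis oU Uz; exists k => //.
rewrite /F ifT// eq_le measure_ge0 andbT (le_trans _ U0)// le_measure// inE.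
  exact: measurable_rat_box.
exact: open_measurable_plane.
Qed.

Lemma msupp1 : mu (msupp mu) = 1%E.
Proof.
have := probability_setC mu (measurableC measurable_msupp).
by rewrite msuppC0 setCK sube0.
Qed.

Lemma msupp_neq0 : msupp mu !=set0.
Proof.
apply/set0P/eqP => S0; have := msupp1; rewrite S0 measure0 => /eqP.
by rewrite eq_sym onee_eq0.
Qed.

Lemma integral_msupp (f : CC -> \bar R) : measurable_fun setT f ->
  (\int[mu]_t f t = \int[mu]_(t in msupp mu) f t)%E.
Proof.
move=> mf; have mS := measurable_msupp; rewrite [RHS]integral_mkcond.
apply: ae_eq_integral => //.
  by apply: (iffLR (measurable_restrictT _ mS)); exact: measurable_funTS.
exists (~` msupp mu); split; [exact: measurableC|exact: msuppC0|].
move=> t /= /not_implyP[_ h] St; apply: h.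
by rewrite patchE mem_set.
Qed.

End support.

(** The integral of a nonnegative function is a supremum over the simple functions below it, hence
    monotone for arbitrary functions; positive and negative parts give the general case. *)
Lemma pointwise_le_integral d (T : measurableType d) (R : realType)
    (mu : {measure set T -> \bar R}) (D : set T) (f g : T -> \bar R) :
  (forall x, D x -> f x <= g x)%E ->
  (\int[mu]_(x in D) f x <= \int[mu]_(x in D) g x)%E.
Proof.
have ge0_le (h k : T -> \bar R) : (forall x, 0 <= h x)%E -> (forall x, h x <= k x)%E ->
    (\int[mu]_x h x <= \int[mu]_x k x)%E.
  move=> h0 hk; have k0 x : (0 <= k x)%E by exact: le_trans (h0 x) (hk x).
  rewrite !ge0_integralTE//; apply: ereal_sup_le => _ /= [l lh <-].
  by exists l => // x; exact: le_trans (lh x) (hk x).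
move=> fg; rewrite !(integral_mkcond D) integralE [leRHS]integralE leeB//.
- apply: ge0_le => // x; rewrite !funeposE !patchE.
  by case: ifPn => // /[!inE] Dx; apply: le_max2 => //; exact: fg.
- apply: ge0_le => // x; rewrite !funenegE !patchE.
  by case: ifPn => // /[!inE] Dx; apply: le_max2 => //; rewrite leeN2; exact: fg.
Qed.

(** * Logarithms, and means of continuous functions over the support *)

Section log_facts.
Context {R : realType}.
Implicit Types a b d x : R.

Lemma ln_sub_le a b : 0 < a -> 0 < b -> ln a - ln b <= (a - b) / b.
Proof.
move=> a0 b0; rewrite -ln_div ?posrE//.
have -> : a / b = 1 + (a - b) / b by rewrite mulrBl divff ?gt_eqF// addrC subrK.
by apply: le_ln1Dx; rewrite mulrBl divff ?gt_eqF// ltrBrDr addNr divr_gt0.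
Qed.

Lemma le_ln a b : 0 < a -> a <= b -> ln a <= ln b.
Proof. by move=> a0 ab; rewrite ler_ln// posrE (lt_le_trans a0). Qed.

Lemma max_gt0 a d : 0 < d -> 0 < Num.max a d.
Proof. by move=> d0; rewrite lt_max d0 orbT. Qed.

Lemma ln_max_lipschitz d a b : 0 < d ->
  ln (Num.max a d) - ln (Num.max b d) <= d^-1 * `|a - b|.
Proof.
move=> d0; have [ab|ba] := leP (Num.max a d) (Num.max b d).
  rewrite (@le_trans _ _ 0)//; last by rewrite mulr_ge0// invr_ge0 ltW.
  by rewrite subr_le0 le_ln// max_gt0.
apply: (le_trans (ln_sub_le (max_gt0 _ d0) (max_gt0 _ d0))).
rewrite mulrC; apply: ler_pM.
- by rewrite invr_ge0 ltW// max_gt0.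
- by rewrite subr_ge0 ltW.
- by rewrite lef_pV2 ?posrE ?max_gt0// le_max lexx orbT.
- have [da|ad] := leP a d.
    by move: ba; rewrite (max_idPr da) gt_max ltxx andbF.
  by rewrite (@le_trans _ _ (a - b))// ?ler_norm// lerB// le_max lexx.
Qed.

Lemma elogE x : 0 < x -> elog x%:E = (ln x)%:E :> \bar R.
Proof. by move=> x0; rewrite /elog leNgt x0. Qed.

Lemma elog_le0 x : x <= 0 -> elog x%:E = -oo%E :> \bar R.
Proof. by rewrite /elog => ->. Qed.

Lemma le_elog (x y : \bar R) : (x <= y)%E -> (elog x <= elog y)%E.
Proof.
case: x y => [x| |] [y| |]//=; rewrite ?leey ?leNye// lee_fin => xy.
have [y0|y0] := leP y 0; first by rewrite (le_trans xy y0).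
have [x0|x0] := leP x 0; first by rewrite leNye.
by rewrite lee_fin le_ln.
Qed.

Lemma measurable_elog (disp : measure_display) (T : measurableType disp) (f : T -> R) :
  measurable_fun setT f -> measurable_fun setT (fun u => elog (f u)%:E).
Proof.
move=> mf; rewrite [X in measurable_fun _ X](_ : _ =
  (fun u => if f u <= 0 then -oo%E else (ln (f u))%:E)); last by [].
apply: measurable_fun_ifT => //; first exact: measurable_fun_ler.
by apply/measurable_EFinP; apply: measurableT_comp.
Qed.

End log_facts.

Lemma continuous_bigsum {R : realType} (T : topologicalType) (I : Type)
    (s : seq I) (f : I -> T -> R) :
  (forall i, continuous (f i)) -> continuous (fun t => \sum_(i <- s) f i t).
Proof.
move=> cf; elim: s => [|i s IH] t.
  by under [X in continuous_at _ X]funext do rewrite big_nil; exact: cvg_cst.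
under [X in continuous_at _ X]funext do rewrite big_cons.
by apply: cvgD; [exact: cf|exact: IH].
Qed.

Section functional.
Context {R : realType} (mu : probability (R * R)%type R).
Local Notation CC := (R * R)%type.
Local Notation S := (msupp mu).
Implicit Types (f g : CC -> R).

(** Integrating over the compact support makes every continuous function bounded, hence integrable,
    so continuity is the only side condition of linearity and monotonicity. *)
Definition mean f : R := \int[mu]_(t in S) f t.

Hypothesis cptS : compact S.

Lemma integrable_msupp f : continuous f -> mu.-integrable S (EFin \o f).
Proof.
move=> cf; have mS := measurable_msupp mu.
apply: measurable_bounded_integrable => //.
- by rewrite (le_lt_trans (probability_le1 mu mS))// ltry.
- by apply: measurable_funTS; exact: continuous_measurable_plane.
- rewrite [X in bounded_near X]/=.
  have /compact_bounded : compact (f @` S).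
    by apply: continuous_compact => //; exact: continuous_subspaceT.
  rewrite /bounded_set /= => -[M [Mr h]]; exists M; split => // x xM t St.
  by apply: (h x xM); exists t.
Qed.

Lemma meanE f : continuous f ->
  (\int[mu]_(t in S) (f t)%:E = (mean f)%:E)%E.
Proof.
move=> cf; rewrite /mean /Rintegral fineK//.
by apply: integrable_fin_num; [exact: measurable_msupp|exact: (integrable_msupp cf)].
Qed.

Lemma le_mean f g : continuous f -> continuous g ->
  (forall t, S t -> f t <= g t) -> mean f <= mean g.
Proof.
move=> cf cg fg; apply: le_Rintegral => //; first exact: measurable_msupp.
- exact: integrable_msupp.
- exact: integrable_msupp.
Qed.

Lemma meanD f g : continuous f -> continuous g ->
  mean (fun t => f t + g t) = mean f + mean g.
Proof.
move=> cf cg; apply: RintegralD; first exact: measurable_msupp.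
- exact: integrable_msupp.
- exact: integrable_msupp.
Qed.

Lemma meanZ (k : R) f : continuous f -> mean (fun t => k * f t) = k * mean f.
Proof.
move=> cf; apply: RintegralZl; first exact: measurable_msupp.
exact: integrable_msupp.
Qed.

Lemma mean_cst (k : R) : mean (fun=> k) = k.
Proof.
apply: etrans (Rintegral_cst _ (measurable_msupp mu) k) _.
exact: etrans (congr1 (fun x => k * fine x) (msupp1 mu)) (mulr1 k).
Qed.

Lemma mean_sum (I : Type) (s : seq I) (f : I -> CC -> R) :
  (forall i, continuous (f i)) ->
  mean (fun t => \sum_(i <- s) f i t) = \sum_(i <- s) mean (f i).
Proof.
move=> cf; elim: s => [|i s IH].
  by under [X in mean X]funext do rewrite big_nil; rewrite mean_cst big_nil.
under [X in mean X]funext do rewrite big_cons.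
rewrite meanD// ?big_cons ?IH//.
exact: continuous_bigsum.
Qed.

End functional.

(** * Truncated logarithms and truncated potentials *)

Section truncation.
Context d (T : measurableType d) (R : realType) (mu : {measure set T -> \bar R}).
Local Open Scope ereal_scope.

(** The passage from truncated logarithms to [elog]. Subtracting from the upper bound [B] makes the
    integrands nonnegative and increasing as the level 1/(n+1) decreases, so monotone convergence
    applies. *)
Lemma truncated_log_integral (D : set T) (x : T -> R) (B : R) (C : \bar R) :
  measurable D -> measurable_fun setT x -> (0 <= B)%R ->
  (forall t, D t -> (x t <= expR B)%R) ->
  (forall e : R, (0 < e <= 1)%R ->
     \int[mu]_(t in D) (B - ln (Num.max (x t) e))%:E <= C) ->
  \int[mu]_(t in D) (B%:E - elog (x t)%:E) <= C.
Proof.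
move=> mD mx B0 xB hC.
pose g (n : nat) t : \bar R := (B - ln (Num.max (x t) n.+1%:R^-1))%:E.
have n01 n : (0 < (n.+1%:R^-1 : R) <= 1)%R.
  by rewrite invr_gt0 ltr0n/= invf_le1 ?ltr0n// ler1n.
have n0 n : (0 < n.+1%:R^-1 :> R)%R by case/andP: (n01 n).
have mg n : measurable_fun D (g n).
  apply: measurable_funTS; apply/measurable_EFinP.
  apply: measurable_funB => //; apply: measurableT_comp => //.
  by apply: measurable_maxr.
have g0 n t : D t -> 0 <= g n t.
  move=> Dt; rewrite lee_fin subr_ge0 -[leRHS]expRK le_ln ?max_gt0//.
  rewrite ge_max xB//=; have /andP[_ /le_trans] := n01 n; apply.
  by rewrite -expR0 ler_expR.
have ndg t : D t -> nondecreasing_seq (g ^~ t).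
  move=> Dt m n mn; rewrite lee_fin lerB// le_ln ?max_gt0// le_max2//.
  by rewrite lef_pV2 ?posrE ?ltr0n// ler_nat.
have cg t : D t -> g ^~ t @ \oo --> ereal_sup (range (g ^~ t)).
  by move=> Dt; apply: ereal_nondecreasing_cvgn; exact: ndg.
have mlim : measurable_fun D (fun t => limn (g ^~ t)).
  apply: (emeasurable_fun_cvg g (fun t => limn (g ^~ t)) mg) => t Dt.
  by rewrite (cvg_lim _ (cg _ Dt))//; exact: cg.
apply: (@le_trans _ _ (\int[mu]_(t in D) limn (g ^~ t))).
  apply: pointwise_le_integral => t Dt; rewrite (cvg_lim _ (cg _ Dt))//.
  have [xt0|xt0] := ltP 0%R (x t).
    have [n nx] : exists n, (n.+1%:R^-1 < x t)%R.
      have [n _ /(_ n (leqnn n)) h] := near_infty_natSinv_lt (PosNum xt0).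
      by exists n.
    apply: ereal_sup_ubound; exists n => //.
    by rewrite /g elogE// -EFinB (max_idPl (ltW nx)).
  (* Here the target is +oo; the truncation at level 1/(n+1) contributes ln (n+1), which exceeds any
     given [A]. *)
  rewrite elog_le0//= leye_eq; apply/eqP/eqyP => A A0.
  have [n hn] : exists n, (expR A <= n.+1%:R)%R.
    by exists (Num.truncn (expR A)); have /andP[_ /ltW] := truncn_itv (expR_ge0 A).
  apply: (@le_trans _ _ (g n t)); last by apply: ereal_sup_ubound; exists n.
  rewrite lee_fin (max_idPr _); last exact: le_trans xt0 (ltW (n0 n)).
  rewrite lnV ?posrE ?ltr0n// opprK.
  by rewrite -[A in leLHS]expRK ler_wpDl// le_ln// expR_gt0.
rewrite monotone_convergence//; apply: lime_le.
  apply: ereal_nondecreasing_is_cvgn => m n mn.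
  by apply: ge0_le_integral => // t Dt; [exact: g0..|exact: ndg].
by apply: nearW => n; exact: hC.
Qed.

End truncation.

Section truncated_potential.
Context {R : realType} (mu : probability (R * R)%type R).
Local Notation CC := (R * R)%type.
Local Notation S := (msupp mu).
Hypothesis cptS : compact S.
Implicit Types (z t : CC) (d : R).

Definition tlog d z t : R := ln (Num.max (cdist z t) d).
Definition tpot d z : R := mean mu (tlog d z).

Lemma tlogC d z t : tlog d z t = tlog d t z.
Proof. by rewrite /tlog cdistC. Qed.

Lemma tlog_lipschitz d z u t : 0 < d -> tlog d z t - tlog d u t <= d^-1 * cdist z u.
Proof.
move=> d0; rewrite (le_trans (ln_max_lipschitz _ _ d0))// ler_wpM2l//.
  by rewrite invr_ge0 ltW.
rewrite ler_norml; have h1 := cdist_triangle u z t; have h2 := cdist_triangle z u t.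
by rewrite (cdistC u z) in h2; apply/andP; split; lra.
Qed.

Lemma continuous_tlog d z : 0 < d -> continuous (tlog d z).
Proof.
move=> d0; apply: (@lipschitz_cdist_continuous _ _ d^-1) => t u.
by rewrite !(tlogC d z) tlog_lipschitz.
Qed.

Lemma tpot_lipschitz d z u : 0 < d -> tpot d z - tpot d u <= d^-1 * cdist z u.
Proof.
move=> d0; rewrite lerBlDr -[X in X + _](mean_cst mu) -meanD//; first last.
- exact: continuous_tlog.
- by move=> t; exact: cvg_cst.
apply: le_mean => //; first exact: continuous_tlog.
  by move=> t; apply: cvgD; [exact: cvg_cst|exact: continuous_tlog].
by move=> t St; rewrite -lerBlDr tlog_lipschitz.
Qed.

Lemma continuous_tpot d : 0 < d -> continuous (tpot d).
Proof.
by move=> d0; apply: (@lipschitz_cdist_continuous _ _ d^-1) => z u; exact: tpot_lipschitz.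
Qed.

Lemma le_tpot d e z : 0 < d -> d <= e -> tpot d z <= tpot e z.
Proof.
move=> d0 de; have e0 := lt_le_trans d0 de.
apply: le_mean; [exact: cptS|exact: continuous_tlog..|].
by move=> t St; rewrite le_ln ?max_gt0// le_max2.
Qed.

Lemma tpot_le d z (M : R) : 0 < d -> d <= M -> (forall t, S t -> cdist z t <= M) ->
  tpot d z <= ln M.
Proof.
move=> d0 dM SM; rewrite -[leRHS](mean_cst mu); apply: le_mean; rewrite //.
- exact: continuous_tlog.
- by move=> t; exact: cvg_cst.
- by move=> t St; rewrite le_ln ?max_gt0// ge_max SM.
Qed.

Lemma tpot_ge d z (M : R) : 0 < d -> 0 < M -> (forall t, S t -> M <= cdist z t) ->
  ln M <= tpot d z.
Proof.
move=> d0 M0 SM; rewrite -[leLHS](mean_cst mu); apply: le_mean; rewrite //.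
- by move=> t; exact: cvg_cst.
- exact: continuous_tlog.
- by move=> t St; rewrite le_ln// le_max SM.
Qed.

Lemma tpot_eq d e z : 0 < d -> 0 < e -> (forall t, S t -> d <= cdist z t) ->
  (forall t, S t -> e <= cdist z t) -> tpot d z = tpot e z.
Proof.
move=> d0 e0 Sd Se; apply: eq_Rintegral => t; rewrite inE => St.
by rewrite /tlog (max_idPl (Sd _ St)) (max_idPl (Se _ St)).
Qed.

Lemma measurable_elog_cdist z :
  measurable_fun setT (fun t => elog (cdist z t)%:E).
Proof. by apply: measurable_elog; apply: continuous_measurable_plane; exact: continuous_cdistr. Qed.

Lemma logpot_le_tpot d z : 0 < d -> (logpot mu z <= (tpot d z)%:E)%E.
Proof.
move=> d0; rewrite /logpot integral_msupp; last exact: measurable_elog_cdist.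
rewrite -meanE//; last exact: continuous_tlog.
apply: pointwise_le_integral => t St; rewrite -elogE ?max_gt0//; apply: le_elog.
by rewrite lee_fin le_max lexx.
Qed.

(** A lower bound uniform in the truncation bounds the integrals of the nonnegative functions
    [B - tlog d z], and this bound survives the limit. *)
Lemma tpot_bounded_integrable z (a : R) : (forall d, 0 < d -> a <= tpot d z) ->
  mu.-integrable S (fun t => elog (cdist z t)%:E) /\
  (a%:E <= \int[mu]_(t in S) elog (cdist z t)%:E)%E.
Proof.
move=> h; have [M M0 SM] := compact_cabs_bounded cptS.
(* An upper bound of ln|z - t| on the support; the added 1 makes it nonnegative. *)
pose B := ln (cabs z + M + 1); have zM0 : 0 < cabs z + M + 1.
  by have := cabs_ge0 z; lra.
have B0 : 0 <= B by rewrite ln_ge0//; have := cabs_ge0 z; lra.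
have mS := measurable_msupp mu.
have mk : measurable_fun S (fun t => B%:E - elog (cdist z t)%:E)%E.
  apply: measurable_funTS; apply: emeasurable_funB => //.
  exact: measurable_elog_cdist.
have SB t : S t -> cdist z t <= expR B.
  move=> St; rewrite lnK ?posrE//; have := cdist_cabs z t; have := SM _ St; lra.
have k0 t : S t -> (0 <= B%:E - elog (cdist z t)%:E)%E.
  move=> St; have : (elog (cdist z t)%:E <= B%:E)%E.
    by rewrite -[B]expRK -elogE ?expR_gt0//; apply: le_elog; rewrite lee_fin SB.
  by case: (elog _) => [x| |]//=; rewrite ?leey// -EFinB !lee_fin subr_ge0.
have kC : (\int[mu]_(t in S) (B%:E - elog (cdist z t)%:E) <= (B - a)%:E)%E.
  apply: truncated_log_integral => //.
    by apply: continuous_measurable_plane; exact: continuous_cdistr.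
  move=> e /andP[e0 e1].
  have ctl : continuous (fun t => B - tlog e z t).
    by move=> t; apply: cvgB; [exact: cvg_cst|exact: continuous_tlog].
  rewrite (meanE cptS ctl) lee_fin.
  rewrite (_ : mean _ _ = B - tpot e z); first by rewrite lerB// h.
  rewrite -[B in RHS](mean_cst mu) -[in RHS]mulN1r -meanZ//; last exact: continuous_tlog.
  rewrite -meanD//.
  - by congr mean; apply/funext => t; rewrite mulN1r.
  - by move=> t; exact: cvg_cst.
  - by move=> t; apply: cvgM; [exact: cvg_cst|exact: continuous_tlog].
have ik : mu.-integrable S (fun t => B%:E - elog (cdist z t)%:E)%E.
  apply/integrableP; split => //.
  under eq_integral => t /[!inE] St do rewrite gee0_abs ?k0//.
  exact: le_lt_trans kC (ltry _).
have iB : mu.-integrable S (fun=> B%:E).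
  by apply: (@integrable_msupp _ _ cptS (fun=> B)) => t; exact: cvg_cst.
have fE : (fun t => elog (cdist z t)%:E) =
    (fun t => B%:E - (B%:E - elog (cdist z t)%:E))%E.
  apply/funext => t; case: (elog _) => [x| |]//=.
  by rewrite -!EFinB opprB addrC subrK.
have hB : (\int[mu]_(t in S) B%:E = B%:E)%E.
  by rewrite (@meanE _ _ cptS (fun=> B)) ?mean_cst// => t; exact: cvg_cst.
rewrite fE; split; first exact: (integrableB mS iB ik).
rewrite (integralB mS iB ik) hB leeBrDr; last exact: integrable_fin_num.
by rewrite addeC -leeBrDr// -EFinB.
Qed.

(** Together with [logpot_le_tpot] this says that the potential is the infimum of its
    truncations. *)
Lemma tpot_lt_logpot z (a : R) : (logpot mu z < a%:E)%E ->
  exists2 d, 0 < d & tpot d z < a.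
Proof.
move=> za; apply: contrapT => h.
have {}h d : 0 < d -> a <= tpot d z.
  by move=> d0; rewrite leNgt; apply/negP => ?; apply: h; exists d.
have [_] := tpot_bounded_integrable h.
rewrite leNgt -integral_msupp; first by rewrite -/(logpot mu z) za.
exact: measurable_elog_cdist.
Qed.

End truncated_potential.

(** * Four-point means of distances and of polynomials *)

Section four_points.
Context {R : realType}.
Local Notation CC := (R * R)%type.
Implicit Types (z t : CC) (r d al : R) (Z : seq CC).

Definition east z r : CC := (z.1 + r, z.2).
Definition west z r : CC := (z.1 - r, z.2).
Definition north z r : CC := (z.1, z.2 + r).
Definition south z r : CC := (z.1, z.2 - r).

Definition prod4 (f : CC -> R) z r :=
  f (east z r) * f (west z r) * (f (north z r) * f (south z r)).
Definition sum4 (f : CC -> R) z r :=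
  f (east z r) + f (west z r) + (f (north z r) + f (south z r)).

Lemma prod4_cdist_ge0 z t r : 0 <= prod4 (cdist^~ t) z r.
Proof. by rewrite !mulr_ge0// cdist_ge0. Qed.

Lemma cdist_sqr z t : cdist z t ^+ 2 = (z.1 - t.1) ^+ 2 + (z.2 - t.2) ^+ 2.
Proof. by rewrite sqr_sqrtr// addr_ge0// sqr_ge0. Qed.

(** For u = z - t = x + iy this is |u^4 - r^4|^2, expanded with Re u^4 = |u|^4 - 8 x^2 y^2. *)
Lemma prod4_cdist_sqr z t r : prod4 (cdist^~ t) z r ^+ 2 =
  (cdist z t ^+ 4 - r ^+ 4) ^+ 2
  + 16 * (z.1 - t.1) ^+ 2 * (z.2 - t.2) ^+ 2 * r ^+ 4.
Proof.
rewrite /prod4 !exprMn !cdist_sqr/= (_ : 4%N = (2 * 2)%N)// !exprM cdist_sqr.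
by ring.
Qed.

(* The product of [z - t] over the rotations of [r] by fourth roots of unity is
   [(z - t)^4 - r^4], so the four-point mean of [log|z - t|] deviates from its
   value at the centre only to fourth order in [r]. *)
Lemma prod4_cdist_le z t r : prod4 (cdist^~ t) z r <= cdist z t ^+ 4 + r ^+ 4.
Proof.
have r4 : 0 <= r ^+ 4 by rewrite exprn_even_ge0.
rewrite -ler_sqr ?nnegrE ?prod4_cdist_ge0//; last first.
  by rewrite addr_ge0// exprn_ge0// cdist_ge0.
rewrite prod4_cdist_sqr (_ : 4%N = (2 * 2)%N)// !exprM cdist_sqr -!exprM/=.
set x := z.1 - t.1; set y := z.2 - t.2.
rewrite -subr_ge0 (_ : _ - _ = 4 * r ^+ 4 * (x ^+ 2 - y ^+ 2) ^+ 2); last by ring.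
by rewrite mulr_ge0 ?sqr_ge0// mulr_ge0.
Qed.

Lemma prod4_cdist_ge z t r : cdist z t ^+ 4 - r ^+ 4 <= prod4 (cdist^~ t) z r.
Proof.
have [h|h] := ltP (cdist z t ^+ 4 - r ^+ 4) 0.
  exact: le_trans (ltW h) (prod4_cdist_ge0 _ _ _).
rewrite -ler_sqr ?nnegrE ?prod4_cdist_ge0//.
rewrite prod4_cdist_sqr lerDl mulr_ge0 ?exprn_even_ge0//.
by rewrite mulr_ge0 ?sqr_ge0// mulr_ge0 ?sqr_ge0.
Qed.

Lemma sum4_cabs z r :
  sum4 (fun u => cabs u ^+ 2) z r = 4 * cabs z ^+ 2 + 4 * r ^+ 2.
Proof.
rewrite /sum4 !cabs_cdist !cdist_sqr/= !subr0; ring.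
Qed.

Lemma cdist_four z r (f : CC -> Prop) : 0 <= r -> (forall u, cdist z u <= r -> f u) ->
  [/\ f (east z r), f (west z r), f (north z r) & f (south z r)].
Proof.
move=> r0 h; suff H u : (u.1 - z.1) ^+ 2 + (u.2 - z.2) ^+ 2 = r ^+ 2 -> f u.
  by split; apply: H => /=; ring.
move=> E; apply: h; rewrite -ler_sqr ?nnegrE ?cdist_ge0// cdist_sqr -E.
by rewrite -(sqrrN (z.1 - _)) -(sqrrN (z.2 - _)) !opprB.
Qed.

(** The modulus of a polynomial given by its zeros, with multiplicity, and the modulus of its
    leading coefficient. *)
Definition absprod (al : R) Z z : R := al * \prod_(x <- Z) cdist z x.

Lemma absprod_ge0 al Z z : 0 <= al -> 0 <= absprod al Z z.
Proof. by move=> al0; rewrite mulr_ge0// prodr_ge0// => x _; exact: cdist_ge0. Qed.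

Lemma continuous_absprod al Z : continuous (absprod al Z).
Proof.
move=> z; apply: cvgM; first exact: cvg_cst.
elim: Z => [|x Z IH].
  by under [X in X @ _]funext do rewrite big_nil; rewrite big_nil; exact: cvg_cst.
under [X in X @ _]funext do rewrite big_cons.
by rewrite big_cons; apply: cvgM; [exact: continuous_cdistl|exact: IH].
Qed.

Lemma expRN2_le (y : R) : 0 <= y -> y <= 1 / 2 -> expR (- (2 * y)) <= 1 - y.
Proof.
move=> y0 y1; rewrite expRN invf_ple ?posrE ?expR_gt0//; last lra.
apply: (le_trans _ (expR_ge1Dx _)).
have y2 : 0 < 1 - y by lra.
by rewrite -div1r ler_pdivrMr//; nra.
Qed.

(** Each zero at distance at least [rho] costs a factor of at least 1 - y >= e^(-2y) with y = (r /
    rho)^4, so ln|P| falls short of the mean value property only to fourth order. *)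
Lemma prod4_absprod al Z z r (rho : R) : 0 <= al -> 0 < rho ->
  (forall x, x \in Z -> rho <= cdist z x) -> r ^+ 4 / rho ^+ 4 <= 1 / 2 ->
  absprod al Z z ^+ 4 * expR (- (2 * (size Z)%:R * (r ^+ 4 / rho ^+ 4)))
    <= prod4 (absprod al Z) z r.
Proof.
move=> al0 rho0 Zrho r1; pose y := r ^+ 4 / rho ^+ 4.
have y0 : 0 <= y by rewrite divr_ge0// exprn_even_ge0.
rewrite -/y; rewrite -/y in r1.
have -> : prod4 (absprod al Z) z r = al ^+ 4 * \prod_(x <- Z) prod4 (cdist^~ x) z r.
  by rewrite /prod4 /absprod !big_split/=; ring.
rewrite /absprod exprMn -[leLHS]mulrA ler_wpM2l ?exprn_ge0//.
elim: Z Zrho => [|x Z IH] Zrho.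
  by rewrite !big_nil/= mulr0 mul0r oppr0 expR0 mulr1 expr1n.
rewrite !big_cons/=.
have -> : - (2 * (size Z).+1%:R * y) = - (2 * y) + - (2 * (size Z)%:R * y).
  by rewrite -natr1; ring.
rewrite expRD exprMn mulrACA; apply: ler_pM.
- by rewrite mulr_ge0 ?expR_ge0// exprn_even_ge0.
- by rewrite mulr_ge0 ?expR_ge0// exprn_even_ge0.
- apply: le_trans (prod4_cdist_ge _ _ _).
  have zx : rho <= cdist z x by apply: Zrho; rewrite mem_head.
  have zx0 := lt_le_trans rho0 zx.
  apply: (@le_trans _ _ (cdist z x ^+ 4 * (1 - y))).
    by rewrite ler_wpM2l ?exprn_even_ge0// expRN2_le.
  rewrite mulrBr mulr1 lerB// /y mulrCA -[leLHS]mulr1 ler_wpM2l ?exprn_even_ge0//.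
  by rewrite ler_pdivlMr ?exprn_gt0// mul1r lerXn2r ?nnegrE// ltW.
- by apply: IH => u uZ; apply: Zrho; rewrite inE uZ orbT.
Qed.

End four_points.

(** * Potentials and polynomials near the support and at infinity *)

Section domination.
Context {R : realType} (mu : probability (R * R)%type R).
Local Notation CC := (R * R)%type.
Local Notation S := (msupp mu).
Hypothesis cptS : compact S.
Local Notation tpot := (tpot mu).

(** On the disc of radius [r] the truncation at [d] is inactive, so the fourth-order bound for ln|u
    - t| can be averaged over [t]. *)
Lemma sum4_tpot (d : R) z (r : R) : 0 < d -> 0 <= r ->
  (forall u t, cdist z u <= r -> S t -> d <= cdist u t) ->
  sum4 (tpot d) z r <= 4 * tpot d z + r ^+ 4 / d ^+ 4.
Proof.
move=> d0 r0 far.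
have ct u : continuous (tlog d u) by exact: continuous_tlog.
have ctD u v : continuous (fun t => tlog d u t + tlog d v t).
  by move=> t; apply: cvgD; exact: ct.
rewrite /sum4 -!(meanD cptS)// -(meanZ cptS)// -[X in _ + X](mean_cst mu).
rewrite -(meanD cptS)//; last 2 first.
- by move=> t; apply: cvgM; [exact: cvg_cst|exact: ct].
- by move=> t; exact: cvg_cst.
apply: le_mean => //.
- by move=> t; apply: cvgD; exact: ctD.
- by move=> t; apply: cvgD; [apply: cvgM; [exact: cvg_cst|exact: ct]|exact: cvg_cst].
move=> t St.
have [fe fw fn fs] := cdist_four r0 (fun u zu => far u t zu St).
have fz : d <= cdist z t by apply: far => //; rewrite cdistxx.
have p u : d <= cdist u t -> 0 < cdist u t by exact: lt_le_trans.
rewrite /tlog !(max_idPl _)// -!lnM ?posrE ?mulr_gt0 ?p//.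
have z4 : 0 < cdist z t ^+ 4 by rewrite exprn_gt0 ?p.
have r4 : 0 <= r ^+ 4 by rewrite exprn_even_ge0.
rewrite -lerBlDl mulr_natl -lnXn ?p//.
apply: (@le_trans _ _ (ln (cdist z t ^+ 4 + r ^+ 4) - ln (cdist z t ^+ 4))).
  rewrite lerB// le_ln//; last exact: prod4_cdist_le.
  by rewrite !mulr_gt0 ?p.
apply: (le_trans (ln_sub_le _ _)) => //; first by rewrite ltr_wpDr.
rewrite addrAC subrr add0r ler_wpM2l// lef_pV2 ?posrE ?exprn_gt0 ?p//.
by rewrite lerXn2r ?nnegrE ?cdist_ge0// ltW.
Qed.

Section bounded_below.
Variable Cc : R.
Hypothesis tpotC : forall k (d : R), S k -> 0 < d -> - Cc <= tpot d k.

(* A lower bound on the potential along the support forces small discs to have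
   uniformly small mass, which makes the truncated potentials equicontinuous
   near the support. *)
Lemma tpot_near_support (e : R) : 0 < e -> exists2 d0 : R, 0 < d0 &
  forall (d : R) k z, 0 < d -> d <= d0 -> S k -> cdist z k <= 2 * d ->
    tpot d k - e <= tpot d z.
Proof.
move=> e0; have [M M0 SM] := compact_cabs_bounded cptS.
pose D := 2 * M + 1; have D0 : 0 < D by rewrite /D; lra.
have D1 : 1 <= D by rewrite /D; lra.
have lD : 0 <= ln D by exact: ln_ge0.
pose L := ln D + `|Cc| + 1; have L0 : 0 < L by rewrite /L; have := normr_ge0 Cc; lra.
pose T := 12 * L / e; have T0 : 0 < T by rewrite divr_gt0// mulr_gt0.
pose be := D * expR (- T); have be0 : 0 < be by rewrite mulr_gt0// expR_gt0.
exists (Num.min (e * be / 12) 1).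
  by rewrite lt_min ltr01 andbT divr_gt0// mulr_gt0.
move=> d k z d0; rewrite le_min => /andP[dbe d1] Sk zk.
have ct u : continuous (tlog d u) by exact: continuous_tlog.
(* A majorant of the drop of [tlog] from [k] to [z]. With y = max (|k - t|, d) the drop is at most 6
   d / y: below 6 d / be if y >= be, and otherwise at most 6, while ln D - ln y > T, as in
   Chebyshev's inequality. The choices of [T] and of the bound on [d] make each part contribute at
   most e / 2 to the mean. *)
pose K t := 6 * (d / be) + 6 / T * (ln D + (-1) * tlog d k t).
have ctN : continuous (fun t => (-1) * tlog d k t).
  by move=> t; apply: cvgM; [exact: cvg_cst|exact: ct].
have ctB : continuous (fun t => ln D + (-1) * tlog d k t).
  by move=> t; apply: cvgD; [exact: cvg_cst|exact: ctN].
have ctZ : continuous (fun t => 6 / T * (ln D + (-1) * tlog d k t)).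
  by move=> t; apply: cvgM; [exact: cvg_cst|exact: ctB].
have ccst (c : R) : continuous (fun _ : CC => c) by move=> t; exact: cvg_cst.
have cK : continuous K by move=> t; apply: cvgD; [exact: cvg_cst|exact: ctZ].
have mK : mean mu K = 6 * (d / be) + 6 / T * (ln D - tpot d k).
  apply: etrans (meanD cptS (ccst (6 * (d / be))) ctZ) _.
  rewrite (meanZ cptS _ ctB) (meanD cptS (ccst (ln D)) ctN) (meanZ cptS _ (ct k)).
  by rewrite !mean_cst mulN1r.
have : tpot d k <= tpot d z + mean mu K.
  rewrite -meanD//; apply: le_mean => //.
    by move=> t; apply: cvgD; [exact: ct|exact: cK].
  move=> t St; rewrite -lerBlDl /K /tlog.
  set y := Num.max (cdist k t) d; set x := Num.max (cdist z t) d.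
  have y0 : 0 < y by exact: max_gt0.
  have x0 : 0 < x by exact: max_gt0.
  have dx : d <= x by rewrite le_max lexx orbT.
  have dy : d <= y by rewrite le_max lexx orbT.
  have yx : y <= x + 2 * d.
    rewrite ge_max; apply/andP; split; last by lra.
    have := cdist_triangle z k t; rewrite (cdistC k z).
    have : cdist z t <= x by rewrite le_max lexx.
    by lra.
  have yD : y <= D.
    rewrite ge_max (le_trans d1 D1) andbT /D.
    by have := cdist_cabs k t; have := SM _ St; have := SM _ Sk; lra.
  apply: (@le_trans _ _ (6 * (d / y))).
    apply: (le_trans (ln_sub_le y0 x0)).
    rewrite mulrA ler_pdivrMr// mulrAC ler_pdivlMr//.
    have h1 : (y - x) * y <= (2 * d) * y by rewrite ler_wpM2r ?(ltW y0)//; lra.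
    have yx3 : y <= 3 * x by lra.
    have h2 : (2 * d) * y <= (2 * d) * (3 * x) by rewrite ler_wpM2l//; rewrite mulr_ge0// ltW.
    by lra.
  rewrite -[X in _ <= _ + X]mulrA -mulrDr ler_wpM2l//.
  have lnbe : ln be = ln D - T by rewrite lnM ?posrE ?expR_gt0// expRK.
  rewrite mulN1r.
  have lny : ln y <= ln D by rewrite le_ln.
  have [bey|ybe] := leP be y.
    apply: (@le_trans _ _ (d / be)).
      by rewrite ler_wpM2l ?(ltW d0)// lef_pV2.
    by rewrite lerDl mulr_ge0 ?invr_ge0 ?(ltW T0)// subr_ge0.
  apply: (@le_trans _ _ 1); first by rewrite ler_pdivrMr// mul1r.
  rewrite -[leLHS]add0r lerD ?divr_ge0 ?ltW//.
  rewrite mulrC ltr_pdivlMr// mul1r.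
  have : ln y < ln be by rewrite ltr_ln ?posrE.
  by rewrite lnbe; lra.
rewrite mK => h.
have h1 : 6 * (d / be) <= e / 2.
  rewrite mulrA ler_pdivrMr//; move: dbe; rewrite ler_pdivlMr//; lra.
have h2 : 6 / T * (ln D - tpot d k) <= e / 2.
  apply: (@le_trans _ _ (6 / T * L)).
    have T6 : 0 <= 6 / T by apply: divr_ge0 => //; exact: ltW.
    apply: (ler_wpM2l T6); rewrite /L.
    have := tpotC Sk d0; have := ler_norm Cc; lra.
  rewrite mulrAC ler_pdivrMr// /T.
  rewrite (_ : e / 2 * _ = 6 * L)//; field; lra.
lra.
Qed.

End bounded_below.

Lemma absprod_near_support (al : R) Z (e : R) : 0 < e -> exists2 d0 : R, 0 < d0 &
  forall (d : R) k z, 0 < d -> d <= d0 -> S k -> cdist z k <= 2 * d ->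
    absprod al Z z <= absprod al Z k + e.
Proof.
move=> e0; have /compact_near_coveringP := cptS.
move=> /(_ R (0^'+) (fun d k => forall z, cdist z k <= 2 * d ->
    absprod al Z z <= absprod al Z k + e)) [|].
  move=> k Sk.
  have e2 : 0 < e / 2 by lra.
  have /cvgrPdist_lt/(_ _ e2)/nbhs_cdist[r r0 hr] := @continuous_absprod _ al Z k.
  exists ([set y | cdist k y < r / 2], [set d | 0 < d < r / 4]).
    split; first by apply: near_cdist; lra.
    near=> d; apply/andP; split; first by [].
    by near: d; apply: nbhs_right_lt; lra.
  move=> [k' d]/= [kk' /andP[d0 dr]] z zk'.
  have h1 := hr z; have h2 := hr k'.
  have /h1 : cdist k z < r.
    by have := cdist_triangle k' k z; rewrite (cdistC k' z); lra.
  have /h2 : cdist k k' < r by lra.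
  by rewrite !ltr_norml => /andP[? ?] /andP[? ?]; lra.
move=> r /= r0 h; exists (r / 2); first lra.
move=> d k z d0 dr Sk zk; apply: (h d) => //.
by rewrite /= sub0r normrN gtr0_norm//; lra.
Unshelve. all: end_near. Qed.

(** Near infinity |P| grows like |z| to the number of zeros and e^(sg U) like |z|^sg, so the strict
    inequality of exponents makes the quotient decay, uniformly in the truncation. *)
Lemma absprod_tpot_infty (al : R) Z (sg B : R) : 0 <= al -> (size Z)%:R < sg -> 0 < B ->
  exists2 M : R, 0 < M & forall z (d : R), M <= cabs z -> 0 < d -> d <= 1 ->
    absprod al Z z * expR (- (sg * tpot d z)) <= B.
Proof.
move=> al0 Zsg B0; have [M M0 SM] := compact_cabs_bounded cptS.
have sg0 : 0 < sg by rewrite (le_lt_trans _ Zsg).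
pose M' := \big[Num.max/1 + M]_(x <- Z) cabs x.
have MM' : 1 + M <= M' by exact: bigmax_ge_id.
have ZM' x : x \in Z -> cabs x <= M' by move=> xZ; exact: le_bigmax_seq.
pose n := size Z; pose A := al * expR (ln 2 * (n%:R + sg)) + 1.
have A0 : 0 < A by rewrite ltr_wpDl// mulr_ge0// expR_ge0.
(* For |z| >= e^T the surplus exponent gains (sg - n) ln|z| >= |ln A - ln B|, enough to bring the
   constant [A] below [B]. *)
pose T := `|ln A - ln B| / (sg - n%:R).
have T0 : 0 <= T by rewrite divr_ge0// subr_ge0 ltW.
exists (2 * M' * expR T); first by rewrite !mulr_gt0 ?expR_gt0//; lra.
move=> z d Mz d0 d1.
have M'0 : 0 < M' by lra.
have eT : 1 <= expR T by rewrite -expR0 ler_expR.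
have zM' : 2 * M' <= cabs z by rewrite (le_trans _ Mz)// ler_peMr//; lra.
have z0 : 0 < cabs z by lra.
have Tz : T <= ln (cabs z).
  rewrite -[leLHS]expRK le_ln ?expR_gt0// (le_trans _ Mz)// ler_peMl ?expR_ge0//; lra.
have l2 : ln (2 : R) >= 0 by apply: ln_ge0; lra.
have hp : ln (cabs z) - ln 2 <= tpot d z.
  rewrite -ln_div ?posrE//; apply: tpot_ge => //; first by rewrite divr_gt0.
  move=> t St; have := cabs_sub_cdist z t; have := SM _ St; lra.
have hP : absprod al Z z <= al * expR (n%:R * (ln 2 + ln (cabs z))).
  rewrite ler_wpM2l// expRM_natl -lnM ?posrE// lnK ?posrE ?mulr_gt0//.
  rewrite (_ : _ ^+ n = \prod_(x <- Z) (2 * cabs z)); last first.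
    by rewrite big_const_seq count_predT iter_mulr_1.
  rewrite big_seq [leRHS]big_seq; apply: ler_prod => x xZ.
  by rewrite cdist_ge0/=; have := cdist_cabs z x; have := ZM' _ xZ; lra.
apply: (@le_trans _ _ (al * expR (n%:R * (ln 2 + ln (cabs z)))
    * expR (- (sg * (ln (cabs z) - ln 2))))).
  apply: ler_pM; rewrite ?expR_ge0 ?absprod_ge0//.
  by rewrite ler_expR lerN2 ler_wpM2l// ltW.
rewrite -mulrA -expRD.
rewrite (_ : _ + _ = ln 2 * (n%:R + sg) + - ((sg - n%:R) * ln (cabs z))); last by ring.
rewrite expRD mulrA.
apply: (@le_trans _ _ (A * expR (- `|ln A - ln B|))).
  apply: ler_pM; rewrite ?mulr_ge0 ?expR_ge0//; first by rewrite /A; lra.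
  rewrite ler_expR lerN2 (_ : `|_| = (sg - n%:R) * T).
    by rewrite ler_wpM2l// subr_ge0 ltW.
  rewrite mulrC divfK// subr_eq0; apply/eqP => E; move: Zsg.
  by rewrite E ltxx.
have -> : A * expR (- `|ln A - ln B|) = expR (ln A - `|ln A - ln B|).
  by rewrite expRD lnK ?posrE.
rewrite -[leRHS]lnK ?posrE// ler_expR.
by have := ler_norm (ln A - ln B); lra.
Qed.

End domination.

Lemma prod4_le {R : realType} (f : R * R -> R) (z : R * R) (r a : R) :
  (forall u, 0 <= f u) -> f (east z r) <= a -> f (west z r) <= a ->
  f (north z r) <= a -> f (south z r) <= a -> prod4 f z r <= a ^+ 4.
Proof.
move=> f0 he hw hn hs; rewrite (_ : a ^+ 4 = a * a * (a * a)); last by ring.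
by apply: ler_pM; rewrite ?mulr_ge0//; exact: ler_pM.
Qed.

Lemma prod4_expR {R : realType} (P f g : R * R -> R) (a b : R) (z : R * R) (r : R) :
  prod4 (fun u => P u * expR (- (a * f u)) * expR (b * g u)) z r
    = prod4 P z r * expR (- (a * sum4 f z r) + b * sum4 g z r).
Proof.
rewrite /prod4 /sum4; move: (east z r) (west z r) (north z r) (south z r).
move=> z1 z2 z3 z4; clear.
have -> : - (a * (f z1 + f z2 + (f z3 + f z4))) + b * (g z1 + g z2 + (g z3 + g z4))
  = - (a * f z1) + b * g z1 + (- (a * f z2) + b * g z2)
    + (- (a * f z3) + b * g z3 + (- (a * f z4) + b * g z4)) by ring.
rewrite !expRD.
move: (expR (- (a * f z1))) (expR (- (a * f z2))) (expR (- (a * f z3)))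
  (expR (- (a * f z4))) (expR (b * g z1)) (expR (b * g z2)) (expR (b * g z3))
  (expR (b * g z4)) => *; ring.
Qed.

Lemma expR4_collect {R : realType} (p a b c x y : R) : 4 * a + 4 * b + c = x + y ->
  (p * expR a * expR b) ^+ 4 * expR c = p ^+ 4 * expR x * expR y.
Proof.
by move=> E; rewrite !exprMn -!expRM_natl -!mulrA -!expRD addrA E.
Qed.

Lemma midfE {R : realType} (u b : R) : (u + b) / 2 = u + (b - u) / 2.
Proof. by field. Qed.

(** * The principle of domination *)

Section domination_principle.
Context {R : realType} (mu : probability (R * R)%type R).
Local Notation S := (msupp mu).
Hypothesis cptS : compact S.
Local Notation tpot := (tpot mu).

Lemma msupp_far z : ~ S z -> exists2 rho : R, 0 < rho & forall t, S t -> rho <= cdist z t.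
Proof.
move=> nSz; have : nbhs z (~` S).
  by apply: open_nbhs_nbhs; split => //; exact/closed_openC/msupp_closed.
move=> /nbhs_cdist[rho rho0 h]; exists rho => // t St.
by rewrite leNgt; apply/negP => /h.
Qed.

(* If [|P| e^{-sg U}] exceeded its bound somewhere, the function perturbed by
   [e^{ep |z|^2}] would have a maximum off the support, where the potential [U]
   is harmonic; the four-point mean then gives a contradiction. *)
Lemma interior_maximum_principle (al : R) Z (sg d B M : R) z0 :
  0 <= al -> 0 < sg -> 0 < d -> 0 < B -> 0 < M ->
  (forall z k, S k -> cdist z k <= 2 * d ->
     absprod al Z z * expR (- (sg * tpot d z)) <= B) ->
  (forall z, M <= cabs z -> absprod al Z z * expR (- (sg * tpot d z)) <= B) ->
  absprod al Z z0 * expR (- (sg * tpot d z0)) <= B.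
Proof.
move=> al0 sg0 d0 B0 M0 nearS nearoo; rewrite leNgt; apply/negP => Bz0.
set P := absprod al Z in nearS nearoo Bz0.
pose H z := P z * expR (- (sg * tpot d z)).
have P0 z : 0 <= P z by exact: absprod_ge0.
have Hge0 z : 0 <= H z by rewrite mulr_ge0 ?expR_ge0.
have G00 : 0 < H z0 by exact: lt_trans Bz0.
(* With this choice e^(ep M^2) is the square root of H z0 / B, so the maximiser of the perturbed
   function still satisfies H > B, which keeps it away from the support and from infinity. *)
pose ep := ln (H z0 / B) / (2 * M ^+ 2).
have HB1 : 1 < H z0 / B by rewrite ltr_pdivlMr// mul1r.
have M2 : 0 < 2 * M ^+ 2 by rewrite mulr_gt0 ?exprn_gt0.
have ep0 : 0 < ep by rewrite divr_gt0// ln_gt0.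
have epM : ep * M ^+ 2 < ln (H z0 / B).
  have -> : ep * M ^+ 2 = ln (H z0 / B) / 2 by rewrite /ep; field; rewrite gt_eqF.
  by have := ln_gt0 HB1; lra.
clearbody ep.
pose G z := H z * expR (ep * cabs z ^+ 2).
have cG : continuous G.
  move=> z; apply: cvgM; first apply: cvgM; first exact: continuous_absprod.
    apply: (@continuous_comp _ _ _ (fun u => - (sg * tpot d u)) expR).
      by apply: cvgN; apply: cvgM; [exact: cvg_cst|exact: continuous_tpot].
    exact: continuous_expR.
  apply: (@continuous_comp _ _ _ (fun u => ep * cabs u ^+ 2) expR).
    apply: cvgM; first exact: cvg_cst.
    by under [X in X @ _]funext do rewrite expr2; rewrite expr2; apply: cvgM; exact: continuous_cabs.
  exact: continuous_expR.
have [] := @compact_EVT_max _ R G [set z | cabs z <= M].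
- by exists (0, 0); rewrite /= cabs_cdist cdistxx ltW.
- exact: compact_disc.
- exact: continuous_subspaceT.
move=> zs; rewrite inE/= => zsM Gmax.
have {}Gmax z : cabs z <= M -> G z <= G zs by move=> zM; apply: Gmax; rewrite inE.
have z0M : cabs z0 < M.
  by rewrite ltNge; apply/negP => /nearoo; rewrite leNgt Bz0.
have Gz0 : H z0 <= G zs.
  apply: le_trans (Gmax z0 (ltW z0M)).
  by rewrite ler_peMr ?(ltW G00)// -expR0 ler_expR mulr_ge0 ?sqr_ge0// ltW.
have Hzs : B < H zs.
  rewrite ltNge; apply/negP => HB; move: Gz0; apply/negP; rewrite -ltNge.
  apply: (@le_lt_trans _ _ (B * expR (ep * M ^+ 2))).
    apply: ler_pM; rewrite ?expR_ge0 ?Hge0//.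
    rewrite ler_expR ler_wpM2l ?(ltW ep0)// lerXn2r ?nnegrE ?(ltW M0) ?cabs_ge0//.
  by rewrite mulrC -ltr_pdivlMr// -[ltRHS]lnK ?posrE ?divr_gt0// ltr_expR.
have Hzs0 : 0 < H zs by exact: lt_trans Hzs.
have zsM' : cabs zs < M.
  by rewrite ltNge; apply/negP => /nearoo; rewrite leNgt Hzs.
have far t : S t -> 2 * d < cdist zs t.
  move=> St; rewrite ltNge; apply/negP => /(nearS _ _ St).
  by rewrite leNgt Hzs.
have Pzs : 0 < P zs.
  by rewrite lt_def P0 andbT; apply: contraTneq Hzs0 => E; rewrite /H E mul0r ltxx.
pose rho := \big[Num.min/1]_(x <- Z) cdist zs x.
have Zpos x : x \in Z -> 0 < cdist zs x.
  move=> xZ; rewrite lt_def cdist_ge0 andbT; apply: contraTneq Pzs => E.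
  by rewrite /P /absprod (big_rem x)//= E mul0r mulr0 ltxx.
have rho0 : 0 < rho.
  rewrite /rho big_seq; elim/big_ind: _ => // x y x0 y0.
  by rewrite lt_min x0 y0.
have Zrho x : x \in Z -> rho <= cdist zs x by move=> xZ; exact: ge_bigmin_seq.
pose n := (size Z)%:R : R.
(* K r^4 collects the fourth-order losses of the zeros and of the potential; the perturbation gains
   4 ep r^2, which is larger once r <= 1 and K r <= ep. *)
pose K := 2 * n / rho ^+ 4 + sg / d ^+ 4.
have K0 : 0 < K.
  have n0 : 0 <= n by rewrite ler0n.
  rewrite ltr_wpDl ?divr_gt0 ?exprn_gt0//.
  by apply: divr_ge0; [exact: mulr_ge0|rewrite exprn_ge0// ltW].
pose r := Num.min (Num.min d (M - cabs zs)) (Num.min (rho / 2) (Num.min 1 (ep / K))).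
have r0 : 0 < r.
  have h1 : 0 < rho / 2 by exact: divr_gt0.
  have h2 : 0 < ep / K by exact: divr_gt0.
  have h3 : 0 < M - cabs zs by rewrite subr_gt0.
  by rewrite /r !lt_min d0 h1 h2 h3 ltr01.
have : r <= r by []; rewrite {2}/r !le_min.
move=> /andP[/andP[rd rM] /and3P[rrho r1 rK]].
clearbody r rho.
have disc u : cdist zs u <= r -> G u <= G zs.
  move=> zsu; apply: Gmax; have := cabs_sub_cdist u zs.
  rewrite (cdistC u) lerBlDr => /le_trans; apply.
  by rewrite -lerBrDr (le_trans zsu).
have G0 z : 0 <= G z by apply: mulr_ge0; [exact: Hge0|exact: expR_ge0].
have le1 : prod4 G zs r <= G zs ^+ 4.
  by have [*] := cdist_four (ltW r0) disc; exact: prod4_le.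
have r4 : 0 <= r ^+ 4 by rewrite exprn_even_ge0.
have hP : P zs ^+ 4 * expR (- (2 * n * (r ^+ 4 / rho ^+ 4))) <= prod4 P zs r.
  apply: prod4_absprod => //.
  rewrite ler_pdivrMr ?exprn_gt0//.
  apply: (@le_trans _ _ ((rho / 2) ^+ 4)).
    by rewrite lerXn2r ?nnegrE ?(ltW r0)// divr_ge0// ltW.
  rewrite exprMn mulrC ler_wpM2r ?exprn_ge0 ?(ltW rho0)// exprVn.
  by rewrite -natrX div1r lef_pV2 ?posrE ?ltr0n// ler_nat.
have hT : sum4 (tpot d) zs r <= 4 * tpot d zs + r ^+ 4 / d ^+ 4.
  apply: sum4_tpot => //; first exact: ltW.
  move=> u t zsu St; move: (far _ St) (cdist_triangle u zs t) zsu rd.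
  by clear; lra.
have : prod4 G zs r = prod4 P zs r
    * expR (- (sg * sum4 (tpot d) zs r) + ep * sum4 (fun u => cabs u ^+ 2) zs r).
  exact: prod4_expR.
move=> E; rewrite E in le1.
have : expR (4 * ep * r ^+ 2 - K * r ^+ 4) <= 1.
  have Gzs4 : 0 < G zs ^+ 4 by rewrite exprn_gt0// mulr_gt0// expR_gt0.
  rewrite -(ler_pM2l Gzs4) mulr1; apply: le_trans le1.
  have -> : G zs ^+ 4 * expR (4 * ep * r ^+ 2 - K * r ^+ 4)
    = (P zs ^+ 4 * expR (- (2 * n * (r ^+ 4 / rho ^+ 4)))) *
      expR (- (sg * (4 * tpot d zs + r ^+ 4 / d ^+ 4))
            + ep * (4 * cabs zs ^+ 2 + 4 * r ^+ 2)).
    apply: expR4_collect; rewrite /K; move: (tpot d zs) (cabs zs); clear => *; ring.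
  rewrite sum4_cabs; apply: ler_pM hP _.
  - by apply: mulr_ge0; [exact: exprn_ge0|exact: expR_ge0].
  - exact: expR_ge0.
  by rewrite ler_expR lerD2r lerN2 ler_wpM2l// ltW.
rewrite expR_le1; apply/negP; rewrite -ltNge.
have -> : 4 * ep * r ^+ 2 - K * r ^+ 4 = r ^+ 2 * (4 * ep - K * r * r) by clear; ring.
rewrite mulr_gt0 ?exprn_gt0//.
have h1 : K * r <= ep by rewrite mulrC -ler_pdivlMr.
have h2 : K * r * r <= ep * 1.
  by apply: ler_pM => //; [rewrite mulr_ge0// ltW|exact: ltW].
by move: h2 ep0; clear; lra.
Qed.

(** When [size Z = n] the quotient |P| e^(-n U) need not vanish at infinity. The exponent is
    therefore raised to n + ta, with [ta] so small that a violation at [z0] persists, and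
    [interior_maximum_principle] applies. *)
Lemma domination (al : R) Z (n : nat) (A Cc : R) : 0 <= al -> 0 <= A -> (size Z <= n)%N ->
  (forall k (d : R), S k -> 0 < d -> - Cc <= tpot d k) ->
  (forall k (d : R), S k -> 0 < d -> absprod al Z k <= A * expR (n%:R * tpot d k)) ->
  forall z (d : R), 0 < d -> absprod al Z z <= A * expR (n%:R * tpot d z).
Proof.
move=> al0 A0 Zn tpotC PS z0 d1 d10; rewrite leNgt; apply/negP => Pz0.
set P := absprod al Z in PS Pz0.
have P0 z : 0 <= P z by exact: absprod_ge0.
have nSz0 : ~ S z0 by move=> /PS/(_ d10); rewrite leNgt Pz0.
have [rho0 rho00 far] := msupp_far nSz0.
have [d2 [d20 d2rho d2d1]] : exists d2 : R, [/\ 0 < d2, d2 <= rho0 & d2 <= d1].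
  by exists (Num.min rho0 d1); rewrite lt_min rho00 d10 !ge_min !lexx orbT.
pose p0 := tpot d2 z0.
have p0E d : 0 < d -> d <= d2 -> tpot d z0 = p0.
  move=> d0 dd2; have h t : S t -> d2 <= cdist z0 t.
    by move=> /far; apply: le_trans.
  by apply: tpot_eq => // t St; apply: le_trans (h t St).
pose V := P z0 * expR (- (n%:R * p0)).
have VA : A < V.
  rewrite /V expRN ltr_pdivlMr; last exact: expR_gt0.
  apply: le_lt_trans Pz0.
  by rewrite ler_wpM2l// ler_expR ler_wpM2l// le_tpot.
have V0 : 0 < V by exact: le_lt_trans VA.
(* A positive substitute for [A], which may be 0 and could not be divided by. *)
have [A1 AA1 A1V] : exists2 A1, A < A1 & A1 < V.
  by exists ((A + V) / 2); have [] := midf_lt VA.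
have A10 : 0 < A1 by exact: le_lt_trans AA1.
have VA1 : 1 < V / A1 by rewrite ltr_pdivlMr// mul1r.
pose q : R := `|Cc + p0| + 1; have q0 : 0 < q by rewrite ltr_wpDl.
(* Since q > Cc + p0, this gives e^(ta (Cc + p0)) <= (V / A1)^(1/2), so with exponent n + ta the
   value [H0] at [z0] still exceeds the bound [U] valid on the support. *)
pose ta := ln (V / A1) / (2 * q).
have lV := ln_gt0 VA1.
have ta0 : 0 < ta by rewrite divr_gt0// mulr_gt0.
pose sg := n%:R + ta.
pose U := A * expR (ta * Cc).
pose H0 := P z0 * expR (- (sg * p0)).
have UH0 : U < H0.
  have -> : H0 = V * expR (- (ta * p0)).
    by rewrite /H0 /V -mulrA -expRD; congr (_ * expR _); rewrite /sg; ring.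
  rewrite expRN ltr_pdivlMr ?expR_gt0// /U -mulrA -expRD -mulrDr.
  apply: (@le_lt_trans _ _ (A1 * expR (ta * q))).
    apply: ler_pM; rewrite ?expR_ge0 ?(ltW AA1)//.
    by rewrite ler_expR ler_wpM2l ?(ltW ta0)// /q; move: (ler_norm (Cc + p0)); clear; lra.
  rewrite mulrC -ltr_pdivlMr// -[ltRHS]lnK ?posrE ?divr_gt0//.
  have -> : ta * q = ln (V / A1) / 2 by rewrite /ta; field; rewrite gt_eqF.
  by rewrite ltr_expR; move: lV; clear; lra.
have U0 : 0 <= U by rewrite mulr_ge0 ?expR_ge0.
have [B UB BH] : exists2 B, U < B & B < H0.
  by exists ((U + H0) / 2); have [] := midf_lt UH0.
have B0 : 0 < B by exact: le_lt_trans UB.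
pose B1 := (U + B) / 2; have [UB1 B1B] : U < B1 /\ B1 < B by have [] := midf_lt UB.
have B10 : 0 < B1 by exact: le_lt_trans UB1.
have BB1 : 1 < B / B1 by rewrite ltr_pdivlMr// mul1r.
have sg0 : 0 < sg by rewrite ltr_wpDl.
(* [e1] and [e2] are the tolerated variations of |P| and of the potential within distance 2 d of the
   support: they turn [U] into at most (U + (B - U) / 2) (B / B1) = B. *)
pose e1 := (B - U) / 2 * expR (- (sg * Cc)).
have e10 : 0 < e1 by rewrite mulr_gt0 ?expR_gt0// divr_gt0// subr_gt0.
pose e2 := ln (B / B1) / sg.
have e20 : 0 < e2 by rewrite divr_gt0// ln_gt0.
have [d3 d30 h3] := tpot_near_support cptS tpotC e20.
have [d4 d40 h4] := absprod_near_support cptS al Z e10.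
have Zsg : (size Z)%:R < sg.
  by apply: (@le_lt_trans _ _ n%:R); [rewrite ler_nat|rewrite ltrDl].
have [M M0 hM] := absprod_tpot_infty cptS al0 Zsg B0.
pose d := Num.min (Num.min d2 1) (Num.min d3 d4).
have d0 : 0 < d by rewrite /d !lt_min d20 ltr01 d30.
have : d <= d by []; rewrite {2}/d !le_min => /andP[/andP[dd2 dd1] /andP[dd3 dd4]].
have : H0 <= B.
  rewrite /H0 -(p0E _ d0 dd2).
  apply: (@interior_maximum_principle _ _ _ _ _ M) => //; last first.
    by move=> z zM; exact: hM.
  move=> z k Sk zk.
  have hp := h3 _ _ _ d0 dd3 Sk zk; have hP := h4 _ _ _ d0 dd4 Sk zk.
  apply: (@le_trans _ _ ((P k + e1) * (expR (- (sg * tpot d k)) * expR (sg * e2)))).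
    apply: ler_pM; rewrite ?expR_ge0 ?absprod_ge0// -expRD ler_expR.
    by move: (ler_wpM2l (ltW sg0) hp); rewrite mulrBr; clear; lra.
  rewrite mulrA (_ : expR (sg * e2) = B / B1); last first.
    by rewrite /e2 mulrC mulfVK ?gt_eqF// lnK// posrE (lt_trans ltr01).
  rewrite mulrA ler_pdivrMr// mulrC ler_wpM2l ?(ltW B0)//.
  have -> : B1 = U + (B - U) / 2 by exact: midfE.
  rewrite mulrDl lerD//.
    apply: (@le_trans _ _ (A * expR (n%:R * tpot d k) * expR (- (sg * tpot d k)))).
      by rewrite ler_wpM2r ?expR_ge0// PS.
    rewrite -mulrA -expRD ler_wpM2l// ler_expR.
    have -> : n%:R * tpot d k + - (sg * tpot d k) = ta * - tpot d k.
      by rewrite /sg; ring.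
    by rewrite ler_wpM2l ?(ltW ta0)//; move: (tpotC _ _ Sk d0); clear; lra.
  rewrite /e1 -mulrA -expRD -[leRHS]mulr1 ler_wpM2l//; first by rewrite divr_ge0// subr_ge0 ltW.
  rewrite -expR0 ler_expR -opprD -mulrDr oppr_le0 mulr_ge0 ?(ltW sg0)//.
  by move: (tpotC _ _ Sk d0); clear; lra.
by rewrite leNgt BH.
Qed.

End domination_principle.

(** * Weak limits of point sequences through coding by binary words *)

(* A nonnegative additive weight [m] on binary words (newest letter first)
   is realised by nested subintervals of [0, 1) of lengths [m w]. *)
Section word_intervals.
Context {R : realType} (m : seq bool -> R).
Hypothesis m_ge0 : forall w, 0 <= m w.
Hypothesis m_nil : m [::] = 1.
Hypothesis m_split : forall w, m w = m (true :: w) + m (false :: w).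

Fixpoint wleft (w : seq bool) : R :=
  if w is b :: w' then wleft w' + (if b then m (false :: w') else 0) else 0.

Fixpoint wordof (k : nat) (s : R) : seq bool :=
  if k is k'.+1 then
    let w := wordof k' s in (wleft w + m (false :: w) <= s) :: w
  else [::].

(** Gives every real a word; the change happens on a null set of the uniform law. *)
Definition clamp01 (s : R) : R := if 0 <= s < 1 then s else 0.

Lemma clamp01_itv s : 0 <= clamp01 s < 1.
Proof. by rewrite /clamp01; case: ifP => //; rewrite lexx ltr01. Qed.

Lemma size_wordof k s : size (wordof k s) = k.
Proof. by elim: k => //= k ->. Qed.

Lemma wordof_itv k s : 0 <= s < 1 ->
  wleft (wordof k s) <= s < wleft (wordof k s) + m (wordof k s).
Proof.
move=> s01; elim: k => [|k /andP[IH1 IH2]] /=; first by rewrite m_nil add0r.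
move: IH2; rewrite m_split; set w := wordof k s in IH1 *.
by case: (leP (wleft w + m (false :: w)) s) => h /=; lra.
Qed.

Lemma wordofE w s : 0 <= s < 1 ->
  (wordof (size w) s == w) = (wleft w <= s < wleft w + m w).
Proof.
move=> s01; apply/eqP/idP => [E|]; first by rewrite -[w]E wordof_itv.
elim: w => //= b w IH.
have mt := m_ge0 (true :: w); have mf := m_ge0 (false :: w).
case: b => /= h.
  have -> : wordof (size w) s = w.
    by apply: IH; rewrite (m_split w); move: h; lra.
  by congr (_ :: _); move: h => /andP[].
have -> : wordof (size w) s = w.
  by apply: IH; rewrite (m_split w); move: h; lra.
congr (_ :: _); apply/negbTE; rewrite -ltNge; move: h => /andP[_].
by rewrite addr0.
Qed.

Lemma measurable_wordof (f : seq bool -> R) k : measurable_fun setT (fun s => f (wordof k s)).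
Proof.
elim: k f => [|k IH] f; first by rewrite /=; apply: measurable_cst.
rewrite [X in measurable_fun _ X](_ : _ = (fun s =>
  if wleft (wordof k s) + m (false :: wordof k s) <= s
  then f (true :: wordof k s) else f (false :: wordof k s))); last first.
  by apply/funext => s /=; case: (_ <= s).
apply: measurable_fun_ifT.
- apply: measurable_fun_ler => //.
  exact: (IH (fun w => wleft w + m (false :: w))).
- exact: (IH (fun w => f (true :: w))).
- exact: (IH (fun w => f (false :: w))).
Qed.

Lemma measurable_clamp01 : measurable_fun setT clamp01.
Proof.
apply: measurable_fun_ifT => //.
by apply: measurable_and; [exact: measurable_fun_ler|exact: measurable_fun_ltr].
Qed.

Definition unif01 : probability (measurableTypeR R) R := uniform_prob (@ltr01 R).

Lemma unif01_itv (a b : R) : 0 <= a -> a <= b -> b <= 1 ->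
  unif01 `[a, b[%classic = (b - a)%:E.
Proof.
move=> a0 ab b1; rewrite /unif01 /= /uniform_prob.
rewrite (eq_integral (fun=> 1%:E)); last first.
  move=> x; rewrite inE/= in_itv/= => /andP[ax xb].
  rewrite /uniform_pdf subr0 invr1 ifT//; apply/andP; split; lra.
rewrite integral_cst//= mul1e lebesgue_measure_itv/= lte_fin.
by case: ltP => // ba; congr (_%:E); lra.
Qed.

Lemma wleft_itv w : 0 <= wleft w /\ wleft w + m w <= 1.
Proof.
elim: w => [|b w [IH1 IH2]] /=; first by rewrite m_nil add0r.
rewrite (m_split w) in IH2.
have mt := m_ge0 (true :: w); have mf := m_ge0 (false :: w).
by case: b; lra.
Qed.

Definition unifword k s := wordof k (clamp01 s).

Lemma measurable_unifword (f : seq bool -> R) k :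
  measurable_fun setT (fun s => f (unifword k s)).
Proof.
exact: (measurableT_comp (measurable_wordof f k) measurable_clamp01).
Qed.

Lemma measurable_unifword_eq k w : measurable [set s | unifword k s == w].
Proof.
rewrite (_ : [set _ | _] = (fun s => (unifword k s == w)%:R : R) @^-1` [set 1]).
  rewrite -[X in measurable X]setTI.
  exact: (measurable_unifword (fun v => (v == w)%:R : R)).
apply/seteqP; split => s /=; first by move=> ->.
by case: (_ == _) => //= /esym/eqP; rewrite oner_eq0.
Qed.

Lemma unif01_word w : unif01 [set s | unifword (size w) s == w] = (m w)%:E.
Proof.
have [l0 l1] := wleft_itv w; have mw := m_ge0 w.
have U1 : unif01 `[0, 1[%classic = 1%E by rewrite unif01_itv ?subr0.
have mI : measurable (`[0, 1[%classic : set R) by exact: measurable_itv.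
have UC : unif01 (~` `[0, 1[%classic) = 0%E.
  by rewrite probability_setC// U1 subee.
have mA := @measurable_unifword_eq (size w) w.
set A := [set s | _] in mA *.
have -> : unif01 A = unif01 (A `&` `[0, 1[%classic).
  rewrite -[in LHS](setIT A) -(setUv `[0, 1[%classic) setIUr measureU//.
  - rewrite [X in (_ + X)%E](_ : _ = 0%E) ?adde0//.
    apply/eqP; rewrite eq_le measure_ge0 andbT -UC le_measure// inE.
      by apply: measurableI => //; exact: measurableC.
    exact: measurableC.
  - exact: measurableI.
  - by apply: measurableI => //; exact: measurableC.
  - by rewrite setIACA setICr setI0.
have -> : A `&` `[0, 1[%classic = `[wleft w, wleft w + m w[%classic.
  apply/seteqP; split => s /=; rewrite !in_itv/=.
    move=> [+ s01]; rewrite /A/= /unifword /clamp01 s01.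
    by rewrite wordofE.
  move=> h; have s01 : 0 <= s < 1 by lra.
  by rewrite /A /= /unifword /clamp01 s01 wordofE.
by rewrite unif01_itv//; [congr (_%:E); lra|lra].
Qed.

Lemma integral_unifword (f : seq bool -> R) k : (forall w, 0 <= f w) ->
  (\int[unif01]_s (f (unifword k s))%:E =
   (\sum_(w : k.-tuple bool) f w * m w)%:E)%E.
Proof.
move=> f0.
pose A (w : seq bool) : set (measurableTypeR R) := [set s | unifword k s == w].
have mA w : measurable (A w) by exact: measurable_unifword_eq.
pose g (w : k.-tuple bool) (s : measurableTypeR R) := ((f w)%:E * (\1_(A w) s)%:E)%E.
transitivity (\int[unif01]_s (\sum_(w : k.-tuple bool) g w s))%E.
  apply: eq_integral => s _; have sz : size (unifword k s) == k by rewrite size_wordof.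
  rewrite (bigD1 (Tuple sz))//= /g indicE mem_set/= ?mule1; last by rewrite /A/= eqxx.
  rewrite big1 ?adde0// => w; rewrite -val_eqE/= => ws.
  by rewrite indicE memNset ?mule0//= /A/= eq_sym; apply/negP.
rewrite ge0_integral_sum//; first last.
- by move=> w s _; rewrite mule_ge0// lee_fin.
- by move=> w; exact/measurable_funeM/measurable_EFinP/measurable_indic.
rewrite -sumEFin; apply: eq_bigr => w _.
rewrite ge0_integralZl//; last by rewrite lee_fin.
  rewrite integral_indic// setIT EFinM; congr (_ * _)%E.
  by have := unif01_word w; rewrite size_tuple.
exact/measurable_EFinP/measurable_indic.
Qed.

End word_intervals.

Section truncated_kernel.
Context {R : realType}.
Local Notation CC := (R * R)%type.
Implicit Types (x y : CC) (e : R).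

(** Capping the distance at 1 makes the kernel nonnegative, so Tonelli and monotone convergence
    apply; the floor [e] makes it finite and Lipschitz. *)
Definition tkernel e x y : R := - ln (Num.max (Num.min (cdist x y) 1) e).

Lemma tkernelC e x y : tkernel e x y = tkernel e y x.
Proof. by rewrite /tkernel cdistC. Qed.

Lemma tkernelxx e x : 0 < e -> tkernel e x x = - ln e.
Proof. by move=> e0; rewrite /tkernel cdistxx minElt ltr01 maxElt e0. Qed.

Lemma tkernel_ge0 e x y : e <= 1 -> 0 <= tkernel e x y.
Proof. by move=> e1; rewrite oppr_ge0 ln_le0// ge_max e1 ge_min lexx orbT. Qed.

Lemma tkernel_lipschitz e x y x' y' : 0 < e ->
  tkernel e x y <= tkernel e x' y' + e^-1 * (cdist x x' + cdist y y').
Proof.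
move=> e0; rewrite addrC -lerBlDr opprK addrC.
apply: (le_trans (ln_max_lipschitz _ _ e0)); rewrite ler_wpM2l ?invr_ge0 ?(ltW e0)//.
have h1 := cdist_triangle x' x y; have h2 := cdist_triangle y' x' y.
have h3 := cdist_triangle x x' y'; have h4 := cdist_triangle y x y'.
rewrite (cdistC x' x) in h3; rewrite (cdistC y' y) in h2.
by rewrite ler_norml; case: (ltP (cdist x' y') 1) => ?;
  case: (ltP (cdist x y) 1) => ?; apply/andP; split; lra.
Qed.

Lemma tkernel_le e x y (D : R) : 0 < e -> 1 <= D -> 0 < cdist x y -> cdist x y <= D ->
  tkernel e x y <= - ln (cdist x y) + ln D.
Proof.
move=> e0 D1 xy0 xyD; have D0 : 0 < D by exact: lt_le_trans D1.
rewrite /tkernel -lerBlDr -opprD lerN2 -lnM ?posrE ?max_gt0//.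
rewrite le_ln// (@le_trans _ _ (Num.min (cdist x y) 1 * D))//; last first.
  by rewrite ler_wpM2r ?(ltW D0)// le_max lexx.
by rewrite minElt; case: ltP => _; rewrite ?mul1r// ler_peMr// ltW.
Qed.

End truncated_kernel.

(* The letters of the word of a point record on which side of an enumeration of
   rational vertical and horizontal lines the point lies. *)
Section plane_words.
Context {R : realType}.
Local Notation CC := (R * R)%type.
Implicit Types (x y : CC).

Definition coord (b : bool) x : R := if b then x.1 else x.2.

Definition letter (k : nat) x : bool :=
  if @unpickle (bool * int * nat)%type k is Some (b, j, N) then
    coord b x < j%:~R / N.+1%:R else false.

Fixpoint word (k : nat) x : seq bool :=
  if k is k'.+1 then letter k' x :: word k' x else [::].

Lemma size_word k x : size (word k x) = k.
Proof. by elim: k => //= k ->. Qed.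

Lemma eq_word k k' x y : (k <= k')%N -> word k' x = word k' y -> word k x = word k y.
Proof.
elim: k' => [|k' IH]; first by rewrite leqn0 => /eqP ->.
by rewrite leq_eqVlt => /predU1P[->//|]; rewrite ltnS => /IH + /= [_]; exact.
Qed.

Lemma eq_letter k k' x y : (k < k')%N -> word k' x = word k' y ->
  letter k x = letter k y.
Proof. by move=> /eq_word/[apply] /= -[]. Qed.

(** Two points of the disc with a coordinate differing by more than e / 2 are separated by a line at
    some j / (N+1). Only finitely many such lines matter, and [k0] exceeds all their codes. *)
Lemma word_close (M e : R) : 0 < e -> exists k0, forall x y,
  cabs x <= M -> cabs y <= M -> word k0 x = word k0 y -> cdist x y <= e.
Proof.
move=> e0; have e2 : 0 < e / 2 by lra.
have [N _ /(_ N (leqnn N)) /= hN] := near_infty_natSinv_lt (PosNum e2).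
pose B := (Num.truncn (`|M| * N.+1%:R)).+2.
have hB : `|M| * N.+1%:R + 1 <= B%:R :> R.
  have MN0 : 0 <= `|M| * N.+1%:R by rewrite mulr_ge0.
  have /andP[_ /ltW h] := truncn_itv MN0.
  have -> : B%:R = (Num.truncn (`|M| * N.+1%:R)).+1%:R + 1 :> R by rewrite natr1.
  by rewrite lerD2r.
pose k0 := (\max_(i < B.*2.+1) \max_(b : bool) (pickle (b, (i%:Z - B%:Z)%R, N))).+1.
have N0 : 0 < N.+1%:R :> R by rewrite ltr0n.
exists k0 => x y xM yM xy.
suff close b u v : word k0 u = word k0 v -> cabs u <= M -> cabs v <= M ->
    coord b v - coord b u <= e / 2.
  have h1 := close true x y xy xM yM; have h2 := close true y x (esym xy) yM xM.
  have h3 := close false x y xy xM yM; have h4 := close false y x (esym xy) yM xM.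
  rewrite [leRHS](_ : e = 2 * (e / 2)); last by field.
  by apply: cdist_sup_le; rewrite ler_norml; apply/andP; split;
    rewrite /coord in h1 h2 h3 h4; lra.
move=> uv uM vM; rewrite leNgt; apply/negP => far.
(* The last grid line not beyond [v]; as 1 / (N+1) < e / 2, it lies strictly beyond [u]. *)
pose j := Num.floor (coord b v * N.+1%:R).
have /andP[j1 j2] := floor_itv (coord b v * N.+1%:R).
rewrite -/j in j1 j2.
have vb : `|coord b v| <= `|M|.
  have cvv : `|coord b v| <= cabs v.
    rewrite cabs_cdist; have := le_cdist1 v (0, 0); have := le_cdist2 v (0, 0).
    by rewrite /= !subr0 /coord => *; case: ifP.
  by rewrite (le_trans cvv)// (le_trans vM)// ler_norm.
have jB : `|j%:~R| <= B%:R :> R.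
  have vN : `|coord b v * N.+1%:R| <= `|M| * N.+1%:R.
    by rewrite normrM (gtr0_norm N0) ler_wpM2r// ltW.
  move: vN; rewrite !ler_norml => /andP[v1 v2]; rewrite intrD in j2.
  by apply/andP; split; lra.
have [i iB ij] : exists2 i : nat, (i < B.*2.+1)%N & j = i%:Z - B%:Z.
  have jB' : (`|j| <= B%:Z)%R by rewrite -(@ler_int R) intr_norm.
  have jB0 : 0 <= j + B%:Z.
    by move: jB'; rewrite ler_norml => /andP[+ _]; rewrite -lerBlDr sub0r.
  have [i ji] : exists i : nat, j + B%:Z = i%:Z by case: (j + B%:Z) jB0 => // i _; exists i.
  exists i; last by rewrite -ji addrK.
  rewrite ltnS -lez_nat -ji -addnn PoszD lerD2r.
  by move: jB'; rewrite ler_norml => /andP[].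
have hk : (pickle (b, j, N) < k0)%N.
  rewrite /k0 ltnS ij.
  apply: (leq_trans _ (leq_bigmax (Ordinal iB))) => /=.
  exact: (leq_bigmax b).
have := eq_letter hk uv; rewrite /letter pickleK.
have -> : coord b u < j%:~R / N.+1%:R.
  rewrite ltr_pdivlMr//; rewrite intrD in j2.
  have : 1 < e / 2 * N.+1%:R by rewrite mulrC -ltr_pdivrMl// mulr1.
  have : (e / 2) * N.+1%:R < (coord b v - coord b u) * N.+1%:R by rewrite ltr_pM2r.
  rewrite mulrBl; lra.
by move=> /esym; rewrite ltr_pdivlMr// ltNge j1.
Qed.

End plane_words.

Lemma ultrafilter_cvg01 {R : realType} (T : Type) (U : set_system T) (u : T -> R) :
  UltraFilter U -> (forall i, 0 <= u i <= 1) -> exists p : R, u @ U --> p.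
Proof.
move=> UU u01; have UP : ProperFilter U by exact: ultra_proper.
have UI : U (u @^-1` [set` `[0, 1]%R]).
  by apply: filterE => i; rewrite /= in_itv/=; exact: u01.
have [p [_ clp]] := @segment_compact R 0 1 (u @ U) _ UI.
exists p => V pV; have [//|UnV] := in_ultra_setVsetC (u @^-1` V) UU.
have [y []] := clp (~` V) V UnV pV.
by [].
Qed.

Lemma cvg_bigsum {R : realType} (T : Type) (F : set_system T) (FF : Filter F)
    (I : Type) (r : seq I) (g : I -> T -> R) (l : I -> R) :
  (forall i, g i @ F --> l i) ->
  (fun n => \sum_(i <- r) g i n) @ F --> \sum_(i <- r) l i.
Proof.
move=> gl; elim: r => [|i r IH].
  rewrite big_nil; under [X in X @ _]funext do rewrite big_nil.
  exact: cvg_cst.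
rewrite big_cons; under [X in X @ _]funext do rewrite big_cons.
by apply: cvgD; [exact: gl|exact: IH].
Qed.

Section weak_limit.
Context {R : realType}.
Local Notation CC := (R * R)%type.
Variable x : nat -> CC.

Definition freq (n : nat) (w : seq bool) : R :=
  (\sum_(i < n.+1) (word (size w) (x i) == w)%:R) / n.+1%:R.

Lemma freq01 n w : 0 <= freq n w <= 1.
Proof.
have n0 : 0 < n.+1%:R :> R by rewrite ltr0n.
rewrite divr_ge0 ?sumr_ge0//= ler_pdivrMr// mul1r.
rewrite -[leRHS]mulr_natl mulr1 -[X in _ <= X%:R]card_ord -sumr_const.
by apply: ler_sum => i _; case: (_ == _) => //=; exact: ler01.
Qed.

Lemma freq_nil n : freq n [::] = 1.
Proof.
rewrite /freq /= (eq_bigr (fun=> 1))//.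
by rewrite sumr_const card_ord divff// pnatr_eq0.
Qed.

Lemma freq_split n w : freq n w = freq n (true :: w) + freq n (false :: w).
Proof.
rewrite /freq -mulrDl -big_split/=; congr (_ / _); apply: eq_bigr => i _.
rewrite !eqseq_cons; case: (letter _ _) => /=; by rewrite ?addr0 ?add0r.
Qed.

Lemma freq_sum n k (f : seq bool -> R) :
  \sum_(w : k.-tuple bool) f w * freq n w =
  (\sum_(i < n.+1) f (word k (x i))) / n.+1%:R.
Proof.
rewrite mulr_suml /freq.
under eq_bigr do rewrite mulrA mulr_sumr mulr_suml.
rewrite exchange_big/=; apply: eq_bigr => i _.
have sz : size (word k (x i)) == k by rewrite size_word.
rewrite (bigD1 (Tuple sz))//= size_word eqxx mulr1 big1 ?addr0// => w.
rewrite -val_eqE/= size_tuple => /negbTE; rewrite eq_sym => ->.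
by rewrite mulr0 mul0r.
Qed.

(** One ultrafilter makes the frequencies of all words converge at once, in place of a diagonal
    subsequence. *)
Lemma limit_weights : exists (U : set_system nat) (m : seq bool -> R),
  [/\ ProperFilter U, \oo `<=` U & forall w, freq ^~ w @ U --> m w].
Proof.
have [U [UU ooU]] := @ultraFilterLemma nat \oo _.
have /choice[m hm] : forall w, exists p : R, freq ^~ w @ U --> p.
  by move=> w; apply: ultrafilter_cvg01 => // n; exact: freq01.
by exists U, m; split => //; exact: ultra_proper.
Qed.

Section with_weights.
Variables (U : set_system nat) (m : seq bool -> R).
Context {UP : ProperFilter U}.
Hypothesis ooU : \oo `<=` U.
Hypothesis freq_m : forall w, freq ^~ w @ U --> m w.

Lemma weight_ge0 w : 0 <= m w.
Proof.
apply: (cvgr_to_ge (@freq_m w)).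
by apply: filterE => n; case/andP: (freq01 n w).
Qed.

Lemma weight_nil : m [::] = 1.
Proof.
apply: (cvg_unique _ (@freq_m [::])); first exact: Rhausdorff.
by under [X in X @ _]funext do rewrite freq_nil; exact: cvg_cst.
Qed.

Lemma weight_split w : m w = m (true :: w) + m (false :: w).
Proof.
apply: (cvg_unique _ (@freq_m w)); first exact: Rhausdorff.
under [X in X @ _]funext do rewrite freq_split.
by apply: cvgD; exact: freq_m.
Qed.

Lemma weight_gt0 w : 0 < m w -> exists i, word (size w) (x i) = w.
Proof.
move=> mw; apply: contrapT => h; move: mw.
suff -> : m w = 0 by rewrite ltxx.
apply: (cvg_unique _ (@freq_m w)); first exact: Rhausdorff.
rewrite [X in X @ _](_ : _ = fun=> 0); first exact: cvg_cst.
apply/funext => n; rewrite /freq big1 ?mul0r// => i _.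
by case: eqP => // E; exfalso; apply: h; exists i.
Qed.

(** For a fixed word length the double average is a polynomial in finitely many frequencies, so it
    passes to the limit. *)
Lemma double_weight_le (k : nat) (f : seq bool -> seq bool -> R) (C : R) :
  (\forall n \near \oo, (\sum_(i < n.+1) \sum_(j < n.+1)
     f (word k (x i)) (word k (x j))) / n.+1%:R ^+ 2 <= C) ->
  \sum_(w : k.-tuple bool) (\sum_(v : k.-tuple bool) f w v * m v) * m w <= C.
Proof.
move=> fC.
have cv : (fun n => \sum_(w : k.-tuple bool)
      (\sum_(v : k.-tuple bool) f w v * freq n v) * freq n w) @ U -->
    \sum_(w : k.-tuple bool) (\sum_(v : k.-tuple bool) f w v * m v) * m w.
  apply: cvg_bigsum => w; apply: cvgM; last exact: freq_m.
  by apply: cvg_bigsum => v; apply: cvgM; [exact: cvg_cst|exact: freq_m].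
apply: (cvgr_to_le cv); apply: ooU; apply: filterS fC => n.
have -> : \sum_(w : k.-tuple bool) (\sum_(v : k.-tuple bool) f w v * freq n v) * freq n w
    = (\sum_(i < n.+1) \sum_(j < n.+1) f (word k (x i)) (word k (x j))) / n.+1%:R ^+ 2.
  rewrite (@freq_sum n k (fun w => \sum_(v : k.-tuple bool) f w v * freq n v)).
  under eq_bigr do rewrite freq_sum.
  by rewrite -mulr_suml expr2 invfM mulrA.
by [].
Qed.

End with_weights.
End weak_limit.

Lemma uniform_cauchy_cvgn {R : realType} (u : nat -> R) :
  (forall e : R, 0 < e -> exists k0, forall k, (k0 <= k)%N -> `|u k0 - u k| <= e) ->
  cvgn u.
Proof.
move=> h; apply/cauchy_cvgP/cauchy_exP => e e0.
have e2 : 0 < e / 2 by lra.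
have [k0 hk0] := h _ e2; exists (u k0).
exists k0 => // k /= /hk0 hk; rewrite /ball/=.
by apply: le_lt_trans hk _; lra.
Qed.

Section random_point.
Context {R : realType}.
Local Notation CC := (R * R)%type.
Variables (K : set CC) (m : seq bool -> R) (rep : seq bool -> CC).
Hypothesis cptK : compact K.
Hypothesis m_nil : m [::] = 1.
Hypothesis m_split : forall w, m w = m (true :: w) + m (false :: w).
Hypothesis Krep : forall w, K (rep w).
Hypothesis rep_word : forall w, 0 < m w -> word (size w) (rep w) = w.

Local Notation uword := (unifword m).

Lemma word_prefix k k' (y : CC) s : (k <= k')%N ->
  word k' y = uword k' s -> word k y = uword k s.
Proof.
elim: k' => [|k' IH]; first by rewrite leqn0 => /eqP ->.
by rewrite leq_eqVlt => /predU1P[->//|]; rewrite ltnS => /IH + /= [_]; exact.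
Qed.

Lemma word_rep k s : word k (rep (uword k s)) = uword k s.
Proof.
have := @rep_word (uword k s); rewrite size_wordof; apply.
(* The half-open interval of this word contains a point, so its weight is positive. *)
have := wordof_itv m_nil m_split k (clamp01_itv s).
by rewrite -/(uword k s); lra.
Qed.

Lemma rep_close (e : R) : 0 < e -> exists k0, forall k k' (s : R),
  (k0 <= k)%N -> (k0 <= k')%N -> cdist (rep (uword k s)) (rep (uword k' s)) <= e.
Proof.
move=> e0; have [M M0 KM] := compact_cabs_bounded cptK.
have [k0 hk0] := word_close M e0; exists k0 => k k' s kk kk'.
apply: hk0; [exact/KM/Krep|exact/KM/Krep|].
by rewrite (word_prefix kk (word_rep _ _)) (word_prefix kk' (word_rep _ _)).
Qed.

(** The representatives of longer and longer prefixes of the word of [s] form a Cauchy sequence,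
    uniformly in [s]. Under the uniform law its limit is distributed like the weak limit of the
    empirical measures. *)
Lemma random_point : exists psi : measurableTypeR R -> CC,
  [/\ measurable_fun setT psi, (forall s, K (psi s)) &
    forall e : R, 0 < e -> exists k0, forall k (s : R), (k0 <= k)%N ->
      cdist (psi s) (rep (uword k s)) <= e].
Proof.
have cv1 s : cvgn (fun k => (rep (uword k s)).1).
  apply: uniform_cauchy_cvgn => e e0; have [k0 hk0] := rep_close e0.
  by exists k0 => k kk; apply: le_trans (le_cdist1 _ _) _; exact: hk0.
have cv2 s : cvgn (fun k => (rep (uword k s)).2).
  apply: uniform_cauchy_cvgn => e e0; have [k0 hk0] := rep_close e0.
  by exists k0 => k kk; apply: le_trans (le_cdist2 _ _) _; exact: hk0.
pose psi (s : measurableTypeR R) : CC :=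
  (limn (fun k => (rep (uword k s)).1), limn (fun k => (rep (uword k s)).2)).
have close (e : R) : 0 < e -> exists k0, forall k (s : R), (k0 <= k)%N ->
    cdist (psi s) (rep (uword k s)) <= e.
  move=> e0; have e4 : 0 < e / 4 by lra.
  have [k0 hk0] := rep_close e4; exists k0 => k s kk.
  have [/cvgrPdist_lt/(_ _ e4) n1 /cvgrPdist_lt/(_ _ e4) n2] := (cv1 s, cv2 s).
  have [N [NN N1 N2]] : exists N, [/\ (k0 <= N)%N,
      `|(psi s).1 - (rep (uword N s)).1| < e / 4 &
      `|(psi s).2 - (rep (uword N s)).2| < e / 4].
    have : \forall n \near \oo, [/\ (k0 <= n)%N,
      `|(psi s).1 - (rep (uword n s)).1| < e / 4 &
      `|(psi s).2 - (rep (uword n s)).2| < e / 4].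
      near=> n; split; [near: n; exact: nbhs_infty_ge|near: n; exact: n1|near: n; exact: n2].
    by move=> [N _ /(_ N (leqnn N))]; exists N.
  have h1 : cdist (psi s) (rep (uword N s)) <= 2 * (e / 4).
    by apply: cdist_sup_le; exact: ltW.
  have h2 := hk0 N k s NN kk.
  have := cdist_triangle (rep (uword N s)) (psi s) (rep (uword k s)); lra.
exists psi; split.
- apply: measurable_fun_pair.
    apply: (measurable_fun_cvg (h := fun k s => (rep (uword k s)).1)).
      by move=> k; exact: (measurable_unifword m (fun w => (rep w).1) k).
    by move=> s _; exact: cv1.
  apply: (measurable_fun_cvg (h := fun k s => (rep (uword k s)).2)).
    by move=> k; exact: (measurable_unifword m (fun w => (rep w).2) k).
  by move=> s _; exact: cv2.
- move=> s; apply: (compact_closed_plane cptK) => V /nbhs_cdist[e e0 eV].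
  have e2 : 0 < e / 2 by lra.
  have [k hk] := close _ e2; exists (rep (uword k s)); split; first exact: Krep.
  by apply: eV; have := hk k s (leqnn k); lra.
- exact: close.
Unshelve. all: end_near. Qed.

End random_point.

Lemma measurable_cdist {R : realType} :
  measurable_fun setT (fun p : (R * R) * (R * R) => cdist p.1 p.2).
Proof.
apply: (@measurableT_comp _ _ _ _ _ _ (@Num.sqrt R)).
  by apply: continuous_measurable_fun; exact: sqrt_continuous.
apply: measurable_funD; apply: measurable_funX; apply: measurable_funB;
  exact: measurableT_comp.
Qed.

(** * Energy of the limit measure *)

Section capacity_of_limit.
Context {R : realType}.
Local Notation CC := (R * R)%type.
Variables (K : set CC) (x : nat -> CC) (L : R).
Hypothesis cptK : compact K.
Hypothesis Kx : forall n, K (x n).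
Hypothesis energyL : forall (e : R) n, 0 < e -> e <= 1 ->
  \sum_(i < n) \sum_(j < n) tkernel e (x i) (x j) <= L * n%:R ^+ 2 - n%:R * ln e.

Lemma log_energy_le (nu : probability CC R) :
  (forall e : R, (0 < e)%R -> (e <= 1)%R ->
    \int[nu]_z \int[nu]_t (tkernel e z t)%:E <= L%:E)%E ->
  (log_energy nu <= L%:E)%E.
Proof.
move=> h; pose g (p : CC * CC) : R := Num.min (cdist p.1 p.2) 1.
have mg : measurable_fun setT g.
  by apply: measurable_minr => //; exact: measurable_cdist.
have g1 p : g p <= 1 by rewrite ge_min lexx orbT.
apply: (@le_trans _ _ (\int[nu]_z \int[nu]_t (0%:E - elog (g (z, t))%:E))%E).
  apply: pointwise_le_integral => z _; apply: pointwise_le_integral => t _.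
  by rewrite add0e leeN2; apply: le_elog; rewrite lee_fin ge_min lexx.
have -> : (\int[nu]_z \int[nu]_t (0%:E - elog (g (z, t))%:E) =
    \int[nu \x nu]_p (0%:E - elog (g p)%:E))%E.
  rewrite (@fubini_tonelli1 _ _ _ _ _ nu nu (fun p => 0%:E - elog (g p)%:E)%E)//.
    by apply: emeasurable_funB => //; exact: measurable_elog.
  move=> p; have : (elog (g p)%:E <= 0)%E.
    rewrite (_ : 0%E = elog 1%:E); last by rewrite elogE// ln1.
    by apply: le_elog; rewrite lee_fin.
  by case: (elog _) => [r| |]//=; rewrite ?leey// -EFinB !lee_fin sub0r oppr_ge0.
apply: truncated_log_integral => //; first by move=> p _; rewrite expR0.
move=> e /andP[e0 e1].
rewrite (@fubini_tonelli1 _ _ _ _ _ nu nu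
  (fun p => (0 - ln (Num.max (g p) e))%:E)).
- apply: le_trans (h _ e0 e1); apply: pointwise_le_integral => z _.
  by apply: pointwise_le_integral => t _; rewrite /= sub0r.
- apply/measurable_EFinP; apply: measurable_funB => //.
  by apply: measurableT_comp => //; exact: measurable_maxr.
- by move=> p; rewrite lee_fin sub0r; exact: tkernel_ge0.
Qed.

(** For fixed [e] the truncated energy of the law of [psi] is within any tolerance of the averages
    bounded by [energyL], whose diagonal term is negligible against n^2. The resulting bound [L]
    does not depend on [e], so it passes to the full energy. *)
Lemma pos_log_cap_limit : pos_log_cap K.
Proof.
have [U [m [UP ooU fm]]] := limit_weights x.
have mge0 w : 0 <= m w by exact: weight_ge0 fm w.
have mnil : m [::] = 1 by exact: weight_nil fm.
have msplit w : m w = m (true :: w) + m (false :: w) by exact: weight_split fm w.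
(* A word that no point of the sequence has carries weight zero and is never a prefix of the random
   word, so its representative is arbitrary. *)
have /choice[rep hrep] : forall w, exists y : CC, K y /\
    ((exists i, word (size w) (x i) = w) -> word (size w) y = w).
  move=> w; have [[i wi]|nw] := pselect (exists i, word (size w) (x i) = w).
    by exists (x i).
  by exists (x 0%N).
have Krep w : K (rep w) by case: (hrep w).
have rep_word w : 0 < m w -> word (size w) (rep w) = w.
  by move=> mw; case: (hrep w) => _; apply; exact: (weight_gt0 fm mw).
have [psi [mpsi Kpsi close]] := random_point cptK mnil msplit Krep rep_word.
pose mX := isMeasurableFun.Build _ _ _ _ _ mpsi.
pose X : {mfun measurableTypeR R >-> CC} := HB.pack psi mX.
pose nu : probability CC R := distribution (unif01 (R := R)) X.
exists nu, K; split => //.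
  rewrite /nu /= /distribution /pushforward/= (_ : psi @^-1` K = setT).
    exact: probability_setT.
  by apply/seteqP; split => // s _; exact: Kpsi.
apply: (@le_lt_trans _ _ L%:E); last exact: ltry.
apply: log_energy_le => e e0 e1.
have mk : measurable_fun setT (fun p : CC * CC => (tkernel e p.1 p.2)%:E).
  apply/measurable_EFinP; apply: measurableT_comp => //.
  apply: measurableT_comp => //; apply: measurable_maxr => //.
  by apply: measurable_minr => //; exact: measurable_cdist.
have k0 z t : (0 <= (tkernel e z t)%:E)%E by rewrite lee_fin tkernel_ge0.
have mkz z : measurable_fun setT (fun t => (tkernel e z t)%:E).
  apply/measurable_EFinP; apply: measurableT_comp => //.
  apply: measurableT_comp => //; apply: measurable_maxr => //.
  apply: measurable_minr => //; apply: continuous_measurable_plane.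
  exact: continuous_cdistr.
have -> : (\int[nu]_z \int[nu]_t (tkernel e z t)%:E =
    \int[unif01 (R := R)]_s \int[unif01 (R := R)]_r (tkernel e (psi s) (psi r))%:E)%E.
  transitivity (\int[unif01 (R := R)]_s \int[nu]_t (tkernel e (psi s) t)%:E)%E.
    rewrite [LHS]ge0_integral_distribution//; last first.
      by move=> z; apply: integral_ge0 => t _; exact: k0.
    exact: (@measurable_fun_fubini_tonelli_F _ _ _ _ _ nu _ mk (fun p => k0 p.1 p.2)).
  apply: eq_integral => s _.
  by rewrite [LHS]ge0_integral_distribution.
apply/lee_addgt0Pr => ep ep0; rewrite -EFinD.
(* Four displacements of size [et] (two points moved to representatives, then to terms of the
   sequence) cost 4 et / e = ep / 2; the other half absorbs the diagonal. *)
pose et := e * ep / 8; have et0 : 0 < et by rewrite /et divr_gt0// mulr_gt0.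
have [M M0 KM] := compact_cabs_bounded cptK.
have [k1 hk1] := close _ et0; have [k2 hk2] := word_close M et0.
pose k := maxn k1 k2.
pose f w v := tkernel e (rep w) (rep v) + e^-1 * (et + et).
have f0 w v : 0 <= f w v.
  by rewrite addr_ge0 ?tkernel_ge0// mulr_ge0 ?invr_ge0 ?addr_ge0// ltW.
apply: (@le_trans _ _ (\int[unif01 (R := R)]_s \int[unif01 (R := R)]_r
    (f (unifword m k s) (unifword m k r))%:E)%E).
  apply: pointwise_le_integral => s _; apply: pointwise_le_integral => r _.
  rewrite lee_fin; apply: (le_trans (tkernel_lipschitz _ _ (rep (unifword m k s))
    (rep (unifword m k r)) e0)).
  rewrite /f lerD2l ler_wpM2l ?invr_ge0 ?(ltW e0)//.
  by apply: lerD; apply: hk1; exact: leq_maxl.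
under eq_integral => s _ do rewrite (integral_unifword mge0 mnil msplit k (f0 _)).
rewrite (integral_unifword mge0 mnil msplit k (f := fun w =>
   \sum_(v : k.-tuple bool) f w v * m v)); last first.
  by move=> w; apply: sumr_ge0 => v _; rewrite mulr_ge0.
rewrite lee_fin; apply: (double_weight_le ooU fm).
have rep_close i : cdist (rep (word k (x i))) (x i) <= et.
  apply: hk2; [exact/KM/Krep|exact/KM/Kx|].
  apply: (@eq_word _ _ k); first exact: leq_maxr.
  by case: (hrep (word k (x i))) => _; rewrite size_word; apply; exists i.
near=> n; have n0 : 0 < n.+1%:R :> R by rewrite ltr0n.
rewrite ler_pdivrMr ?exprn_gt0//.
apply: (@le_trans _ _ (\sum_(i < n.+1) \sum_(j < n.+1)
    (tkernel e (x i) (x j) + e^-1 * (4 * et)))).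
  apply: ler_sum => i _; apply: ler_sum => j _; rewrite /f.
  have := tkernel_lipschitz (rep (word k (x i))) (rep (word k (x j))) (x i) (x j) e0.
  have : e^-1 * (cdist (rep (word k (x i))) (x i) + cdist (rep (word k (x j))) (x j))
      <= e^-1 * (et + et).
    by rewrite ler_wpM2l ?invr_ge0 ?(ltW e0)// lerD.
  by lra.
under eq_bigr do rewrite big_split/= sumr_const card_ord.
rewrite big_split/= sumr_const card_ord -mulrnA.
apply: (@le_trans _ _ (L * n.+1%:R ^+ 2 - n.+1%:R * ln e
   + e^-1 * (4 * et) * n.+1%:R ^+ 2)).
  apply: lerD; first exact: energyL.
  by rewrite -[leLHS]mulr_natr natrM expr2.
have -> : e^-1 * (4 * et) = ep / 2 by rewrite /et; field; rewrite gt_eqF.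
have hn : - ln e <= ep / 2 * n.+1%:R.
  rewrite mulrC -ler_pdivrMr; last by lra.
  near: n; exists (Num.truncn (`|- ln e / (ep / 2)|)) => // n /= hn.
  apply: (le_trans (ler_norm _)).
  have /andP[_ /ltW] := truncn_itv (normr_ge0 (- ln e / (ep / 2))).
  by move=> /le_trans; apply; rewrite ler_nat ltnS.
have := ler_wpM2r (ltW n0) hn.
by rewrite expr2; lra.
Unshelve. all: end_near. Qed.

End capacity_of_limit.

(** * Leja points and tiny polynomials on sets of zero capacity *)

Section leja.
Context {R : realType}.
Local Notation CC := (R * R)%type.
Implicit Types (s : seq CC).

Fixpoint greedy (next : seq CC -> CC) (n : nat) : seq CC :=
  if n is n'.+1 then next (greedy next n') :: greedy next n' else [::].

Lemma size_greedy next n : size (greedy next n) = n.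
Proof. by elim: n => //= n ->. Qed.

Lemma greedy_prod next n (f : CC -> R) :
  \prod_(y <- greedy next n) f y = \prod_(i < n) f (next (greedy next i)).
Proof.
elim: n => [|n IH]; first by rewrite big_nil big_ord0.
by rewrite /= big_cons IH big_ord_recr/= mulrC.
Qed.

(** A weak form of Leja points: at a new point the product of distances need only reach eta^n, not
    its maximum. *)
Lemma leja_sequence (K : set CC) (eta : R) : K !=set0 ->
  (forall s, s != [::] -> (forall x, x \in s -> K x) ->
     exists z, K z /\ eta ^+ size s <= \prod_(x <- s) cdist z x) ->
  exists x : nat -> CC, (forall n, K (x n)) /\
    forall n, eta ^+ n <= \prod_(i < n) cdist (x n) (x i).
Proof.
move=> [x0 Kx0] bad.
have /choice[next hnext] : forall s, exists y, (forall x, x \in s -> K x) ->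
    K y /\ eta ^+ size s <= \prod_(x <- s) cdist y x.
  move=> s; have [sK|nsK] := pselect (forall x, x \in s -> K x); last by exists x0.
  have [->|s0] := eqVneq s [::]; first by exists x0; rewrite big_nil.
  by have [z hz] := bad s s0 sK; exists z.
have gK n : forall x, x \in greedy next n -> K x.
  elim: n => //= n IH x; rewrite inE => /predU1P[->|/IH//].
  by have [] := hnext _ IH.
exists (fun n => next (greedy next n)); split.
  by move=> n; have [] := hnext _ (gK n).
by move=> n; have [_] := hnext _ (gK n); rewrite size_greedy greedy_prod.
Qed.

(** The n-th point adds twice its row sum, at most 2 n L with L = |ln eta| + ln D, and the diagonal
    term -ln e; the row sums add up to at most L n^2. *)
Lemma leja_energy (x : nat -> CC) (eta D e : R) n :
  0 < eta -> 0 < e -> e <= 1 -> 1 <= D ->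
  (forall i j, cdist (x i) (x j) <= D) ->
  (forall n, eta ^+ n <= \prod_(i < n) cdist (x n) (x i)) ->
  \sum_(i < n) \sum_(j < n) tkernel e (x i) (x j)
    <= (`|ln eta| + ln D) * n%:R ^+ 2 - n%:R * ln e.
Proof.
move=> eta0 e0 e1 D1 xD leja; set L := _ + ln D.
have L0 : 0 <= L by rewrite addr_ge0// ln_ge0.
have step k : \sum_(j < k) tkernel e (x k) (x j) <= k%:R * L.
  have pos (i : 'I_k) : 0 < cdist (x k) (x i).
    rewrite lt_def cdist_ge0 andbT; apply/negP => /eqP E.
    have := leja k; rewrite (bigD1 i)//= E mul0r.
    by rewrite leNgt exprn_gt0.
  have lnE : \sum_(j < k) ln (cdist (x k) (x j)) = ln (\prod_(j < k) cdist (x k) (x j)).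
    apply/esym; apply: (big_morph_in (Num.pos : {pred R})) => //.
    - by move=> a b; rewrite !posrE => *; rewrite mulr_gt0.
    - by rewrite posrE.
    - exact: lnM.
    - exact: ln1.
    - by move=> i _; rewrite posrE.
  have lnb : k%:R * ln eta <= \sum_(j < k) ln (cdist (x k) (x j)).
    rewrite lnE mulr_natl -lnXn// le_ln ?exprn_gt0//.
  apply: (@le_trans _ _ (\sum_(j < k) (- ln (cdist (x k) (x j)) + ln D))).
    by apply: ler_sum => j _; apply: tkernel_le.
  rewrite big_split/= sumrN sumr_const card_ord -[X in _ + X <= _]mulr_natl /L mulrDr lerD2r.
  apply: (@le_trans _ _ (- (k%:R * ln eta))); first by rewrite lerN2.
  by rewrite -mulrN ler_wpM2l// -normrN ler_norm.
elim: n => [|n IH]; first by rewrite big_ord0 expr0n/= mulr0 mul0r subr0.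
rewrite big_ord_recr/=.
under eq_bigr do rewrite big_ord_recr/=.
rewrite big_split/= big_ord_recr/= tkernelxx//.
have -> : \sum_(i < n) tkernel e (x i) (x n) = \sum_(i < n) tkernel e (x n) (x i).
  by apply: eq_bigr => i _; rewrite tkernelC.
have := step n; move: IH; rewrite -natr1; clear step; clearbody L.
move: (\sum_(i < n) tkernel e (x n) (x i)) (\sum_(i < n) _) (ln e) (n%:R : R) L L0.
move=> a b c p {}L {}L0.
have -> : L * (p + 1) ^+ 2 = L * p ^+ 2 + 2 * (p * L) + L by ring.
rewrite mulrDl mul1r; lra.
Qed.

(* Otherwise a greedily chosen (Leja) sequence would equidistribute to a measure
   of finite energy on [K]. *)
Lemma small_monic_polynomial (K : set CC) (z0 : CC) (eta : R) :
  compact K -> ~ pos_log_cap K -> 0 < eta -> exists s : seq CC,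
    [/\ s != [::], (forall x, x \in s -> K x \/ x = z0) &
        forall z, K z -> \prod_(x <- s) cdist z x < eta ^+ size s].
Proof.
move=> cptK cap0 eta0; apply: contrapT => h.
have K0 : K !=set0.
  (* For empty [K] the bound is vacuous, but the list must be nonempty: this is the purpose of
     [z0]. *)
  apply/set0P/eqP => K0; apply: h; exists [:: z0]; split => //.
    by move=> x; rewrite inE => /eqP ->; right.
  by move=> z; rewrite K0.
have [|x [Kx leja]] := @leja_sequence K eta K0.
  move=> s s0 sK; apply: contrapT => nz; apply: h; exists s; split => //.
    by move=> x /sK; left.
  move=> z Kz; rewrite ltNge; apply/negP => hz; apply: nz.
  by exists z.
have [M M0 KM] := compact_cabs_bounded cptK.
apply: cap0; apply: (@pos_log_cap_limit _ _ x (`|ln eta| + ln (2 * M + 1))) => //.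
move=> e n e0 e1; apply: leja_energy => //; first by lra.
by move=> i j; have := cdist_cabs (x i) (x j); have := KM _ (Kx i); have := KM _ (Kx j); lra.
Qed.

End leja.

Lemma normc_sum {R : realType} (I : Type) (r : seq I) (f : I -> R[i]) :
  Normc.normc (\sum_(i <- r) f i) <= \sum_(i <- r) Normc.normc (f i).
Proof.
elim: r => [|i r IH]; first by rewrite !big_nil Normc.normc0.
by rewrite !big_cons (le_trans (le_normcD _ _))// lerD2l.
Qed.

Lemma normc_prod {R : realType} (I : Type) (r : seq I) (f : I -> R[i]) :
  Normc.normc (\prod_(i <- r) f i) = \prod_(i <- r) Normc.normc (f i).
Proof.
elim: r => [|i r IH]; first by rewrite !big_nil Normc.normc1.
by rewrite !big_cons Normc.normcM IH.
Qed.

Lemma normcX {R : realType} (x : R[i]) n : Normc.normc (x ^+ n) = Normc.normc x ^+ n.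
Proof.
elim: n => [|n IH]; first by rewrite !expr0 Normc.normc1.
by rewrite !exprS Normc.normcM IH.
Qed.

Lemma normc_ge0 {R : realType} (x : R[i]) : 0 <= Normc.normc x.
Proof. by case: x => a b; exact: sqrtr_ge0. Qed.

Lemma normc_real {R : realType} (x : R) : 0 <= x -> Normc.normc (x%:C)%C = x.
Proof. by move=> x0; rewrite /= expr0n/= addr0 sqrtr_sqr ger0_norm. Qed.

(** * Linear combinations without cancellation *)

Section good_combination.
Context {R : realType}.
Local Notation normc := (@Normc.normc R).

(** Pigeonhole: if each of the n + 1 integers failed at some coordinate, two would fail at the same
    one, and subtracting would make both of its entries smaller than their maximum. *)
Lemma combination_step (n : nat) (x y : 'I_n -> R[i]) : exists t : R,
  [/\ 1 <= t, t <= n.+1%:R &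
    forall k, (2 * n%:R + 4)^-1 * Num.max (normc (x k)) (normc (y k))
      <= normc (x k + t%:C%C * y k)].
Proof.
(* Two failures at [k] give |y_k| < 2 d A_k, hence |x_k| < (1 + 2 (n + 1)) d A_k = (2 n + 3) d A_k;
   both fall below A_k. *)
pose d : R := (2 * n%:R + 4)^-1.
have d0 : 0 < d by rewrite invr_gt0 ltr_wpDl ?mulr_ge0.
pose A k := Num.max (normc (x k)) (normc (y k)).
pose T (i : 'I_n.+1) : R := i.+1%:R.
apply: contrapT => h.
have bad i : exists k, normc (x k + (T i)%:C%C * y k) < d * A k.
  apply: contrapT => hk; apply: h; exists (T i); split.
  - by rewrite ler1n.
  - by rewrite ler_nat ltn_ord.
  - by move=> k; rewrite leNgt; apply/negP => hb; apply: hk; exists k.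
have /choice[g hg] := bad.
suff injg : injective g by have := leq_card g injg; rewrite !card_ord ltnn.
move=> i j gij; apply/eqP/negPn/negP => ij.
have hi := hg i; have := hg j; rewrite -gij => hj; move: (g i) hi hj => k hi hj.
have Ak0 : 0 <= A k by rewrite le_max normc_ge0.
have dA : d * (2 * n%:R + 4) = 1 by rewrite mulVf// gt_eqF// ltr_wpDl ?mulr_ge0.
have hy : normc (y k) < 2 * (d * A k).
  have h1 : 1 <= `|T i - T j|.
    have : 1%Z <= `|i.+1%:Z - j.+1%:Z|.
      by rewrite -gtz0_ge1 normr_gt0 subr_eq0 eqz_nat eqSS.
    by rewrite -(@ler_int R) intr_norm rmorphB.
  apply: (@le_lt_trans _ _ (`|T i - T j| * normc (y k))).
    by rewrite ler_peMl ?normc_ge0.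
  have -> : `|T i - T j| * normc (y k) =
      normc ((x k + (T i)%:C%C * y k) - (x k + (T j)%:C%C * y k)).
    have -> : (x k + (T i)%:C%C * y k) - (x k + (T j)%:C%C * y k) =
       (T i - T j)%:C%C * y k by rewrite rmorphB mulrBl opprD addrACA subrr add0r.
    rewrite Normc.normcM; congr (_ * _).
    by rewrite /= expr0n/= addr0 sqrtr_sqr.
  apply: (le_lt_trans (le_normcD _ _)); rewrite normcN; move: hi hj; lra.
have hx : normc (x k) < (2 * n%:R + 3) * (d * A k).
  have Ti0 : 0 <= T i by rewrite ler0n.
  have Tin : T i <= n%:R + 1 by rewrite natr1 ler_nat ltn_ord.
  have -> : x k = (x k + (T i)%:C%C * y k) - (T i)%:C%C * y k by rewrite addrK.
  apply: (le_lt_trans (le_normcD _ _)).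
  rewrite normcN Normc.normcM normc_real//.
  have h2 : T i * normc (y k) <= (n%:R + 1) * (2 * (d * A k)).
    by apply: ler_pM => //; [exact: normc_ge0|exact: ltW].
  move: hi h2; lra.
have h4 : d * A k * (2 * n%:R + 4) = A k by rewrite mulrAC dA mul1r.
have n0 : 0 <= n%:R :> R by [].
have hdA : 0 <= d * A k by rewrite mulr_ge0// ltW.
have hn : 0 <= n%:R * (d * A k) by rewrite mulr_ge0.
have : A k < A k.
  rewrite {1}/A gt_max; apply/andP; split.
  - by apply: lt_le_trans hx _; move: h4 hdA hn; lra.
  - by apply: lt_le_trans hy _; move: h4 hdA hn; lra.
by rewrite ltxx.
Qed.

(* The coefficients are chosen one at a time: among [n + 1] candidates one is
   harmless for all [n] coordinates. *)
Lemma good_combination (n m : nat) : exists de B : R, [/\ 0 < de, de <= 1, 1 <= B &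
  forall a : 'I_m -> 'I_n -> R[i], exists ep : 'I_m -> R,
    (forall l, 1 <= ep l <= B) /\
    forall k l, de * normc (a l k) <= normc (\sum_(l < m) (ep l)%:C%C * a l k)].
Proof.
elim: m => [|m [de [B [de0 de1 B1 IH]]]].
  by exists 1, 1; split => // a; exists (fun=> 1); split => [[]|k []].
pose c : R := (2 * n%:R + 4)^-1.
have c4 : 4 <= 2 * n%:R + 4 :> R by rewrite lerDr mulr_ge0.
have c0 : 0 < c by rewrite invr_gt0; move: c4; lra.
have c1 : c <= 1 by rewrite invf_le1; move: c4; lra.
exists (c * de), (Num.max B n.+1%:R); split.
- by rewrite mulr_gt0.
- by rewrite mulr_ile1// ltW.
- by rewrite le_max B1.
move=> a; have [ep [epB hep]] := IH (fun l k => a (widen_ord (leqnSn m) l) k).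
pose x k := \sum_(l < m) (ep l)%:C%C * a (widen_ord (leqnSn m) l) k.
have [t [t1 tn ht]] := combination_step x (fun k => a ord_max k).
pose ep' (l : 'I_m.+1) := if unlift ord_max l is Some l' then ep l' else t.
have epw l : ep' (widen_ord (leqnSn m) l) = ep l.
  rewrite /ep'; have -> : widen_ord (leqnSn m) l = lift ord_max l.
    by apply: val_inj; rewrite /= /bump leqNgt ltn_ord.
  by rewrite liftK.
have epm : ep' ord_max = t by rewrite /ep' unlift_none.
exists ep'; split.
  move=> l; rewrite /ep'; case: unliftP => [l' _|_].
    by have /andP[-> h] := epB l'; rewrite le_max h.
  by rewrite t1 le_max tn orbT.
move=> k l; rewrite big_ord_recr/= epm.
under eq_bigr do rewrite epw.
apply: le_trans (ht k); rewrite -/(x k) -/c -mulrA ler_wpM2l ?(ltW c0)//.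
case: (unliftP ord_max l) => [l' ->|->].
  have -> : lift ord_max l' = widen_ord (leqnSn m) l'.
    by apply: val_inj; rewrite /= /bump leqNgt ltn_ord.
  by rewrite le_max (hep k l').
by rewrite le_max; apply/orP; right; rewrite ler_piMl ?normc_ge0.
Qed.

End good_combination.

(** Taking N-th roots sends the fixed constant [K] to 1. *)
Lemma le_of_powers {R : realType} (K X Y : R) : 0 <= X -> 0 <= Y -> 0 < K ->
  (forall N : nat, (0 < N)%N -> X ^+ N <= K * Y ^+ N) -> X <= Y.
Proof.
move=> X0 Y0 K0 h; rewrite leNgt; apply/negP => YX.
have X0' : 0 < X by exact: le_lt_trans YX.
have [Y0'|] := ltP 0 Y; last first.
  move=> Y0'; have Y00 : Y = 0 by apply/eqP; rewrite eq_le Y0' Y0.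
  by have := h 1%N isT; rewrite Y00 !expr1 mulr0 leNgt X0'.
pose q := ln X - ln Y; have q0 : 0 < q by rewrite subr_gt0 ltr_ln ?posrE.
pose N := (Num.truncn (`|ln K| / q)).+1.
have hN : `|ln K| < q * N%:R.
  rewrite mulrC -ltr_pdivrMr//; have : 0 <= `|ln K| / q by rewrite divr_ge0// ltW.
  by move=> /truncn_itv/andP[].
have := h N isT; apply/negP; rewrite -ltNge.
have -> : K * Y ^+ N = expR (ln K + N%:R * ln Y).
  by rewrite expRD lnK ?posrE// expRM_natl lnK ?posrE.
rewrite -[X in _ < X ^+ _]lnK ?posrE// -expRM_natl ltr_expR.
by move: hN (ler_norm (ln K)); rewrite /q; lra.
Qed.

(** * Weighted maxima of distances and factored polynomials *)

Section weighted_max.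
Context {R : realType}.
Local Notation CC := (R * R)%type.
Variables (m : nat) (v : 'I_m -> R) (c : 'I_m -> CC).
Hypothesis v0 : forall k, 0 <= v k.

Definition wmax (z : CC) : R := \big[Num.max/0]_(k < m) (v k * cdist z (c k)).

Lemma wmax_ge0 z : 0 <= wmax z.
Proof. exact: bigmax_ge_id. Qed.

Lemma le_wmax k z : v k * cdist z (c k) <= wmax z.
Proof. exact: le_bigmax. Qed.

Lemma wmax_le z (y : R) : 0 <= y -> (forall k, v k * cdist z (c k) <= y) -> wmax z <= y.
Proof. by move=> y0 h; apply: bigmax_le. Qed.

Lemma wmax_attained (i0 : 'I_m) z : exists k, wmax z = v k * cdist z (c k).
Proof.
have h : forall i : 'I_m, true -> 0 <= v i * cdist z (c i).
  by move=> i _; rewrite mulr_ge0 ?cdist_ge0.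
have := @bigmax_eq_arg _ _ _ _ i0 predT (fun k => v k * cdist z (c k)) isT h.
by rewrite /wmax => ->; eexists.
Qed.

Lemma wmax_lipschitz (V : R) z u : 0 <= V -> (forall k, v k <= V) ->
  wmax z - wmax u <= V * cdist z u.
Proof.
move=> V0 vV; rewrite lerBlDr; apply: wmax_le.
  by rewrite addr_ge0 ?wmax_ge0// mulr_ge0 ?cdist_ge0.
move=> k; apply: (@le_trans _ _ (v k * cdist z u + v k * cdist u (c k))).
  by rewrite -mulrDr ler_wpM2l// cdist_triangle.
by rewrite lerD ?le_wmax// ler_wpM2r ?cdist_ge0.
Qed.

(** By the triangle inequality no point is close to two distinct centers. *)
Lemma wmax_gt0 i j : c i <> c j -> 0 < v i -> 0 < v j ->
  exists2 ka : R, 0 < ka & forall z, ka <= wmax z.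
Proof.
move=> cij vi vj; pose w := Num.min (v i) (v j).
have w0 : 0 < w by rewrite lt_min vi.
have D0 := cdist_gt0 cij.
exists (w * cdist (c i) (c j) / 2); first by rewrite divr_gt0// mulr_gt0.
move=> z.
have h1 : w * cdist z (c i) <= wmax z.
  by apply: le_trans (le_wmax i z); rewrite ler_wpM2r ?cdist_ge0// ge_min lexx.
have h2 : w * cdist z (c j) <= wmax z.
  by apply: le_trans (le_wmax j z); rewrite ler_wpM2r ?cdist_ge0// ge_min lexx orbT.
have h3 : w * cdist (c i) (c j) <= w * (cdist z (c i) + cdist z (c j)).
  by rewrite ler_wpM2l ?(ltW w0)// (cdistC z (c i)) cdist_triangle.
by move: h1 h2 h3; rewrite mulrDr; clear; lra.
Qed.

End weighted_max.

Section factorization.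
Context {R : realType}.
Local Notation CC := (R * R)%type.

Definition ofC (z : R[i]) : CC := (complex.Re z, complex.Im z).

Lemma ofCK z : toC (ofC z) = z.
Proof. by case: z. Qed.

Lemma normc_factor (a : R[i]) (Z : seq CC) z :
  Normc.normc (a *: \prod_(x <- Z) ('X - (toC x)%:P)).[toC z]
    = absprod (Normc.normc a) Z z.
Proof.
rewrite hornerZ Normc.normcM horner_prod normc_prod /absprod; congr (_ * _).
by apply: eq_bigr => x _; rewrite hornerXsubC cdistE.
Qed.

Lemma poly_factor (P : {poly R[i]}) n : size P = n.+1 ->
  exists2 Z : seq CC, size Z = n &
    P = lead_coef P *: \prod_(x <- Z) ('X - (toC x)%:P).
Proof.
move=> szP; have [rs rsP] := closed_field_poly_normal P.
have P0 : P != 0 by rewrite -size_poly_eq0 szP.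
exists (map ofC rs).
  rewrite size_map; move: szP; rewrite {1}rsP size_scale ?lead_coef_eq0//.
  by rewrite size_prod_XsubC => -[].
rewrite {1}rsP big_map; congr (_ *: _).
by apply: eq_bigr => x _; rewrite ofCK.
Qed.

End factorization.

(** * The resultant inequality *)

Section resultant_inequality.
Context {R : realType} (mu : probability (R * R)%type R).
Local Notation CC := (R * R)%type.
Local Notation S := (msupp mu).
Hypothesis cptS : compact S.
Local Notation tpot := (tpot mu).

Lemma truncated_absprod (Z : seq CC) (e : R) : 0 < e -> exists2 d : R, 0 < d &
  forall t, S t -> \prod_(x <- Z) Num.max (cdist x t) d <= \prod_(x <- Z) cdist t x + e.
Proof.
move=> e0.
(* Strengthened to all smaller [d], so that the induction on the zeros can take minima. *)
suff [d0 d00 h] : exists2 d0 : R, 0 < d0 & forall d t, 0 < d -> d <= d0 -> S t ->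
    \prod_(x <- Z) Num.max (cdist x t) d <= \prod_(x <- Z) cdist t x + e.
  by exists d0 => // t; exact: h.
elim: Z e e0 => [|x Z IH] e e0.
  by exists 1 => // d t d0 d1 St; rewrite !big_nil lerDl ltW.
have [M M0 SM] := compact_cabs_bounded cptS.
pose Mx := M + cabs x + 1; have Mx0 : 0 < Mx by rewrite /Mx; have := cabs_ge0 x; lra.
pose e' := e / (2 * Mx); have e'0 : 0 < e' by rewrite divr_gt0// mulr_gt0.
have [d0 d00 hd0] := IH e' e'0.
pose Q := \prod_(y <- Z) (M + cabs y) + e'.
have Q0 : 0 < Q.
  by rewrite ltr_wpDl// prodr_ge0// => y _; rewrite addr_ge0 ?cabs_ge0// ltW.
exists (Num.min d0 (e / (2 * Q))).
  by rewrite lt_min d00 divr_gt0// mulr_gt0.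
move=> d t d1; rewrite le_min => /andP[dd0 dQ] St; rewrite !big_cons.
have hZ := hd0 d t d1 dd0 St.
have p0 : 0 <= \prod_(y <- Z) cdist t y by apply: prodr_ge0 => y _; exact: cdist_ge0.
have pQ : \prod_(y <- Z) cdist t y + e' <= Q.
  rewrite lerD2r; apply: ler_prod => y _; rewrite cdist_ge0/=.
  by have := cdist_cabs t y; have := SM _ St; lra.
have xt : cdist t x <= Mx.
  by rewrite /Mx; have := cdist_cabs t x; have := SM _ St; lra.
apply: (@le_trans _ _ ((cdist t x + d) * (\prod_(y <- Z) cdist t y + e'))).
  apply: ler_pM => //.
  - by rewrite le_max cdist_ge0.
  - by apply: prodr_ge0 => y _; rewrite le_max cdist_ge0.
  - by rewrite cdistC ge_max lerDl lerDr cdist_ge0 ltW.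
rewrite mulrDl mulrDr -addrA lerD2l.
have h1 : cdist t x * e' <= e / 2.
  apply: (@le_trans _ _ (Mx * e')); first by rewrite ler_wpM2r// ltW.
  by rewrite le_eqVlt; apply/orP; left; apply/eqP; rewrite /e'; field; rewrite gt_eqF.
have h2 : d * (\prod_(y <- Z) cdist t y + e') <= e / 2.
  apply: (@le_trans _ _ (e / (2 * Q) * Q)).
    by apply: ler_pM => //; [exact: ltW|rewrite addr_ge0// ltW].
  by rewrite le_eqVlt; apply/orP; left; apply/eqP; field; rewrite gt_eqF.
by move: h1 h2; clear; lra.
Qed.

Section with_centers.
Variables (m : nat) (v : 'I_m -> R) (c : 'I_m -> CC) (ka : R).
Hypothesis v0 : forall k, 0 <= v k.
Hypothesis ka0 : 0 < ka.
Hypothesis kaW : forall z, ka <= wmax v c z.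

Lemma wmax_pos z : 0 < wmax v c z.
Proof. exact: lt_le_trans (kaW z). Qed.

Lemma center_exists : exists i : 'I_m, 0 < v i.
Proof.
apply: contrapT => h; have := wmax_pos (0, 0).
suff -> : wmax v c (0, 0) = 0 by rewrite ltxx.
apply/eqP; rewrite eq_le wmax_ge0 andbT; apply: wmax_le => // k.
suff -> : v k = 0 by rewrite mul0r.
apply/eqP; rewrite eq_le v0 andbT leNgt; apply/negP => vk.
by apply: h; exists k.
Qed.

Lemma ln_wmax_lipschitz : exists2 La : R, 0 <= La &
  forall z u, ln (wmax v c z) - ln (wmax v c u) <= La * cdist z u.
Proof.
pose V := \big[Num.max/0]_(k < m) v k.
have V0 : 0 <= V by exact: bigmax_ge_id.
exists (V / ka); first by rewrite divr_ge0// ltW.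
move=> z u; have [zu|uz] := leP (wmax v c z) (wmax v c u).
  rewrite (@le_trans _ _ 0)//; last by rewrite mulr_ge0 ?cdist_ge0// divr_ge0// ltW.
  by rewrite subr_le0 le_ln// wmax_pos.
apply: (le_trans (ln_sub_le (wmax_pos z) (wmax_pos u))).
rewrite mulrAC; apply: ler_pM.
- by rewrite subr_ge0 ltW.
- by rewrite invr_ge0 ltW// wmax_pos.
- by apply: wmax_lipschitz => // k; exact: le_bigmax.
- by rewrite lef_pV2 ?posrE// wmax_pos.
Qed.

Lemma continuous_ln_wmax : continuous (fun z => ln (wmax v c z)).
Proof.
have [La La0 h] := ln_wmax_lipschitz.
exact: lipschitz_cdist_continuous h.
Qed.

Definition powersum (N : nat) (ep : 'I_m -> R) : {poly R[i]} :=
  \sum_(l < m) ((ep l * v l ^+ N)%:C%C) *: ('X - (toC (c l))%:P) ^+ N.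

Lemma powersum_horner N ep z : (powersum N ep).[toC z] =
  \sum_(l < m) (ep l)%:C%C * ((v l)%:C%C * (toC z - toC (c l))) ^+ N.
Proof.
rewrite horner_sum; apply: eq_bigr => l _.
by rewrite hornerZ horner_exp hornerXsubC exprMn rmorphM rmorphXn mulrA.
Qed.

(** The leading coefficient is a sum of nonnegative reals with a positive term, so the degree cannot
    drop; hence the choice of positive real coefficients [ep]. *)
Lemma powersum_size N ep : (forall l, 1 <= ep l) -> size (powersum N ep) = N.+1 /\
  lead_coef (powersum N ep) = (\sum_(l < m) ep l * v l ^+ N)%:C%C.
Proof.
move=> ep1.
have sz l : (size (((ep l * v l ^+ N)%:C%C) *: ('X - (toC (c l))%:P) ^+ N) <= N.+1)%N.
  by rewrite (leq_trans (size_scale_leq _ _))// size_exp_XsubC.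
have szle : (size (powersum N ep) <= N.+1)%N.
  by apply: (leq_trans (size_sum _ _ _)); apply/bigmax_leqP => l _; exact: sz.
have coefN : (powersum N ep)`_N = (\sum_(l < m) ep l * v l ^+ N)%:C%C.
  rewrite coef_sum rmorph_sum; apply: eq_bigr => l _ /=.
  rewrite coefZ; have := lead_coef_exp ('X - (toC (c l))%:P) N.
  rewrite lead_coefXsubC expr1n /lead_coef size_exp_XsubC/= => ->.
  by rewrite mulr1.
have sum0 : 0 < \sum_(l < m) ep l * v l ^+ N.
  have [i vi] := center_exists; rewrite (bigD1 i)//= ltr_pwDl//.
    by rewrite mulr_gt0 ?exprn_gt0// (lt_le_trans ltr01).
  by apply: sumr_ge0 => l _; rewrite mulr_ge0 ?exprn_ge0// (le_trans ler01).
have cN : (powersum N ep)`_N != 0.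
  rewrite coefN; apply/eqP => /(congr1 (@complex.Re R)) /= /eqP.
  by rewrite gt_eqF.
have szE : size (powersum N ep) = N.+1.
  apply/eqP; rewrite eqn_leq szle /= ltnNge; apply/negP => h.
  by move: cN; rewrite nth_default ?eqxx.
by split => //; rewrite /lead_coef szE.
Qed.

(* With [Q_N = sum_l ep_l (v_l (z - c_l))^N] one has [|Q_N|^(1/N) -> wmax] at the
   zeros of [P], and the resultant of [P] and [Q_N] turns the product of the
   values of [Q_N] at the zeros of [P] into a product of values of [P]. *)
Lemma absprod_wmax_le (al A : R) (Z : seq CC) : 0 <= al -> 0 <= A ->
  (forall z (d : R), 0 < d -> absprod al Z z <= A * expR ((size Z)%:R * tpot d z)) ->
  al * \prod_(x <- Z) wmax v c x
    <= A * expR ((size Z)%:R * mean mu (fun z => ln (wmax v c z))).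
Proof.
move=> al0 A0 hP; set n := size Z; set I := mean mu _.
have [de [B [de0 de1 B1 comb]]] := @good_combination R n m.
have W0 z : 0 <= wmax v c z by exact: wmax_ge0.
have B0 : 0 < B by exact: lt_le_trans B1.
have m0 : 0 < m%:R :> R.
  by rewrite ltr0n; have [i _] := center_exists; case: m i => // -[].
(* [de] and [B] come from [good_combination] and depend only on [n] and [m], so this constant does
   not depend on N. *)
apply: (@le_of_powers _ ((2 * (m%:R * B) / de) ^+ n)).
- by rewrite mulr_ge0// prodr_ge0.
- by rewrite mulr_ge0// expR_ge0.
- by rewrite exprn_gt0// divr_gt0// mulr_gt0// mulr_gt0.
move=> N N0.
pose zk (k : 'I_n) := nth (0, 0) Z k.
have [ep [epB hep]] := comb (fun l k => ((v l)%:C%C * (toC (zk k) - toC (c l))) ^+ N).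
have ep1 l : 1 <= ep l by case/andP: (epB l).
have [szQ leadQ] := powersum_size N ep1.
set Q := powersum N ep in szQ leadQ.
have [Zq szZq QE] := poly_factor szQ.
set b := \sum_(l < m) _ in leadQ.
have b0 : 0 <= b.
  by apply: sumr_ge0 => l _; rewrite mulr_ge0 ?exprn_ge0// (le_trans ler01).
have normQ z : Normc.normc Q.[toC z] = absprod b Zq z.
  by rewrite QE normc_factor leadQ normc_real.
have bpos : 0 < b.
  rewrite lt_def b0 andbT; apply/eqP => b00; move: leadQ; rewrite b00 => /eqP.
  by rewrite lead_coef_eq0 -size_poly_eq0 szQ.
have lowQ x : x \in Z -> de * wmax v c x ^+ N <= absprod b Zq x.
  move=> xZ; have ix : (index x Z < n)%N by rewrite index_mem.
  have [i _] := center_exists.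
  have [l Wl] := wmax_attained c v0 i x.
  have := hep (Ordinal ix) l; rewrite /zk /= nth_index// -powersum_horner -/Q normQ.
  by rewrite normcX Normc.normcM normc_real// -cdistE -Wl.
have upQ t : absprod b Zq t <= m%:R * B * wmax v c t ^+ N.
  rewrite -normQ powersum_horner (le_trans (normc_sum _ _))//.
  apply: (@le_trans _ _ (\sum_(l < m) (B * wmax v c t ^+ N))).
    apply: ler_sum => l _; have /andP[e1 eB] := epB l.
    have e0 : 0 <= ep l by exact: le_trans e1.
    rewrite Normc.normcM normcX Normc.normcM !normc_real// -cdistE.
    apply: ler_pM => //; first by rewrite exprn_ge0// mulr_ge0 ?cdist_ge0.
    by rewrite lerXn2r ?nnegrE ?le_wmax// mulr_ge0 ?cdist_ge0.
  by rewrite sumr_const card_ord -[leLHS]mulr_natl mulrA.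
(* Both sides are the modulus of the resultant of P and Q_N. *)
have swap : al ^+ N * \prod_(x <- Z) absprod b Zq x
    = b ^+ n * \prod_(y <- Zq) absprod al Z y.
  rewrite /absprod !big_split/= !big_const_seq !count_predT !iter_mulr_1 szZq.
  rewrite exchange_big/= mulrCA; congr (_ * (_ * _)).
  by apply: eq_bigr => y _; apply: eq_bigr => x _; rewrite cdistC.
(* The truncation error allowed for the zeros of Q_N: it at most doubles the bound [upQ], whence the
   factor 2 in the constant. *)
have bkappa : 0 < m%:R * B * ka ^+ N / b.
  by rewrite divr_gt0// mulr_gt0 ?exprn_gt0// mulr_gt0.
have [d d0 hd] := truncated_absprod Zq bkappa.
have sumpot : ln b + \sum_(y <- Zq) tpot d y <= ln (2 * (m%:R * B)) + N%:R * I.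
  have cst (k : R) : continuous (fun _ : CC => k) by move=> z; exact: cvg_cst.
  have clog y : continuous (tlog d y) by exact: continuous_tlog.
  have csum : continuous (fun t => \sum_(y <- Zq) tlog d y t) by exact: continuous_bigsum.
  have cW := continuous_ln_wmax.
  have cNW : continuous (fun z => N%:R * ln (wmax v c z)).
    by move=> z; apply: cvgM; [exact: cvg_cst|exact: cW].
  rewrite -[ln b](mean_cst mu) -(mean_sum cptS)//.
  rewrite -[ln (2 * _)](mean_cst mu) -(meanZ cptS)// -!(meanD cptS)//.
  apply: le_mean => //.
  - by move=> t; apply: cvgD; [exact: cvg_cst|exact: csum].
  - by move=> t; apply: cvgD; [exact: cvg_cst|exact: cNW].
  move=> t St.
  have -> : \sum_(y <- Zq) tlog d y t = ln (\prod_(y <- Zq) Num.max (cdist y t) d).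
    apply/esym; elim: (Zq) => [|y s IHs]; first by rewrite !big_nil ln1.
    rewrite !big_cons lnM ?IHs// ?posrE ?max_gt0//.
    by elim/big_ind: _ => // *; rewrite ?mulr_gt0 ?max_gt0.
  have pp : 0 < \prod_(y <- Zq) Num.max (cdist y t) d.
    by elim/big_ind: _ => // *; rewrite ?mulr_gt0 ?max_gt0.
  rewrite -lnM ?posrE// [N%:R * _]mulr_natl -lnXn ?wmax_pos//.
  rewrite -lnM ?posrE ?exprn_gt0 ?wmax_pos ?mulr_gt0//.
  rewrite le_ln ?mulr_gt0//.
  apply: (@le_trans _ _ (b * (\prod_(x <- Zq) cdist t x + m%:R * B * ka ^+ N / b))).
    by rewrite ler_wpM2l// hd.
  rewrite mulrDr -/(absprod b Zq t) [X in _ + X]mulrC divfK ?gt_eqF//.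
  have h1 := upQ t.
  have h2 : m%:R * B * ka ^+ N <= m%:R * B * wmax v c t ^+ N.
    by rewrite ler_wpM2l ?mulr_ge0 ?(ltW B0)// lerXn2r ?nnegrE ?W0// ltW.
  by move: h1 h2; rewrite -mulrA; clear; lra.
have main : al ^+ N * \prod_(x <- Z) (de * wmax v c x ^+ N)
    <= A ^+ N * expR (n%:R * (ln (2 * (m%:R * B)) + N%:R * I)).
  apply: (@le_trans _ _ (al ^+ N * \prod_(x <- Z) absprod b Zq x)).
    rewrite ler_wpM2l ?exprn_ge0// big_seq [leRHS]big_seq; apply: ler_prod => x xZ.
    by rewrite mulr_ge0 ?exprn_ge0 ?(ltW de0)//= lowQ.
  rewrite swap.
  apply: (@le_trans _ _ (b ^+ n * \prod_(y <- Zq) (A * expR (n%:R * tpot d y)))).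
    rewrite ler_wpM2l ?exprn_ge0//; apply: ler_prod => y _.
    by rewrite absprod_ge0//= hP.
  rewrite big_split/= big_const_seq count_predT iter_mulr_1 szZq mulrCA.
  rewrite ler_wpM2l ?exprn_ge0// -expR_sum -mulr_sumr.
  rewrite -[b in leLHS]lnK ?posrE// -expRM_natl -expRD -mulrDr ler_expR.
  by rewrite ler_wpM2l.
move: main; rewrite big_split/= big_const_seq count_predT iter_mulr_1 -/n.
rewrite mulrCA prodrXl -exprMn mulrC -ler_pdivlMr ?exprn_gt0// => /le_trans; apply.
rewrite le_eqVlt; apply/orP; left; apply/eqP.
rewrite mulrDr expRD expRM_natl lnK ?posrE ?mulr_gt0//.
have -> : expR (n%:R * (N%:R * I)) = expR (n%:R * I) ^+ N.
  by rewrite -expRM_natl mulrCA.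
move: (2 * (m%:R * B)) (expR (n%:R * I)) => a b'; rewrite expr_div_n (exprMn _ A).
by move: (a ^+ n) (A ^+ N) (b' ^+ N) ((de ^+ n)^-1); clear => *; ring.
Qed.

End with_centers.
End resultant_inequality.

(** * Consequences of admissibility and of the equilibrium conditions *)

Section admissible_weight.
Context {R : realType} (E : set (R * R)) (w : R * R -> R).
Local Notation CC := (R * R)%type.
Hypothesis closedE : closed E.
Hypothesis admE : admissible E w.

Lemma weight_tail (e : R) : 0 < e -> exists M : R,
  forall z, E z -> M < cabs z -> cabs z * w z < e.
Proof.
move=> e0; have [_ _ _ tail] := admE.
have [[M EM]|unb] := pselect (Defs.bounded_set E); last exact: tail.
by exists M => z /EM zM; rewrite ltNge zM.
Qed.

Lemma usc_compact_bounded (A : set CC) : compact A -> A `<=` E ->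
  exists B : R, forall z, A z -> w z <= B.
Proof.
move=> cptA AE; have [_ usc _ _] := admE.
move: cptA => /compact_near_coveringP.
move=> /(_ R (pinfty_nbhs R) (fun B z => E z -> w z <= B)) [|B [Br hB]].
  move=> z Az; have wz : w z < w z + 1 by rewrite ltrDl.
  exists ([set y | E y -> w y < w z + 1], [set B | w z + 1 < B]).
    by split; [exact: (usc z (AE _ Az))|exists (w z + 1); split => //; exact: num_real].
  by move=> [y B] /= [h1 h2] /h1/ltW/le_trans; apply; exact: ltW.
exists (B + 1) => z Az; apply: (hB (B + 1)) => //; first by rewrite ltrDl.
exact: AE.
Qed.

Lemma weight_bounded : exists2 W0 : R, 0 < W0 &
  forall z, E z -> w z <= W0 /\ cabs z * w z <= W0.
Proof.
have [w0 _ _ _] := admE.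
have [M hM] := weight_tail (@ltr01 R).
pose M1 := Num.max M 1.
have [| |B hB] := @usc_compact_bounded (E `&` [set z | cabs z <= M1]).
- apply: (@closed_disc_compact _ _ M1); last by move=> z [].
  apply: closedI => //.
  exact: ((continuous_closedP _).1 continuous_cabs _ (@closed_le _ M1)).
- by move=> z [].
exists (Num.max 1 (M1 * `|B|)); first by rewrite lt_max ltr01.
move=> z Ez; have wz := w0 _ Ez.
have M11 : 1 <= M1 by rewrite le_max lexx orbT.
have [zM|Mz] := leP (cabs z) M1.
  have wB : w z <= `|B| by rewrite (le_trans (hB z _))// ler_norm.
  split; rewrite le_max; apply/orP; right.
    by rewrite (le_trans wB)// ler_peMl.
  by apply: ler_pM => //; exact: cabs_ge0.
have zw : cabs z * w z < 1.
  by apply: hM => //; apply: le_lt_trans Mz; rewrite le_max lexx.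
split; rewrite le_max; apply/orP; left; last exact: ltW.
apply: le_trans (ltW zw); rewrite ler_peMl//.
by apply: le_trans (ltW Mz).
Qed.

End admissible_weight.

Section equilibrium.
Context {R : realType} (E : set (R * R)) (w : R * R -> R).
Context (mu : probability (R * R)%type R) (F : R).
Local Notation CC := (R * R)%type.
Local Notation S := (msupp mu).
Local Notation tpot := (tpot mu).
Hypothesis closedE : closed E.
Hypothesis admE : admissible E w.
Hypothesis eqE : weighted_equilibrium E w mu F.

Lemma equilibrium_compact : compact S.
Proof. by case: eqE. Qed.

Lemma equilibrium_sub k : S k -> E k.
Proof. by case: eqE => _ + _ _; exact. Qed.

Lemma weight_ge0E z : E z -> 0 <= w z.
Proof. by case: admE => + _ _ _; exact. Qed.

Lemma weight_pos k : S k -> 0 < w k.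
Proof.
move=> Sk; case: eqE => _ _ /(_ k Sk) + _; rewrite ltNge => h; apply/negP => wk.
by move: h; rewrite elog_le0// addeNy addNye leeNy_eq.
Qed.

Lemma tpot_support k (d : R) : S k -> 0 < d -> 0 <= tpot d k + ln (w k) + F.
Proof.
move=> Sk d0; case: eqE => _ _ /(_ k Sk) + _; rewrite elogE ?weight_pos// => h.
rewrite -lee_fin; apply: (le_trans h); rewrite !EFinD !leeD2r//.
by apply: logpot_le_tpot => //; exact: equilibrium_compact.
Qed.

Lemma tpot_support_bounded : exists Cc : R,
  forall k (d : R), S k -> 0 < d -> - Cc <= tpot d k.
Proof.
have [W0 W00 hW] := weight_bounded closedE admE.
exists (ln W0 + F) => k d Sk d0; have := tpot_support Sk d0.
have : ln (w k) <= ln W0.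
  by apply: le_ln; [exact: weight_pos|have [] := hW _ (equilibrium_sub Sk)].
by lra.
Qed.

(** A point mass would have truncated potentials tending to -oo at its atom, against
    [tpot_support_bounded]. *)
Lemma support_two_points : exists a b : CC, [/\ S a, S b & a <> b].
Proof.
have [a Sa] := msupp_neq0 mu; apply: contrapT => h.
have Sa1 t : S t -> t = a.
  by move=> St; apply: contrapT => ta; apply: h; exists a, t; split => // /esym.
have [Cc hC] := tpot_support_bounded.
have d0 := expR_gt0 (- Cc - 1); have := hC _ _ Sa d0.
have : tpot (expR (- Cc - 1)) a <= ln (expR (- Cc - 1)).
  apply: tpot_le => //; first exact: equilibrium_compact.
  by move=> t /Sa1 ->; rewrite cdistxx expR_ge0.
by rewrite expRK; lra.
Qed.

Local Notation wmaxc c := (wmax (fun k => w (c k)) c).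

(** Degenerate centers carry at most one point [p] of positive weight. Keeping [p] once and using a
    second point of the support elsewhere cannot lower the maximum, and it makes [ln wmax] finite
    and continuous. *)
Lemma nondegenerate_centers m (c : 'I_m -> CC) : (2 <= m)%N -> (forall k, E (c k)) ->
  exists c' : 'I_m -> CC, [/\ forall k, E (c' k),
    forall z, wmaxc c z <= wmaxc c' z &
    exists2 ka : R, 0 < ka & forall z, ka <= wmaxc c' z].
Proof.
case: m c => [//|[//|m]] c _ Ec.
have wc k : 0 <= w (c k) by exact: weight_ge0E.
have [[i [j [cij vi vj]]]|h] := pselect (exists i j : 'I_m.+2,
    [/\ c i <> c j, 0 < w (c i) & 0 < w (c j)]).
  by exists c; split => //; exact: (wmax_gt0 (i := i) (j := j)).
have [a [b [Sa Sb ab]]] := support_two_points.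
have [p [Ep wp hp]] : exists p, [/\ E p, 0 < w p &
    forall k, w (c k) = 0 \/ c k = p].
  have [[i vi]|n] := pselect (exists i, 0 < w (c i)).
    exists (c i); split => // k; have [k0|k0] := ltP 0 (w (c k)).
      by right; apply: contrapT => ck; apply: h; exists k, i.
    by left; apply/eqP; rewrite eq_le k0 wc.
  exists a; split; [exact: equilibrium_sub|exact: weight_pos|].
  move=> k; left; apply/eqP; rewrite eq_le wc andbT leNgt; apply/negP => k0.
  by apply: n; exists k.
have [q [Eq wq pq]] : exists q, [/\ E q, 0 < w q & p <> q].
  have [pa|pa] := pselect (p = a).
    by exists b; rewrite pa; split; [exact: equilibrium_sub|exact: weight_pos|].
  by exists a; split; [exact: equilibrium_sub|exact: weight_pos|].
pose c' (k : 'I_m.+2) := if k == ord0 then p else q.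
have wc' k : 0 <= w (c' k) by rewrite /c'; case: ifP => _; exact: ltW.
exists c'; split.
- by move=> k; rewrite /c'; case: ifP.
- move=> z; apply: wmax_le; first exact: wmax_ge0.
  move=> k; have [->|->] := hp k; first by rewrite mul0r; exact: wmax_ge0.
  exact: (le_wmax (fun k => w (c' k)) c' ord0 z).
- by apply: (wmax_gt0 (i := ord0) (j := ord_max)).
Qed.

Lemma integral_elog_wmax m (c : 'I_m -> CC) (ka : R) : (forall k, E (c k)) ->
  0 < ka -> (forall z, ka <= wmaxc c z) ->
  (\int[mu]_z elog (wmaxc c z)%:E = (mean mu (fun z => ln (wmaxc c z)))%:E)%E.
Proof.
move=> Ec ka0 kaW; have wc k : 0 <= w (c k) by exact: weight_ge0E.
have cW := continuous_ln_wmax wc ka0 kaW.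
rewrite integral_msupp.
  rewrite -(meanE equilibrium_compact cW); apply: eq_integral => z _.
  by rewrite elogE// (lt_le_trans ka0).
apply: measurable_elog; rewrite [X in measurable_fun _ X](_ : _ =
  (fun z => expR (ln (wmaxc c z)))).
  apply: measurableT_comp => //.
  exact: continuous_measurable_plane.
by apply/funext => z; rewrite lnK// posrE (lt_le_trans ka0).
Qed.

Definition fardist (z : CC) : R := fine (farthest_dist E w z).

Lemma weighted_dist_bounded : exists2 W0 : R, 0 < W0 &
  forall t z, E t -> 0 <= w t * cdist z t <= W0 * (cabs z + 1) /\ w t <= W0.
Proof.
have [W0 W00 hW] := weight_bounded closedE admE; exists W0 => // t z Et.
have [h1 h2] := hW _ Et; have wt := weight_ge0E Et.
split => //; rewrite mulr_ge0 ?cdist_ge0//=.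
apply: (@le_trans _ _ (w t * (cabs z + cabs t))).
  by rewrite ler_wpM2l// cdist_cabs.
rewrite !mulrDr mulr1 lerD//; last by rewrite mulrC.
by rewrite ler_wpM2r ?cabs_ge0.
Qed.

Lemma farthest_distE z : farthest_dist E w z = (fardist z)%:E /\
  (forall t, E t -> w t * cdist z t <= fardist z) /\
  (forall y : R, (forall t, E t -> w t * cdist z t <= y) -> fardist z <= y).
Proof.
have [W0 W00 hW] := weighted_dist_bounded.
have [a Sa] := msupp_neq0 mu; have Ea := equilibrium_sub Sa.
have fin : farthest_dist E w z \is a fin_num.
  rewrite fin_numElt; apply/andP; split.
    apply: (@lt_le_trans _ _ (w a * cdist z a)%:E); first exact: ltNyr.
    by apply: ereal_sup_ubound; exists a.
  apply: (@le_lt_trans _ _ (W0 * (cabs z + 1))%:E); last exact: ltry.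
  apply: ge_ereal_sup => _ [t Et <-]; rewrite lee_fin.
  by have [/andP[]] := hW t z Et.
have fE : farthest_dist E w z = (fardist z)%:E by rewrite fineK.
split => //; split.
  by move=> t Et; rewrite -lee_fin -fE; apply: ereal_sup_ubound; exists t.
move=> y hy; rewrite -lee_fin -fE; apply: ge_ereal_sup => _ [t Et <-].
by rewrite lee_fin hy.
Qed.

Lemma fardist_lipschitz : exists2 W0 : R, 0 <= W0 &
  forall z u, fardist z - fardist u <= W0 * cdist z u.
Proof.
have [W0 W00 hW] := weighted_dist_bounded; exists W0; first exact: ltW.
move=> z u; have [_ [hu _]] := farthest_distE u; have [_ [_ hz]] := farthest_distE z.
rewrite lerBlDr; apply: hz => t Et; have [_ wW] := hW t z Et.
have wt := weight_ge0E Et.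
apply: (@le_trans _ _ (w t * cdist z u + w t * cdist u t)).
  by rewrite -mulrDr ler_wpM2l// cdist_triangle.
by rewrite lerD ?hu// ler_wpM2r ?cdist_ge0.
Qed.

Lemma wmax_le_fardist m (c : 'I_m -> CC) z : (forall k, E (c k)) ->
  wmaxc c z <= fardist z.
Proof.
move=> Ec; have [_ [h _]] := farthest_distE z; apply: wmax_le; last by move=> k; exact: h.
have [a Sa] := msupp_neq0 mu; have Ea := equilibrium_sub Sa.
by apply: le_trans (h _ Ea); rewrite mulr_ge0 ?cdist_ge0// weight_ge0E.
Qed.

Lemma fardist_bounded_below : exists2 ka : R, 0 < ka & forall z, ka <= fardist z.
Proof.
have [a Sa] := msupp_neq0 mu; have Ea := equilibrium_sub Sa.
have [c' [Ec' _ [ka ka0 h]]] := @nondegenerate_centers 2 (fun=> a) isT (fun=> Ea).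
by exists ka => // z; apply: le_trans (wmax_le_fardist z Ec').
Qed.

Lemma continuous_ln_fardist : continuous (fun z => ln (fardist z)).
Proof.
have [ka ka0 h] := fardist_bounded_below; have [W0 W00 lip] := fardist_lipschitz.
apply: (@lipschitz_cdist_continuous _ _ (W0 / ka)) => z u.
have p y : 0 < fardist y by exact: lt_le_trans (h y).
have [zu|uz] := leP (fardist z) (fardist u).
  rewrite (@le_trans _ _ 0)//; last by rewrite mulr_ge0 ?cdist_ge0// divr_ge0// ltW.
  by rewrite subr_le0 le_ln.
apply: (le_trans (ln_sub_le (p z) (p u))).
rewrite mulrAC; apply: ler_pM.
- by rewrite subr_ge0 ltW.
- by rewrite invr_ge0 ltW.
- exact: lip.
- by rewrite lef_pV2 ?posrE.
Qed.

Lemma CEwE : CEw E w mu F = (mean mu (fun z => ln (fardist z)) + F)%:E.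
Proof.
have [ka ka0 h] := fardist_bounded_below.
have p y : 0 < fardist y by exact: lt_le_trans (h y).
rewrite /CEw EFinD; congr (_ + _)%E.
rewrite (eq_integral (fun z => (ln (fardist z))%:E)); last first.
  by move=> z _; have [-> _] := farthest_distE z; rewrite elogE.
rewrite integral_msupp ?(meanE equilibrium_compact continuous_ln_fardist)//.
apply/measurable_EFinP; apply: continuous_measurable_plane.
exact: continuous_ln_fardist.
Qed.

Lemma CEwm_le_CEw m : (CEwm E w mu F m <= CEw E w mu F)%E.
Proof.
apply: ge_ereal_sup => _ [c [Ec ->]]; rewrite leeD2r//.
apply: pointwise_le_integral => z _; apply: le_elog.
have [-> _] := farthest_distE z; rewrite lee_fin.
exact: (wmax_le_fardist z Ec).
Qed.

Lemma CEwm_ge m (c : 'I_m -> CC) (ka : R) : (forall k, E (c k)) ->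
  0 < ka -> (forall z, ka <= wmaxc c z) ->
  ((mean mu (fun z => ln (wmaxc c z)) + F)%:E <= CEwm E w mu F m)%E.
Proof.
move=> Ec ka0 kaW; apply: ereal_sup_ubound; exists c; split => //.
by rewrite (integral_elog_wmax Ec ka0 kaW) EFinD.
Qed.

Lemma CEwm_fin m : (2 <= m)%N -> CEwm E w mu F m \is a fin_num.
Proof.
move=> m2; have [a Sa] := msupp_neq0 mu; have Ea := equilibrium_sub Sa.
have [c' [Ec' _ [ka ka0 h]]] := nondegenerate_centers m2 (fun=> Ea).
rewrite fin_numElt; apply/andP; split.
  exact: lt_le_trans (ltNyr _) (CEwm_ge Ec' ka0 h).
by apply: le_lt_trans (CEwm_le_CEw m) _; rewrite CEwE ltry.
Qed.

(** With the single center in the support, this is the equilibrium inequality at that point. *)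
Lemma CEwm1_ge0 : (0 <= CEwm E w mu F 1)%E.
Proof.
have [a Sa] := msupp_neq0 mu; have Ea := equilibrium_sub Sa.
have wa := weight_pos Sa; have cptS := equilibrium_compact.
have h (d : R) : 0 < d -> - (ln (w a) + F) <= tpot d a.
  by move=> d0; have := tpot_support Sa d0; lra.
have [i1 i2] := tpot_bounded_integrable cptS h.
apply: (@le_trans _ _ (\int[mu]_z elog (w a * cdist z a)%:E + F%:E)%E); last first.
  apply: ereal_sup_ubound; exists (fun=> a); split => //; congr (_ + _)%E.
  apply: eq_integral => z _; rewrite big_ord_recl big_ord0 max_l//.
  by rewrite mulr_ge0 ?cdist_ge0// ltW.
rewrite integral_msupp; last first.
  apply: measurable_elog; apply: measurable_funM => //.
  by apply: continuous_measurable_plane; exact: continuous_cdistl.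
rewrite (eq_integral (fun z => (ln (w a))%:E + elog (cdist a z)%:E)%E); last first.
  move=> z _; rewrite (cdistC z); have [z0|z0] := ltP 0 (cdist a z).
    by rewrite !elogE ?mulr_gt0// lnM ?posrE.
  rewrite [in RHS]elog_le0// addeNy elog_le0// pmulr_rle0//.
have ic : mu.-integrable S (fun=> (ln (w a))%:E).
  by apply: (@integrable_msupp _ _ cptS (fun=> ln (w a))) => t; exact: cvg_cst.
rewrite (integralD (measurable_msupp mu) ic i1).
rewrite (@meanE _ _ cptS (fun=> ln (w a))) ?mean_cst; last by move=> t; exact: cvg_cst.
apply: (@le_trans _ _ ((ln (w a))%:E + (- (ln (w a) + F))%:E + F%:E)%E).
  by rewrite -!EFinD lee_fin; lra.
by rewrite leeD2r// leeD2l.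
Qed.

End equilibrium.

(** One factor is freed at a time by dividing by the others; factors equal to zero are treated
    apart. This reduces a product of norms to values at freely chosen points. *)
Lemma prod_sup_le {R : realType} (T : Type) (E : set T) (m : nat)
    (f : 'I_m -> T -> R) (r : 'I_m -> R) (B : R) : E !=set0 ->
  (forall j z, E z -> 0 <= f j z) -> (forall j, 0 <= r j) ->
  (forall j (y : R), (forall z, E z -> f j z <= y) -> r j <= y) ->
  (forall c : 'I_m -> T, (forall j, E (c j)) -> \prod_(j < m) f j (c j) <= B) ->
  \prod_(j < m) r j <= B.
Proof.
move=> [e0 Ee0]; elim: m f r B => [|m IH] f r B f0 r0 rlub h.
  by have := h (fun=> e0) (fun=> Ee0); rewrite !big_ord0.
have B0 : 0 <= B.
  by apply: le_trans (h (fun=> e0) (fun=> Ee0)); apply: prodr_ge0 => j _; exact: f0.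
rewrite big_ord_recl; set p := \prod_(i < m) _.
have p0 : 0 <= p by apply: prodr_ge0.
have claim z : E z -> f ord0 z * p <= B.
  move=> Ez; have := f0 ord0 z Ez; rewrite le_eqVlt => /predU1P[<-|fz].
    by rewrite mul0r.
  rewrite mulrC -ler_pdivlMr//; apply: (IH (fun j => f (lift ord0 j))) => //.
  - by move=> j; exact: f0.
  - by move=> j; exact: rlub.
  - move=> c Ec; rewrite ler_pdivlMr// mulrC.
    pose c' j := if unlift ord0 j is Some i then c i else z.
    have := h c'; rewrite big_ord_recl /c' unlift_none.
    under eq_bigr do rewrite liftK.
    by apply => j; case: (unlift ord0 j).
move: p0; rewrite le_eqVlt => /predU1P[<-|p0]; first by rewrite mulr0.
by rewrite -ler_pdivlMr//; apply: rlub => z Ez; rewrite ler_pdivlMr// claim.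
Qed.

(** * The two inequalities *)

Section polynomial_inequality.
Context {R : realType} (E : set (R * R)) (w : R * R -> R).
Context (mu : probability (R * R)%type R) (F : R).
Local Notation CC := (R * R)%type.
Local Notation tpot := (tpot mu).
Hypothesis closedE : closed E.
Hypothesis admE : admissible E w.
Hypothesis eqE : weighted_equilibrium E w mu F.
Local Notation wmaxc c := (wmax (fun k => w (c k)) c).
Local Notation normc := (@Normc.normc R).

(** The exponent equals the degree, so each zero x takes one factor w(z), and w(z) |z - x| is
    bounded on [E]: the norm is finite. *)
Lemma wsnormE n (P : {poly R[i]}) : size P = n.+1 -> exists r : R,
  [/\ 0 <= r, wsnorm E w n P = r%:E,
    forall z, E z -> w z ^+ n * normc P.[toC z] <= r &
    forall y : R, (forall z, E z -> w z ^+ n * normc P.[toC z] <= y) -> r <= y].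
Proof.
move=> szP; have [Z szZ PE] := poly_factor szP.
have [W0 W00 hW] := weighted_dist_bounded closedE admE.
have [a Sa] := msupp_neq0 mu; have Ea := equilibrium_sub eqE Sa.
pose B := normc (lead_coef P) * \prod_(x <- Z) (W0 * (cabs x + 1)).
have hB z : E z -> w z ^+ n * normc P.[toC z] <= B.
  move=> Ez; rewrite PE normc_factor /absprod mulrCA ler_wpM2l ?normc_ge0//.
  rewrite -szZ -[X in X * _ <= _](_ : \prod_(x <- Z) w z = _); last first.
    by rewrite big_const_seq count_predT iter_mulr_1.
  rewrite -big_split/=; apply: ler_prod => x _.
  by have [] := hW z x Ez; rewrite (cdistC x).
have pos z : E z -> 0 <= w z ^+ n * normc P.[toC z].
  by move=> Ez; rewrite mulr_ge0 ?normc_ge0// exprn_ge0// (weight_ge0E admE).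
have fin : wsnorm E w n P \is a fin_num.
  rewrite fin_numElt; apply/andP; split.
    apply: (@lt_le_trans _ _ (w a ^+ n * normc P.[toC a])%:E); first exact: ltNyr.
    by apply: ereal_sup_ubound; exists a.
  apply: (@le_lt_trans _ _ B%:E); last exact: ltry.
  by apply: ge_ereal_sup => _ [t Et <-]; rewrite lee_fin hB.
have fE : wsnorm E w n P = (fine (wsnorm E w n P))%:E by rewrite fineK.
have ub z : E z -> w z ^+ n * normc P.[toC z] <= fine (wsnorm E w n P).
  by move=> Ez; rewrite -lee_fin -fE; apply: ereal_sup_ubound; exists z.
exists (fine (wsnorm E w n P)); split => //.
- exact: le_trans (pos _ Ea) (ub _ Ea).
- move=> y hy; rewrite -lee_fin -fE; apply: ge_ereal_sup => _ [t Et <-].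
  by rewrite lee_fin hy.
Qed.

Lemma weighted_bernstein_walsh (al r : R) (Z : seq CC) : 0 <= al -> 0 <= r ->
  (forall z, E z -> w z ^+ size Z * absprod al Z z <= r) ->
  forall z (d : R), 0 < d ->
    absprod al Z z <= r * expR ((size Z)%:R * F) * expR ((size Z)%:R * tpot d z).
Proof.
move=> al0 r0 hr; have [Cc hC] := tpot_support_bounded closedE admE eqE.
apply: domination hC _ => //; first exact: equilibrium_compact eqE.
  by rewrite mulr_ge0 ?expR_ge0.
move=> k d Sk d0; have wk := weight_pos eqE Sk.
have hk := hr _ (equilibrium_sub eqE Sk).
have hp := tpot_support eqE Sk d0.
rewrite -mulrA -expRD -mulrDr expRM_natl.
apply: (@le_trans _ _ (r * (w k)^-1 ^+ size Z)).
  by rewrite exprVn ler_pdivlMr ?exprn_gt0// mulrC.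
rewrite ler_wpM2l// lerXn2r ?nnegrE ?expR_ge0 ?invr_ge0 ?(ltW wk)//.
rewrite -[w k]lnK ?posrE// -expRN ler_expR; move: hp; lra.
Qed.

(** Writing P_j through its zeros x, each factor w(c_j) |c_j - x| is at most [wmax] at x, so the
    values are controlled by the product of [wmax] over all zeros together. *)
Lemma products_of_values_le m (n : 'I_m -> nat) (P : 'I_m -> {poly R[i]})
    (c c' : 'I_m -> CC) (r ka : R) :
  (forall j, size (P j) = (n j).+1) -> (forall j, E (c j)) -> (forall j, E (c' j)) ->
  (forall z, wmaxc c z <= wmaxc c' z) -> 0 < ka -> (forall z, ka <= wmaxc c' z) ->
  0 <= r ->
  (forall z, E z ->
     w z ^+ (\sum_j n j)%N * normc (\prod_j P j).[toC z] <= r) ->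
  \prod_j (w (c j) ^+ n j * normc (P j).[toC (c j)]) <=
  expR ((\sum_j n j)%N%:R * (mean mu (fun z => ln (wmaxc c' z)) + F)) * r.
Proof.
move=> szP Ec Ec' cc' ka0 kaW r0 hr.
have /choice[Z hZ] : forall j, exists Zj : seq CC, size Zj = n j /\
    P j = lead_coef (P j) *: \prod_(x <- Zj) ('X - (toC x)%:P).
  by move=> j; have [Zj ? ?] := poly_factor (szP j); exists Zj.
pose ZZ := flatten [seq Z j | j <- index_enum 'I_m].
pose al := \prod_j normc (lead_coef (P j)).
have al0 : 0 <= al by apply: prodr_ge0 => j _; exact: normc_ge0.
have prodZZ (f : CC -> R) : \prod_(x <- ZZ) f x = \prod_j \prod_(x <- Z j) f x.
  by rewrite big_flatten big_map.
have szZZ : size ZZ = (\sum_j n j)%N.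
  rewrite size_flatten sumnE !big_map; apply: eq_bigr => j _.
  by have [] := hZ j.
have normP z : normc (\prod_j P j).[toC z] = absprod al ZZ z.
  rewrite horner_prod normc_prod /absprod prodZZ /al -big_split/=.
  by apply: eq_bigr => j _; have [_ ->] := hZ j; rewrite normc_factor lead_coefZ
    lead_coef_prod_XsubC mulr1.
have hr' z : E z -> w z ^+ size ZZ * absprod al ZZ z <= r.
  by move=> Ez; rewrite szZZ -normP hr.
have wc' k : 0 <= w (c' k) by exact: weight_ge0E admE _ _.
have wc k : 0 <= w (c k) by exact: weight_ge0E admE _ _.
have main := absprod_wmax_le (equilibrium_compact eqE) wc' ka0 kaW al0
  (mulr_ge0 r0 (expR_ge0 _)) (weighted_bernstein_walsh al0 r0 hr').
apply: (@le_trans _ _ (al * \prod_(x <- ZZ) wmaxc c' x)).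
  rewrite prodZZ /al -big_split/=; apply: ler_prod => j _.
  rewrite mulr_ge0 ?exprn_ge0 ?normc_ge0//=.
  have [szZ PE] := hZ j.
  rewrite {1}PE normc_factor /absprod mulrCA ler_wpM2l ?normc_ge0//.
  rewrite -szZ -[X in X * _ <= _](_ : \prod_(x <- Z j) w (c j) = _); last first.
    by rewrite big_const_seq count_predT iter_mulr_1.
  rewrite -big_split/=; apply: ler_prod => x _.
  rewrite mulr_ge0 ?cdist_ge0//=; apply: le_trans (cc' x).
  by rewrite cdistC; exact: (le_wmax (fun k => w (c k)) c j x).
apply: (le_trans main); rewrite szZZ mulrDr expRD.
by rewrite [leRHS]mulrC mulrA mulrAC.
Qed.

Lemma main_inequality (m : nat) (n : 'I_m -> nat) (P : 'I_m -> {poly R[i]}) :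
  (0 < m)%N -> (forall j, size (P j) = (n j).+1) ->
  (prod_norms E w n P <= bound_with E w n P (CEwm E w mu F m))%E.
Proof.
move=> m0 szP.
have P0 j : P j != 0 by rewrite -size_poly_eq0 szP.
have szprod : size (\prod_j P j) = (\sum_j n j).+1.
  rewrite size_prod; last by move=> j _.
  under eq_bigr do rewrite szP.
  rewrite -[X in (_.+1 - X)%N]sum1_card.
  under eq_bigr do rewrite -addn1.
  by rewrite big_split/= -addSn addnK.
have [r [r0 rE rub rlub]] := wsnormE szprod.
rewrite /bound_with rE.
(* For m = 1 [wmax] vanishes at the only center; but both norms then coincide, and a nonnegative
   exponent suffices. *)
have [m2|m1] := leqP 2 m; last first.
  have m1E : m = 1%N by apply/eqP; rewrite eqn_leq m0 -ltnS m1.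
  move: n P szP P0 szprod rE rub rlub; rewrite m1E => n P szP P0 szprod rE rub rlub.
  rewrite /prod_norms big_ord1.
  have -> : wsnorm E w (n ord0) (P ord0) = r%:E.
    by rewrite -rE !big_ord1.
  rewrite -[leLHS]mul1e lee_wpmul2r ?lee_fin//.
  rewrite -[1%E]expeR0 lee_expeR mule_ge0//.
  exact: (CEwm1_ge0 eqE).
have cfin := CEwm_fin closedE admE eqE m2.
have -> : (expeR ((\sum_(j < m) n j)%N%:R%:E * CEwm E w mu F m) * r%:E =
    (expR ((\sum_(j < m) n j)%N%:R * fine (CEwm E w mu F m)) * r)%:E)%E.
  by rewrite -[in LHS](fineK cfin).
have /choice[rr hrr] : forall j, exists r : R,
  [/\ 0 <= r, wsnorm E w (n j) (P j) = r%:E,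
    forall z, E z -> w z ^+ n j * normc (P j).[toC z] <= r &
    forall y : R, (forall z, E z -> w z ^+ n j * normc (P j).[toC z] <= y) -> r <= y].
  by move=> j; exact: wsnormE.
have -> : prod_norms E w n P = (\prod_j rr j)%:E.
  rewrite /prod_norms -prodEFin; apply: eq_bigr => j _.
  by have [] := hrr j.
rewrite lee_fin.
have [a Sa] := msupp_neq0 mu; have Ea := equilibrium_sub eqE Sa.
apply: (@prod_sup_le _ _ E m (fun j z => w z ^+ n j * normc (P j).[toC z])).
- by exists a.
- by move=> j z Ez; rewrite mulr_ge0 ?normc_ge0// exprn_ge0// (weight_ge0E admE).
- by move=> j; have [] := hrr j.
- by move=> j; have [] := hrr j.
move=> c Ec.
have [c' [Ec' cc' [ka ka0 kaW]]] := nondegenerate_centers closedE admE eqE m2 Ec.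
apply: (le_trans (products_of_values_le szP Ec Ec' cc' ka0 kaW r0 rub)).
rewrite ler_wpM2r// ler_expR ler_wpM2l//.
by rewrite -lee_fin fineK//; exact: (CEwm_ge admE eqE Ec' ka0 kaW).
Qed.

Lemma second_inequality (m : nat) (n : 'I_m -> nat) (P : 'I_m -> {poly R[i]}) :
  (bound_with E w n P (CEwm E w mu F m) <= bound_with E w n P (CEw E w mu F))%E.
Proof.
rewrite /bound_with lee_wpmul2r//.
  have [a Sa] := msupp_neq0 mu; have Ea := equilibrium_sub eqE Sa.
  apply: (@le_trans _ _ (w a ^+ (\sum_(j < m) n j)%N *
    normc (\prod_(j < m) P j).[toC a])%:E).
    by rewrite lee_fin mulr_ge0 ?normc_ge0// exprn_ge0// (weight_ge0E admE).
  by apply: ereal_sup_ubound; exists a.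
rewrite lee_expeR lee_wpmul2l ?lee_fin//.
exact: (CEwm_le_CEw closedE admE eqE).
Qed.

End polynomial_inequality.

(** * The set where the equilibrium inequality fails by a fixed amount *)

Section exceptional_set.
Context {R : realType} (E : set (R * R)) (w : R * R -> R).
Context (mu : probability (R * R)%type R) (F : R).
Local Notation CC := (R * R)%type.
Local Notation S := (msupp mu).
Local Notation tpot := (tpot mu).
Hypothesis closedE : closed E.
Hypothesis admE : admissible E w.
Hypothesis eqE : weighted_equilibrium E w mu F.
Let cptS : compact S := equilibrium_compact eqE.

(** Quantifying over the truncations presents the set as an intersection of relatively closed sets,
    [w] being upper semicontinuous and [tpot d] continuous; with the decay of [w] this gives
    compactness. *)
Definition exceptional (ep : R) : set CC :=
  [set z | E z /\ forall d : R, 0 < d -> expR ep <= w z * expR (tpot d z + F)].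

Lemma pos_log_capS (A B : set CC) : A `<=` B -> pos_log_cap A -> pos_log_cap B.
Proof.
move=> AB [nu [K [cptK KA nuK en]]]; exists nu, K; split => //.
by move=> z /KA/AB.
Qed.

Lemma exceptional_cap0 (ep : R) : 0 < ep -> ~ pos_log_cap (exceptional ep).
Proof.
move=> ep0; have [_ _ _ [N [N0 hN]]] := eqE.
apply: contra_not N0; apply: pos_log_capS => z [Ez hz].
apply: contrapT => Nz; have := hN z Ez Nz.
have wz : 0 < w z.
  rewrite -(pmulr_lgt0 _ (expR_gt0 (tpot 1 z + F))).
  by apply: lt_le_trans (hz 1 ltr01); exact: expR_gt0.
rewrite elogE// -addeA -EFinD -leeBrDr// sub0e => h.
have : (logpot mu z < (- (ln (w z) + F) + ep)%:E)%E.
  by apply: (le_lt_trans h); rewrite -EFinN lte_fin ltrDl.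
move=> /(tpot_lt_logpot cptS)[d d0 hd].
have := hz d d0; apply/negP; rewrite -ltNge.
by rewrite -[w z]lnK ?posrE// -expRD ltr_expR; move: hd; lra.
Qed.

Lemma weighted_tpot_bound : exists2 M : R, 0 < M & forall z (d : R), E z ->
  0 < d -> d <= 1 -> w z * expR (tpot d z) <= w z * (cabs z + M).
Proof.
have [M M0 SM] := compact_cabs_bounded cptS.
exists (M + 1) => [|z d Ez d0 d1]; first lra.
have zM : 0 < cabs z + (M + 1) by have := cabs_ge0 z; lra.
rewrite ler_wpM2l ?(weight_ge0E admE)// -[leRHS]lnK ?posrE// ler_expR.
apply: tpot_le => //; first by have := cabs_ge0 z; lra.
by move=> t St; have := cdist_cabs z t; have := SM _ St; lra.
Qed.

Lemma weighted_tpot_bounded : exists2 M1 : R, 1 <= M1 & forall z (d : R), E z ->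
  0 < d -> d <= 1 -> w z * expR (tpot d z) <= M1.
Proof.
have [M M0 hM] := weighted_tpot_bound; have [W0 W00 hW] := weight_bounded closedE admE.
exists (W0 * (1 + M) + 1) => [|z d Ez d0 d1].
  by rewrite lerDr mulr_ge0//; lra.
apply: (le_trans (hM z d Ez d0 d1)); have [h1 h2] := hW _ Ez.
have : w z * M <= W0 * M by rewrite ler_wpM2r// ltW.
by move: h2; rewrite mulrDr mulrC mulrDr; lra.
Qed.

Lemma weighted_tpot_tail (e : R) : 0 < e -> exists M : R, forall z (d : R), E z ->
  M < cabs z -> 0 < d -> d <= 1 -> w z * expR (tpot d z) < e.
Proof.
move=> e0; have [M M0 hM] := weighted_tpot_bound.
have e2 : 0 < e / 2 by lra.
have [M' hM'] := weight_tail admE e2.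
exists (Num.max M M') => z d Ez; rewrite gt_max => /andP[Mz M'z] d0 d1.
apply: (le_lt_trans (hM z d Ez d0 d1)).
have h1 := hM' _ Ez M'z; have wz := weight_ge0E admE Ez.
have : w z * M <= w z * cabs z by rewrite ler_wpM2l// ltW.
by rewrite mulrDr (mulrC _ (cabs z)); lra.
Qed.

Lemma usc_weighted_tpot z (d b : R) : E z -> 0 < d ->
  w z * expR (tpot d z + F) < b ->
  \forall y \near z, E y -> w y * expR (tpot d y + F) < b.
Proof.
move=> Ez d0 zb; pose g y := expR (tpot d y + F).
have g0 y : 0 < g y by exact: expR_gt0.
have wz := weight_ge0E admE Ez.
have wzb : w z < b / g z by rewrite ltr_pdivlMr.
(* Separates the two factors: [w] stays below [a] by semicontinuity, [a * g] stays below [b] by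
   continuity. *)
pose a := (w z + b / g z) / 2.
have [wa ab] : w z < a /\ a < b / g z by have [] := midf_lt wzb.
have a0 : 0 < a by exact: le_lt_trans wa.
have [_ usc _ _] := admE.
have cg : continuous (fun y => a * g y).
  move=> y; apply: cvgM; first exact: cvg_cst.
  apply: (@continuous_comp _ _ _ (fun u => tpot d u + F) expR).
    by apply: cvgD; [exact: continuous_tpot|exact: cvg_cst].
  exact: continuous_expR.
have agz : a * g z < b by rewrite -ltr_pdivlMr.
near=> y => Ey.
apply: (@le_lt_trans _ _ (a * g y)).
  rewrite ler_wpM2r ?(ltW (g0 y))// ltW//; move: Ey.
  by near: y; exact: (usc z Ez a wa).
near: y; exact: (cvgr_lt _ (cg z)).
Unshelve. all: end_near. Qed.

Lemma exceptional_compact (ep : R) : compact (exceptional ep).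
Proof.
have [M hM] := weighted_tpot_tail (expR_gt0 (ep - F)).
apply: (@closed_disc_compact _ _ M).
  move=> z clz; have Ez : E z.
    apply: closedE => V /clz[y [[Ey _] Vy]]; exists y; split => //.
  split => // d d0; rewrite leNgt; apply/negP => h.
  have [y [[Ey hy]]] := clz _ (usc_weighted_tpot Ez d0 h).
  by move=> /(_ Ey); rewrite ltNge hy.
move=> z [Ez hz]; rewrite leNgt; apply/negP => Mz.
have := hM z 1 Ez Mz ltr01 (lexx _); apply/negP; rewrite -leNgt.
by rewrite expRB ler_pdivrMr ?expR_gt0// -mulrA -expRD hz.
Qed.

(** Dini's argument: off [V] each point has a good truncation, which stays good nearby and for
    smaller [d]; compactness gives a common one, and the tail bound, uniform in [d], covers large
    |z|. *)
Lemma dini_off_exceptional (ep : R) (V : set CC) : open V -> exceptional ep `<=` V ->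
  exists d : R, [/\ 0 < d, d <= 1 &
    forall z, E z -> ~ V z -> w z * expR (tpot d z + F) < expR ep].
Proof.
move=> oV KV; have [M hM] := weighted_tpot_tail (expR_gt0 (ep - F)).
have cptA : compact (E `&` ~` V `&` [set z | cabs z <= M]).
  apply: (@closed_disc_compact _ _ M); last by move=> z [].
  apply: closedI.
    by apply: closedI => //; exact: open_closedC.
  exact: ((continuous_closedP _).1 continuous_cabs _ (@closed_le _ M)).
have /compact_near_coveringP/near_covering_withinP := cptA.
move=> /(_ R (0^'+) (fun d z => w z * expR (tpot d z + F) < expR ep) _) [|].
  move=> z [[Ez nVz] _].
  have [d2 d20 hd2] : exists2 d2 : R, 0 < d2 & w z * expR (tpot d2 z + F) < expR ep.
    apply: contrapT => h; apply: nVz; apply: KV; split => // d d0.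
    by rewrite leNgt; apply/negP => hd; apply: h; exists d.
  exists ([set y | E y -> w y * expR (tpot d2 y + F) < expR ep],
          [set d | 0 < d < d2]).
    split; first exact: usc_weighted_tpot.
    near=> d; apply/andP; split; first by [].
    by near: d; exact: nbhs_right_lt.
  move=> [y d] /= [hy /andP[d0 dd2]] [[Ey _] _].
  apply: le_lt_trans (hy Ey); rewrite ler_wpM2l ?(weight_ge0E admE)//.
  by rewrite ler_expR lerD2r le_tpot// ltW.
move=> r /= r0 h; pose d := Num.min (r / 2) 1.
have d0 : 0 < d by rewrite lt_min ltr01 andbT; lra.
have d1 : d <= 1 by rewrite ge_min lexx orbT.
exists d; split => // z Ez nVz.
have [zM|Mz] := leP (cabs z) M.
  apply: (h d) => //; rewrite /= sub0r normrN gtr0_norm//.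
  by rewrite /d gt_min; apply/orP; left; lra.
have := hM z d Ez Mz d0 d1.
by rewrite expRB ltr_pdivlMr ?expR_gt0// -mulrA -expRD.
Unshelve. all: end_near. Qed.

End exceptional_set.

(** * Quadrature on the support and integer multiplicities *)

Section support_net.
Context {R : realType} (mu : probability (R * R)%type R).
Local Notation CC := (R * R)%type.
Local Notation S := (msupp mu).
Hypothesis cptS : compact S.

Lemma finite_net (dl : R) : 0 < dl -> exists ys : seq CC,
  (forall y, y \in ys -> S y) /\ forall t, S t -> exists2 y, y \in ys & cdist y t < dl.
Proof.
move=> dl0.
(* Lists of points directed by inclusion: the near-covering form of compactness merges the local
   covers into one list. *)
pose FF : set_system (seq CC) := filter_from [set s : seq CC | forall y, y \in s -> S y]
  (fun s => [set s' : seq CC | {subset s <= s'}]).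
have FFF : Filter FF.
  apply: filter_from_filter; first by exists [::].
  move=> s1 s2 /= h1 h2; exists (s1 ++ s2).
    by move=> y; rewrite mem_cat => /orP[/h1|/h2].
  by move=> s /= h; split=> y ys; apply: h; rewrite mem_cat ys ?orbT.
have /compact_near_coveringP := cptS.
move=> /(_ (seq CC) FF (fun s t => exists2 y, y \in s & cdist y t < dl) FFF) [|s sS cov].
  move=> x Sx; exists ([set y | cdist x y < dl], [set s : seq CC | x \in s]).
    split; first exact: near_cdist.
    exists [:: x]; first by move=> y; rewrite inE => /eqP ->.
    by move=> s /= h; apply: h; rewrite inE.
  by move=> [t s] /= [xt xs]; exists x.
by exists s; split => // t St; exact: (cov s).
Qed.

(* The weights are the integrals of a partition of unity subordinate to the
   discs of radius [dl] around the net. *)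
Lemma quadrature (dl : R) : 0 < dl -> exists (ys : seq CC) (al : CC -> R),
  [/\ forall y, y \in ys -> S y, forall y, 0 <= al y, \sum_(y <- ys) al y = 1 &
    forall (G f : CC -> R), continuous f ->
      (forall y t, y \in ys -> S t -> cdist y t < dl -> G y <= f t) ->
      \sum_(y <- ys) al y * G y <= mean mu f].
Proof.
move=> dl0; have dl2 : 0 < dl / 2 by lra.
have [ys [ysS cov]] := finite_net dl2.
pose b y t : R := Num.max 0 (dl - cdist y t).
have b0 y t : 0 <= b y t by rewrite le_max lexx.
(* The floor dl / 2 allows division everywhere; on the support the sum already exceeds it, the net
   having mesh dl / 2. *)
pose T t : R := Num.max (dl / 2) (\sum_(y <- ys) b y t).
have T0 t : 0 < T t by rewrite lt_max dl2.
have cb y : continuous (b y).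
  move=> t; apply: (@continuous_max _ _ (fun=> 0) (fun t => dl - cdist y t)).
    exact: cvg_cst.
  by apply: cvgB; [exact: cvg_cst|exact: continuous_cdistr].
have cT : continuous T.
  move=> t; apply: (@continuous_max _ _ (fun=> dl / 2) (fun t => \sum_(y <- ys) b y t)).
    exact: cvg_cst.
  exact: continuous_bigsum.
pose h y t := b y t / T t.
have ch y : continuous (h y).
  by move=> t; apply: cvgM; [exact: cb|apply: cvgV; [rewrite gt_eqF|exact: cT]].
have h0 y t : 0 <= h y t by rewrite divr_ge0// ltW.
have TE t : S t -> T t = \sum_(y <- ys) b y t.
  move=> /cov[y yys yt]; apply/max_idPr.
  rewrite (big_rem y)//= (le_trans (y := b y t))// ?lerDl ?sumr_ge0//.
  by rewrite le_max; apply/orP; right; lra.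
have sumh t : S t -> \sum_(y <- ys) h y t = 1.
  by move=> St; rewrite -mulr_suml -(TE t St) divff// gt_eqF.
have ccst (k : R) : continuous (fun _ : CC => k) by move=> t; exact: cvg_cst.
exists ys, (fun y => mean mu (h y)); split => //.
- by move=> y; rewrite -(mean_cst mu 0); apply: le_mean.
- rewrite -(mean_sum cptS)// -[RHS](mean_cst mu).
  have cs : continuous (fun t => \sum_(y <- ys) h y t) by exact: continuous_bigsum.
  by apply/eqP; rewrite eq_le !le_mean// => t St; rewrite sumh.
move=> G f cf hGf.
have chG y : continuous (fun t => G y * h y t).
  by move=> t; apply: cvgM; [exact: cvg_cst|exact: ch].
under eq_bigr do rewrite mulrC -(meanZ cptS)//.
rewrite -(mean_sum cptS)//; apply: le_mean => //; first exact: continuous_bigsum.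
move=> t St; rewrite -[f t]mul1r -(sumh t St) mulr_suml.
rewrite big_seq [leRHS]big_seq; apply: ler_sum => y yys.
have [yt|yt] := ltP (cdist y t) dl.
  by rewrite mulrC ler_wpM2l// hGf.
suff -> : h y t = 0 by rewrite mulr0 mul0r.
by rewrite /h /b (max_idPl _) ?mul0r// subr_le0.
Qed.

End support_net.

Section rounding.
Context {R : realType} (T : eqType).
Variables (ys : seq T) (al : T -> R) (N : nat).
Hypothesis al0 : forall y, 0 <= al y.
Hypothesis al1 : \sum_(y <- ys) al y = 1.

(** Rounding up keeps the total at least N and moves each multiplicity by at most 1. All
    multiplicities are positive, so the product in [rounded_product_le] vanishes as soon as one
    factor does. *)
Definition mult (y : T) : nat := (Num.truncn (N%:R * al y)).+1.

Lemma mult_itv y : 0 <= (mult y)%:R - N%:R * al y <= 1.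
Proof.
have h : 0 <= N%:R * al y by rewrite mulr_ge0.
have /andP[h1 h2] := truncn_itv h; rewrite subr_ge0 ltW//=.
by rewrite /mult -natr1 lerBlDr addrC lerD2l.
Qed.

Lemma mult_sum_le : (\sum_(y <- ys) mult y)%N%:R <= N%:R + (size ys)%:R :> R.
Proof.
have -> : N%:R = \sum_(y <- ys) N%:R * al y :> R by rewrite -mulr_sumr al1 mulr1.
rewrite natr_sum -sum1_size natr_sum -big_split/=.
apply: ler_sum => y _; have /andP[_] := mult_itv y.
by rewrite lerBlDl.
Qed.

Lemma mult_sum_ge : N%:R <= (\sum_(y <- ys) mult y)%N%:R :> R.
Proof.
have -> : N%:R = \sum_(y <- ys) N%:R * al y :> R by rewrite -mulr_sumr al1 mulr1.
rewrite natr_sum.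
by apply: ler_sum => y _; have /andP[+ _] := mult_itv y; rewrite subr_ge0.
Qed.

Lemma rounding_le (f : T -> R) (L : R) : 0 <= L -> (forall y, y \in ys -> f y <= L) ->
  \sum_(y <- ys) (mult y)%:R * f y
    <= N%:R * \sum_(y <- ys) al y * f y + (size ys)%:R * L.
Proof.
move=> L0 fL; rewrite mulr_sumr.
have -> : (size ys)%:R * L = \sum_(y <- ys) L.
  by rewrite big_const_seq count_predT iter_addr_0 mulr_natl.
rewrite -big_split/= big_seq [leRHS]big_seq; apply: ler_sum => y yys.
have /andP[h1 h2] := mult_itv y; rewrite -lerBlDl mulrA -mulrBl.
have [fy|fy] := ltP 0 (f y); last by rewrite (le_trans _ L0)// mulr_ge0_le0.
by rewrite -[leRHS]mul1r; apply: ler_pM => //; [exact: ltW|exact: fL].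
Qed.

Lemma rounding_ge (f : T -> R) (L : R) : 0 <= L -> (forall y, y \in ys -> - L <= f y) ->
  N%:R * \sum_(y <- ys) al y * f y - (size ys)%:R * L
    <= \sum_(y <- ys) (mult y)%:R * f y.
Proof.
move=> L0 fL; have fL' y : y \in ys -> - f y <= L by move=> /fL; rewrite lerNl.
have := rounding_le L0 fL'.
rewrite (eq_bigr (fun y => - ((mult y)%:R * f y))); last by move=> y _; rewrite mulrN.
rewrite [X in _ <= _ * X + _](eq_bigr (fun y => - (al y * f y))); last first.
  by move=> y _; rewrite mulrN.
by rewrite !sumrN mulrN; lra.
Qed.

Lemma rounded_product_le (g : T -> R) (v D p : R) : 0 <= v -> 1 <= D ->
  (forall y, 0 <= g y) -> (forall y, y \in ys -> v * g y <= D) ->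
  ((forall y, y \in ys -> 0 < g y) -> \sum_(y <- ys) al y * ln (g y) <= p) ->
  \prod_(y <- ys) (v * g y) ^+ mult y <= (v * expR p) ^+ N * D ^+ size ys.
Proof.
move=> v0 D1 g0 gD hp; have D0 : 0 < D by exact: lt_le_trans D1.
have rhs0 : 0 <= (v * expR p) ^+ N * D ^+ size ys.
  by rewrite mulr_ge0 ?exprn_ge0 ?mulr_ge0 ?expR_ge0// ltW.
have [[y yys gy]|pos] := pselect (exists2 y, y \in ys & v * g y <= 0).
  rewrite (big_rem y)//= (_ : v * g y = 0) ?exprS ?mul0r//.
  by apply/eqP; rewrite eq_le gy mulr_ge0.
have {}pos y : y \in ys -> 0 < v * g y.
  by move=> yys; rewrite ltNge; apply/negP => gy; apply: pos; exists y.
have [y0 y0ys] : exists y, y \in ys.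
  case: (ys) al1 => [|y s _]; last by exists y; rewrite mem_head.
  by rewrite big_nil => /eqP; rewrite eq_sym oner_eq0.
have v1 : 0 < v.
  by rewrite lt_def v0 andbT; apply/eqP => v00; have := pos _ y0ys; rewrite v00 mul0r ltxx.
have g1 y : y \in ys -> 0 < g y by move=> /pos; rewrite pmulr_rgt0.
have -> : \prod_(y <- ys) (v * g y) ^+ mult y =
    expR (\sum_(y <- ys) (mult y)%:R * ln (v * g y)).
  rewrite expR_sum big_seq [RHS]big_seq; apply: eq_bigr => y yys.
  by rewrite expRM_natl lnK// posrE pos.
rewrite -[v in leRHS]lnK ?posrE// -expRD -expRM_natl.
rewrite -[D in leRHS]lnK ?posrE// -expRM_natl -expRD ler_expR.
apply: (le_trans (@rounding_le (fun y => ln (v * g y)) (ln D) (ln_ge0 D1) _)).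
  by move=> y yys; rewrite le_ln// ?pos// gD.
rewrite lerD2r ler_wpM2l//.
have -> : \sum_(y <- ys) al y * ln (v * g y) =
    ln v + \sum_(y <- ys) al y * ln (g y).
  have -> : ln v = \sum_(y <- ys) ln v * al y by rewrite -mulr_sumr al1 mulr1.
  rewrite -big_split/= big_seq [RHS]big_seq.
  by apply: eq_bigr => y yys; rewrite lnM ?posrE ?g1// mulrDr mulrC.
by rewrite lerD2l hp.
Qed.

End rounding.

(** * Zeros of near-extremal polynomials *)

Section extremal_zeros.
Context {R : realType} (E : set (R * R)) (w : R * R -> R).
Context (mu : probability (R * R)%type R) (F : R).
Local Notation CC := (R * R)%type.
Local Notation S := (msupp mu).
Local Notation tpot := (tpot mu).
Hypothesis closedE : closed E.
Hypothesis admE : admissible E w.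
Hypothesis eqE : weighted_equilibrium E w mu F.
Let cptS : compact S := equilibrium_compact eqE.

(* Weighted Fekete-type polynomials: zeros are taken from a quadrature of [mu],
   and a small proportion [ta] of extra zeros kills the exceptional set. *)
Lemma near_extremal_zeros (u : CC -> R) (La lka c0 : R) :
  0 <= La -> (forall z y, u z - u y <= La * cdist z y) ->
  0 <= lka -> (forall z, - lka <= u z) ->
  c0 < mean mu u + F ->
  exists (Z : seq CC) (r : R),
    (forall z, E z -> w z ^+ size Z * \prod_(x <- Z) cdist z x <= expR r) /\
    (size Z)%:R * c0 + r < \sum_(x <- Z) u x.
Proof.
move=> La0 uLip lka0 uka c0C.
have arith1 (n f f' e a k b D : R) : 0 <= b * D -> n * (f - f') <= 0 -> 0 <= n * e ->
    n * (a + e) + k * D - n * (f' + a) <= n * (2 * e - f) + (k + b) * D.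
  by lra.
have arith2 (n X Y g : R) : X = n * g -> 2 * Y < X -> 0 <= X ->
    Y + n * (g / 12) < n * (g - 3 * (g / 12)).
  by move=> ->; lra.
have arith3 (n n' c M f e k b l a D A B : R) :
    n * (M - e) - k * l <= A -> - (b * l) <= B -> n' * c <= n * c + k * a ->
    b * c <= b * a -> (k + b) * (l + a + D) < n * (M + f - c - 3 * e) ->
    (n' + b) * c + (n * (2 * e - f) + (k + b) * D) < A + B.
  by lra.
(* The gap g to be spent per zero: ep = g / 12 goes to the quadrature of [u], to that of the
   potential and to the exceptional threshold; ta Lam = g / 12 pays for the extra zeros, and for
   large N the rest absorbs the bounded terms. *)
pose g := mean mu u + F - c0; have g0 : 0 < g by rewrite subr_gt0.
pose ep := g / 12; have ep0 : 0 < ep by rewrite divr_gt0.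
have [z0 Sz0] := msupp_neq0 mu.
have cptK := @exceptional_compact _ _ _ _ _ closedE admE eqE ep.
have [MK MK0 KM] := compact_cabs_bounded cptK.
have [MS MS0 SM] := compact_cabs_bounded cptS.
have [W0 W00 hW] := weighted_dist_bounded closedE admE.
have [M1 M11 hM1] := weighted_tpot_bounded closedE admE eqE.
pose D := W0 * (MK + MS + 1) + 1.
have D1 : 1 <= D by rewrite lerDr mulr_ge0 ?(ltW W00)//; lra.
have D0 : 0 < D by exact: lt_le_trans D1.
have hD z x : E z -> cabs x <= MK + MS -> w z * cdist z x <= D.
  move=> Ez xM; have [/andP[_ h] _] := hW z x Ez; rewrite (cdistC z).
  apply: (le_trans h); apply: (@le_trans _ _ (W0 * (MK + MS + 1))).
    by rewrite ler_wpM2l ?(ltW W00)//; lra.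
  by rewrite lerDl.
have lD := ln_ge0 D1; have lM1 := ln_ge0 M11.
pose Lam := lka + `|c0| + ln D + 1.
have Lam0 : 0 < Lam by rewrite /Lam; have := normr_ge0 c0; move: lka0 lD; lra.
pose ta := g / (12 * Lam); have ta0 : 0 < ta by rewrite divr_gt0// mulr_gt0.
(* At least ta N extra zeros, each contributing e^(-T) in geometric mean, cancel the crude bound
   M1^N near the exceptional set; dividing by [W0] in [eta] compensates for the weight. *)
pose T := (`|F| + ln M1) / ta.
have T0 : 0 <= T by rewrite divr_ge0 ?addr_ge0// ltW.
pose eta := expR (- T) / W0; have eta0 : 0 < eta by rewrite divr_gt0// expR_gt0.
have [s [s0 sK sV]] :=
  small_monic_polynomial z0 cptK (exceptional_cap0 eqE ep0) eta0.
pose d0 := size s; have d00 : (0 < d0)%N by rewrite lt0n size_eq0.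
have sM x : x \in s -> cabs x <= MK + MS.
  by move=> /sK[/KM|->]; [move: MS0; lra|have := SM _ Sz0; move: MK0; lra].
(* The strict bound extends from the exceptional set to an open neighbourhood, which is what the
   Dini argument requires. *)
pose V : set CC := [set z | \prod_(x <- s) cdist z x < eta ^+ d0].
have oV : open V.
  have c1 := @continuous_absprod R 1 s.
  have -> : V = absprod 1 s @^-1` [set x | x < eta ^+ d0].
    by apply/funext => z; rewrite /V /absprod /= mul1r.
  by apply: open_comp; [move=> z _; exact: c1|exact: open_lt].
have [d1 [d10 d11 hd1]] := dini_off_exceptional closedE admE eqE oV sV.
(* Moving a node by [dl] changes the logarithm truncated at [d1] by at most dl / d1 and [u] by at
   most La dl; both stay below [ep]. *)
pose dl := Num.min (ep * d1) (ep / (La + 1)).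
have La1 : 0 < La + 1 by rewrite ltr_wpDl.
have dl0 : 0 < dl by rewrite lt_min mulr_gt0//= divr_gt0.
have dlep : dl / d1 <= ep by rewrite ler_pdivrMr// ge_min lexx.
have dlLa : La * dl <= ep.
  apply: (@le_trans _ _ ((La + 1) * dl)); first by rewrite ler_wpM2r ?(ltW dl0)// lerDl.
  by rewrite mulrC -ler_pdivlMr// ge_min lexx orbT.
have [ys [al [ysS al0 al1 quad]]] := quadrature cptS dl0.
have cu : continuous u by exact: lipschitz_cdist_continuous uLip.
have ctl z : continuous (tlog d1 z) by exact: continuous_tlog.
have ccst (k : R) : continuous (fun _ : CC => k) by move=> t; exact: cvg_cst.
have netpot z : (forall y, y \in ys -> 0 < cdist z y) ->
    \sum_(y <- ys) al y * ln (cdist z y) <= tpot d1 z + ep.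
  move=> zpos; rewrite -[X in _ + X](mean_cst mu) -(meanD cptS)//.
  pose G y := if y \in ys then ln (cdist z y) else 0.
  have -> : \sum_(y <- ys) al y * ln (cdist z y) = \sum_(y <- ys) al y * G y.
    by rewrite big_seq [RHS]big_seq; apply: eq_bigr => y yys; rewrite /G yys.
  apply: quad; first by move=> t; apply: cvgD; [exact: ctl|exact: cvg_cst].
  move=> y t yys St yt; rewrite /G yys -lerBlDl.
  apply: (le_trans (ln_sub_le (zpos y yys) (max_gt0 _ d10))).
  apply: le_trans dlep.
  set mx := Num.max _ _; have mxd : d1 <= mx by rewrite le_max lexx orbT.
  have mx0 : 0 < mx by exact: lt_le_trans mxd.
  have h : cdist z y - mx <= dl.
    have : cdist z t <= mx by rewrite le_max lexx.
    by have := cdist_triangle t z y; rewrite (cdistC t y); move: yt; lra.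
  have [h0|h0] := leP (cdist z y - mx) 0.
    apply: (@le_trans _ _ 0); first by rewrite mulr_le0_ge0 ?invr_ge0// ltW.
    by rewrite divr_ge0// ltW.
  by apply: ler_pM => //; [exact: ltW|rewrite invr_ge0 ltW|rewrite lef_pV2].
have netu : mean mu u - ep <= \sum_(y <- ys) al y * u y.
  have cNu : continuous (fun t => (-1) * u t).
    by move=> t; apply: cvgM; [exact: cvg_cst|exact: cu].
  have cN2 : continuous (fun t => ep + (-1) * u t).
    by move=> t; apply: cvgD; [exact: cvg_cst|exact: cNu].
  have hq y t : y \in ys -> S t -> cdist y t < dl -> - u y <= ep + (-1) * u t.
    move=> yys St yt; have := uLip t y; rewrite cdistC => h.
    have : La * cdist y t <= La * dl by rewrite ler_wpM2l// ltW.
    by move: h dlLa; lra.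
  have := quad (fun y => - u y) _ cN2 hq.
  rewrite (meanD cptS)// mean_cst (meanZ cptS)//.
  rewrite (eq_bigr (fun y => - (al y * u y))); last by move=> y _; rewrite mulrN.
  by rewrite sumrN mulN1r lerNl opprD opprK addrC.
pose N := (Num.truncn (2 * (((size ys)%:R + d0%:R) * Lam) / g)).+1.
have d0R : 0 < d0%:R :> R by rewrite ltr0n.
have [l [l1 l2]] : exists l : nat,
    ta * N%:R <= (l * d0)%:R /\ (l * d0)%:R <= ta * N%:R + d0%:R :> R.
  have taN : 0 <= ta * N%:R / d0%:R by rewrite divr_ge0 ?(ltW d0R)// mulr_ge0 ?(ltW ta0).
  exists (Num.truncn (ta * N%:R / d0%:R)).+1.
  have /andP[h1 h2] := truncn_itv taN; rewrite natrM; split.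
    by rewrite -ler_pdivrMr// ltW.
  by rewrite -natr1 mulrDl mul1r lerD2r -ler_pdivlMr.
have [mu_ muE] : exists f, f = mult al N by exists (mult al N).
pose Z := flatten [seq nseq (mu_ y) y | y <- ys] ++ flatten (nseq l s).
have prodZ (f : CC -> R) : \prod_(x <- Z) f x =
    \prod_(y <- ys) f y ^+ mu_ y * (\prod_(x <- s) f x) ^+ l.
  rewrite big_cat !big_flatten big_map/=; congr (_ * _).
    by apply: eq_bigr => y _; rewrite big_nseq iter_mulr_1.
  by rewrite big_nseq iter_mulr_1.
have sumZ (f : CC -> R) : \sum_(x <- Z) f x =
    \sum_(y <- ys) (mu_ y)%:R * f y + l%:R * \sum_(x <- s) f x.
  rewrite big_cat !big_flatten big_map/=; congr (_ + _).
    by apply: eq_bigr => y _; rewrite big_nseq iter_addr_0 mulr_natl.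
  by rewrite big_nseq iter_addr_0 mulr_natl.
have szZ : size Z = (\sum_(y <- ys) mu_ y + l * d0)%N.
  rewrite size_cat !size_flatten /shape map_nseq sumn_nseq -/d0 mulnC; congr (_ + _)%N.
  by rewrite -map_comp sumnE big_map; apply: eq_bigr => y _; rewrite /= size_nseq.
pose r := N%:R * (2 * ep - F) + ((size ys)%:R + (l * d0)%:R) * ln D.
exists Z, r; split.
  move=> z Ez; have wz := weight_ge0E admE Ez.
  have -> : w z ^+ size Z * \prod_(x <- Z) cdist z x = \prod_(x <- Z) (w z * cdist z x).
    by rewrite big_split/= big_const_seq count_predT iter_mulr_1.
  rewrite prodZ.
  have h1 : \prod_(y <- ys) (w z * cdist z y) ^+ mu_ y
      <= (w z * expR (tpot d1 z + ep)) ^+ N * D ^+ size ys.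
    rewrite muE; apply: rounded_product_le => //.
    - by move=> y; exact: cdist_ge0.
    - by move=> y yys; apply: hD => //; have := SM _ (ysS _ yys); move: MK0; lra.
    - exact: netpot.
  have p0 : 0 <= \prod_(x <- s) (w z * cdist z x).
    by apply: prodr_ge0 => x _; rewrite mulr_ge0 ?cdist_ge0.
  have q0 : 0 <= \prod_(y <- ys) (w z * cdist z y) ^+ mu_ y.
    by apply: prodr_ge0 => y _; rewrite exprn_ge0// mulr_ge0 ?cdist_ge0.
  have DE k : D ^+ k = expR (k%:R * ln D) by rewrite expRM_natl lnK ?posrE.
  (* Off [V] the quadrature nodes give the bound and the extra zeros are only estimated by [D]; on
     [V] the roles are exchanged. *)
  have [Vz|nVz] := pselect (V z); last first.
    have h2 : (\prod_(x <- s) (w z * cdist z x)) ^+ l <= expR ((l * d0)%:R * ln D).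
      rewrite -DE mulnC exprM lerXn2r ?nnegrE ?exprn_ge0 ?(ltW D0)//.
      have -> : D ^+ d0 = \prod_(x <- s) D.
        by rewrite big_const_seq count_predT iter_mulr_1.
      rewrite big_seq [leRHS]big_seq; apply: ler_prod => x xs.
      by rewrite mulr_ge0 ?cdist_ge0//= hD// sM.
    have h3 : (w z * expR (tpot d1 z + ep)) ^+ N <= expR (N%:R * (2 * ep - F)).
      rewrite expRM_natl lerXn2r ?nnegrE ?mulr_ge0 ?expR_ge0//.
      have -> : tpot d1 z + ep = tpot d1 z + F + (ep - F) by ring.
      have -> : 2 * ep - F = ep + (ep - F) by ring.
      by rewrite (expRD _ (ep - F)) [leRHS]expRD mulrA ler_wpM2r ?expR_ge0// ltW// hd1.
    apply: (@le_trans _ _ (expR (N%:R * (2 * ep - F)) * expR ((size ys)%:R * ln D)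
       * expR ((l * d0)%:R * ln D))).
      apply: ler_pM => //; first by rewrite exprn_ge0.
      apply: (le_trans h1); rewrite -DE ler_wpM2r ?exprn_ge0// ltW//.
    by rewrite -!expRD ler_expR /r (mulrDl (size ys)%:R) addrA.
  have h2 : (\prod_(x <- s) (w z * cdist z x)) ^+ l <= expR (- (N%:R * (`|F| + ln M1))).
    apply: (@le_trans _ _ ((expR (- T) ^+ d0) ^+ l)).
      rewrite lerXn2r ?nnegrE ?exprn_ge0 ?expR_ge0//.
      rewrite big_split/= big_const_seq count_predT iter_mulr_1 -/d0.
      apply: (@le_trans _ _ (W0 ^+ d0 * eta ^+ d0)).
        apply: ler_pM.
        - by rewrite exprn_ge0.
        - by apply: prodr_ge0 => x _; exact: cdist_ge0.
        - by rewrite lerXn2r ?nnegrE// ?(ltW W00)//; have [_] := hW z z Ez.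
        - exact: ltW.
      by rewrite -exprMn /eta mulrC divfK// gt_eqF.
    rewrite -exprM -expRM_natl ler_expR mulrN lerN2.
    have -> : `|F| + ln M1 = ta * T by rewrite mulrC divfK// gt_eqF.
    by rewrite mulrA ler_wpM2r// mulrC (mulnC d0).
  have h3 : (w z * expR (tpot d1 z + ep)) ^+ N <= expR (N%:R * (ln M1 + ep)).
    rewrite expRM_natl lerXn2r ?nnegrE ?mulr_ge0 ?expR_ge0//.
    rewrite !expRD mulrA ler_wpM2r ?expR_ge0// lnK ?posrE//; last exact: lt_le_trans M11.
    exact: hM1.
  apply: (@le_trans _ _ (expR (N%:R * (ln M1 + ep)) * expR ((size ys)%:R * ln D)
     * expR (- (N%:R * (`|F| + ln M1))))).
    apply: ler_pM => //; first by rewrite exprn_ge0.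
    by apply: (le_trans h1); rewrite -DE ler_wpM2r ?exprn_ge0// ltW.
  rewrite -!expRD ler_expR /r.
  have a1 : 0 <= (l * d0)%:R * ln D by rewrite mulr_ge0.
  have a2 : N%:R * (F - `|F|) <= 0.
    by rewrite mulr_ge0_le0// subr_le0 ler_norm.
  have a3 : 0 <= N%:R * ep by rewrite mulr_ge0// ltW.
  exact: arith1.
rewrite sumZ szZ natrD.
have hu : N%:R * (mean mu u - ep) - (size ys)%:R * lka <= \sum_(y <- ys) (mu_ y)%:R * u y.
  rewrite muE; apply: le_trans (rounding_ge N al0 lka0 (fun y _ => uka y)).
  by rewrite lerD2r ler_wpM2l.
have hs : - ((l * d0)%:R * lka) <= l%:R * \sum_(x <- s) u x.
  rewrite natrM -mulrA -mulrN ler_wpM2l//.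
  have -> : - (d0%:R * lka) = \sum_(x <- s) (- lka).
    by rewrite big_const_seq count_predT iter_addr_0 -/d0 mulr_natl mulNrn.
  by apply: ler_sum.
have hn : (\sum_(y <- ys) mu_ y)%N%:R * c0 <= N%:R * c0 + (size ys)%:R * `|c0|.
  have n1 := mult_sum_ge N al0 al1; have n2 := mult_sum_le N al0 al1.
  rewrite -muE in n1 n2; rewrite -lerBlDl -mulrBl.
  apply: (@le_trans _ _ (((\sum_(y <- ys) mu_ y)%N%:R - N%:R) * `|c0|)).
    by rewrite ler_wpM2l ?ler_norm// subr_ge0.
  by rewrite ler_wpM2r// lerBlDl.
have hl : (l * d0)%:R * c0 <= (l * d0)%:R * `|c0| by rewrite ler_wpM2l ?ler_norm.
have key : ((size ys)%:R + (l * d0)%:R) * (lka + `|c0| + ln D) < N%:R * (g - 3 * ep).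
  apply: (@le_lt_trans _ _ (((size ys)%:R + (ta * N%:R + d0%:R)) * Lam)).
    apply: ler_pM; rewrite ?addr_ge0//.
      by rewrite lerD2l.
    by rewrite /Lam lerDl.
  have -> : ((size ys)%:R + (ta * N%:R + d0%:R)) * Lam =
      ((size ys)%:R + d0%:R) * Lam + N%:R * (g / 12).
    by rewrite /ta; field; rewrite gt_eqF.
  have hN : 2 * (((size ys)%:R + d0%:R) * Lam) < N%:R * g.
    rewrite -ltr_pdivrMr//.
    have q : 0 <= 2 * (((size ys)%:R + d0%:R) * Lam) / g.
      by rewrite divr_ge0 ?(ltW g0)// mulr_ge0// mulr_ge0 ?(ltW Lam0)// addr_ge0.
    by have /andP[] := truncn_itv q.
  have Ng : 0 <= N%:R * g by rewrite mulr_ge0// ltW.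
  exact: (arith2 _ _ _ _ (erefl _) hN Ng).
exact: (arith3 _ _ _ _ _ _ _ _ _ _ _ _ _ hu hs hn hl key).
Qed.

End extremal_zeros.

(** * Sharpness of both constants *)

Section sharpness.
Context {R : realType} (E : set (R * R)) (w : R * R -> R).
Context (mu : probability (R * R)%type R) (F : R).
Local Notation CC := (R * R)%type.
Local Notation S := (msupp mu).
Hypothesis closedE : closed E.
Hypothesis admE : admissible E w.
Hypothesis eqE : weighted_equilibrium E w mu F.
Local Notation wmaxc c := (wmax (fun k => w (c k)) c).
Local Notation normc := (@Normc.normc R).

(* Each zero of a near-extremal polynomial goes to the factor [P_k] whose
   center [c_k] realizes the weighted maximum there. *)
Lemma CEwm_sharp (m : nat) (c0 : R) : (2 <= m)%N -> (c0%:E < CEwm E w mu F m)%E ->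
  exists (n : 'I_m -> nat) (P : 'I_m -> {poly R[i]}),
    (forall j, size (P j) = (n j).+1) /\
    (bound_with E w n P c0%:E < prod_norms E w n P)%E.
Proof.
move=> m2 /ereal_sup_gt[_ [c [Ec ->]] c0c].
have [c' [Ec' cc' [ka ka0 kaW]]] := nondegenerate_centers closedE admE eqE m2 Ec.
have c0' : c0 < mean mu (fun z => ln (wmaxc c' z)) + F.
  rewrite -lte_fin EFinD -(integral_elog_wmax admE eqE Ec' ka0 kaW).
  apply: (lt_le_trans c0c); rewrite leeD2r//; apply: pointwise_le_integral => z _.
  by apply: le_elog; rewrite lee_fin; exact: cc'.
have wc' k : 0 <= w (c' k) by exact: (weight_ge0E admE).
have [La La0 lip] := ln_wmax_lipschitz wc' ka0 kaW.
have uka z : - `|ln ka| <= ln (wmaxc c' z).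
  apply: le_trans (le_ln ka0 (kaW z)).
  by rewrite lerNl -normrN ler_norm.
have [Z [r [hZ hsum]]] :=
  near_extremal_zeros closedE admE eqE La0 lip (normr_ge0 _) uka c0'.
have /choice[kk hkk] : forall z, exists k, wmaxc c' z = w (c' k) * cdist z (c' k).
  by move=> z; exact: (wmax_attained c' wc' (Ordinal m2) z).
pose Zk k := [seq x <- Z | kk x == k].
pose n k := size (Zk k).
pose P k : {poly R[i]} := \prod_(x <- Zk k) ('X - (toC x)%:P).
have szP k : size (P k) = (n k).+1 by rewrite size_prod_XsubC.
have sumn : (\sum_k n k)%N = size Z.
  rewrite -sum1_size (partition_big kk predT)//=; apply: eq_bigr => k _.
  by rewrite sum1_count /n size_filter.
have partZ (f : CC -> R) : \prod_(x <- Z) f x = \prod_k \prod_(x <- Zk k) f x.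
  by rewrite (partition_big kk predT)//=; apply: eq_bigr => k _; rewrite big_filter.
have prodP : \prod_k P k = \prod_(x <- Z) ('X - (toC x)%:P).
  by rewrite (partition_big kk predT)//=; apply: eq_bigr => k _; rewrite /P big_filter.
have normXsubC (s : seq CC) z :
    normc (\prod_(x <- s) ('X - (toC x)%:P)).[toC z] = \prod_(x <- s) cdist z x.
  by rewrite horner_prod normc_prod; apply: eq_bigr => x _; rewrite hornerXsubC cdistE.
have szprod : size (\prod_k P k) = (\sum_k n k)%N.+1.
  by rewrite prodP size_prod_XsubC sumn.
have [rB [rB0 rBE _ rBlub]] := wsnormE closedE admE eqE szprod.
have rBr : rB <= expR r.
  by apply: rBlub => z Ez; rewrite sumn prodP normXsubC; exact: hZ.
exists n, P; split => //.
rewrite /bound_with rBE.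
have -> : (expeR ((\sum_(j < m) n j)%N%:R%:E * c0%:E) * rB%:E =
    (expR ((size Z)%:R * c0) * rB)%:E)%E by rewrite sumn.
have /choice[rr hrr] : forall j, exists r : R,
  [/\ 0 <= r, wsnorm E w (n j) (P j) = r%:E,
    forall z, E z -> w z ^+ n j * normc (P j).[toC z] <= r &
    forall y : R, (forall z, E z -> w z ^+ n j * normc (P j).[toC z] <= y) -> r <= y].
  by move=> j; exact: (wsnormE closedE admE eqE).
have -> : prod_norms E w n P = (\prod_j rr j)%:E.
  rewrite /prod_norms -prodEFin; apply: eq_bigr => j _.
  by have [] := hrr j.
rewrite lte_fin.
apply: (@le_lt_trans _ _ (expR ((size Z)%:R * c0 + r))).
  by rewrite expRD ler_wpM2l ?expR_ge0.
apply: (@lt_le_trans _ _ (expR (\sum_(x <- Z) ln (wmaxc c' x)))).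
  by rewrite ltr_expR.
rewrite expR_sum partZ; apply: ler_prod => k _; apply/andP; split.
  by apply: prodr_ge0 => x _; exact: expR_ge0.
have [_ _ ub _] := hrr k; apply: le_trans (ub _ (Ec' k)).
rewrite normXsubC /n -[X in _ <= X * _](_ : \prod_(x <- Zk k) w (c' k) = _); last first.
  by rewrite big_const_seq count_predT iter_mulr_1.
rewrite -big_split/= le_eqVlt; apply/orP; left; apply/eqP.
rewrite big_seq [RHS]big_seq; apply: eq_bigr => x.
rewrite mem_filter => /andP[/eqP xk _].
by rewrite lnK ?posrE ?(lt_le_trans ka0)// hkk xk (cdistC x).
Qed.

(** Choosing for each point of a fine net of the support a center that nearly realizes its farthest
    distance gives finitely many centers with [wmax] uniformly close to [fardist] on the support. *)
Lemma CEw_lt_CEwm (c0 : R) : (c0%:E < CEw E w mu F)%E ->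
  exists2 m : nat, (2 <= m)%N & (c0%:E < CEwm E w mu F m)%E.
Proof.
rewrite (CEwE closedE admE eqE) lte_fin => c0C; have cptS := equilibrium_compact eqE.
set fd := fardist E w in c0C.
have [ep ep0 epE] : exists2 ep : R, 0 < ep & c0 + ep < mean mu (fun z => ln (fd z)) + F.
  by exists ((mean mu (fun z => ln (fd z)) + F - c0) / 2); move: c0C; lra.
have [ka ka0 hka] := fardist_bounded_below closedE admE eqE.
have [W1 W10 lip] := fardist_lipschitz closedE admE eqE.
have [W0 W00 hW] := weighted_dist_bounded closedE admE.
(* The first bound keeps [wmax] above ka / 2 on the support; the second then keeps the error of the
   logarithm below [ep]. *)
have [et [et0 etka etep]] : exists et : R, [/\ 0 < et, et <= ka / 2 & et <= ep * (ka / 2)].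
  exists (Num.min (ka / 2) (ep * (ka / 2))).
  by rewrite lt_min !ge_min !lexx orbT divr_gt0// mulr_gt0// divr_gt0.
have Wp : 0 < 2 * (W0 + W1) by rewrite mulr_gt0// ltr_wpDr.
pose dl := et / (2 * (W0 + W1)).
have dl0 : 0 < dl by rewrite divr_gt0.
have dlE : (W0 + W1) * dl = et / 2.
  by rewrite /dl; field; rewrite gt_eqF// ltr_wpDr.
have /choice[tt htt] : forall y, exists t, E t /\ fd y - et / 2 < w t * cdist y t.
  move=> y; apply: contrapT => h.
  have [_ [_ lub]] := farthest_distE closedE admE eqE y.
  have : fd y <= fd y - et / 2.
    by apply: lub => t Et; rewrite leNgt; apply/negP => h'; apply: h; exists t.
  by move: et0; lra.
have [ys [ysS cov]] := finite_net cptS dl0.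
(* Two extra indices ensure m >= 2; they receive the default of [nth], which is harmless since [tt]
   sends every point into [E]. *)
pose c (k : 'I_(size ys).+2) := tt (nth (0, 0) ys k).
have Ec k : E (c k) by have [] := htt (nth (0, 0) ys k).
have close t : S t -> fd t - et <= wmaxc c t.
  move=> St; have [y yys yt] := cov _ St.
  have iy : (index y ys < (size ys).+2)%N by rewrite (ltn_trans _ (ltnSn _))// ltnS index_size.
  have := le_wmax (fun k => w (c k)) c (Ordinal iy) t.
  rewrite /c /= nth_index//; apply: le_trans; have [Et ht] := htt y.
  have [_ wW] := hW _ t Et; have wt := weight_ge0E admE Et.
  have h1 := lip t y; rewrite -/fd (cdistC t) in h1.
  have h2 : w (tt y) * cdist y (tt y) <= w (tt y) * cdist y t + w (tt y) * cdist t (tt y).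
    by rewrite -mulrDr ler_wpM2l// cdist_triangle.
  have h3 : w (tt y) * cdist y t <= W0 * dl.
    by apply: ler_pM => //; [exact: cdist_ge0|exact: ltW].
  have h4 : W1 * cdist y t <= W1 * dl by rewrite ler_wpM2l// ltW.
  by move: dlE; rewrite mulrDl; move: h1 h2 h3 h4 ht; lra.
have m2 : (2 <= (size ys).+2)%N by [].
have [c' [Ec' cc' [ka' ka'0 kaW']]] := nondegenerate_centers closedE admE eqE m2 Ec.
exists (size ys).+2 => //.
apply: lt_le_trans (CEwm_ge admE eqE Ec' ka'0 kaW'); rewrite lte_fin.
have wc' k : 0 <= w (c' k) by exact: (weight_ge0E admE).
have cW := continuous_ln_wmax wc' ka'0 kaW'.
have cfd : continuous (fun z => ln (fd z)) by exact: (continuous_ln_fardist closedE admE eqE).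
have ccst : continuous (fun _ : CC => ep) by move=> t; exact: cvg_cst.
suff : mean mu (fun z => ln (fd z)) <= mean mu (fun z => ln (wmaxc c' z)) + ep.
  by move: epE; lra.
rewrite -[ep](mean_cst mu) -(meanD cptS)//; apply: (le_mean cptS) => //.
  by move=> t; apply: cvgD; [exact: cW|exact: ccst].
move=> t St; rewrite -lerBlDl.
have W'0 : 0 < wmaxc c' t by exact: lt_le_trans (kaW' t).
apply: (le_trans (ln_sub_le (lt_le_trans ka0 (hka t)) W'0)).
have cl : fd t - et <= wmaxc c' t by exact: le_trans (close _ St) (cc' t).
have kt : ka / 2 <= wmaxc c' t.
  by apply: le_trans cl; have := hka t; rewrite -/fd; move: etka; lra.
rewrite ler_pdivrMr//; apply: (@le_trans _ _ et).
  by rewrite -/fd; move: cl; lra.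
by apply: (le_trans etep); rewrite ler_wpM2l// ltW.
Qed.

End sharpness.

Theorem theorem3p1 (R : realType) (E : set (R * R)) (w : R * R -> R)
    (mu : probability (R * R)%type R) (F : R) :
  closed E -> admissible E w -> weighted_equilibrium E w mu F ->
  (* the two inequalities *)
  (forall (m : nat) (n : 'I_m -> nat) (P : 'I_m -> {poly R[i]}),
     (0 < m)%N -> (forall j, size (P j) = (n j).+1) ->
     (prod_norms E w n P <= bound_with E w n P (CEwm E w mu F m))%E /\
     (bound_with E w n P (CEwm E w mu F m) <= bound_with E w n P (CEw E w mu F))%E) /\
  (* sharpness of C_E^w(m) for each fixed m >= 2 *)
  (forall m : nat, (2 <= m)%N -> forall c : R, (c%:E < CEwm E w mu F m)%E ->
     exists (n : 'I_m -> nat) (P : 'I_m -> {poly R[i]}),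
       (forall j, size (P j) = (n j).+1) /\
       (bound_with E w n P c%:E < prod_norms E w n P)%E) /\
  (* sharpness of C_E^w among constants independent of m *)
  (forall c : R, (c%:E < CEw E w mu F)%E ->
     exists (m : nat) (n : 'I_m -> nat) (P : 'I_m -> {poly R[i]}),
       (0 < m)%N /\ (forall j, size (P j) = (n j).+1) /\
       (bound_with E w n P c%:E < prod_norms E w n P)%E).
Proof.
move=> closedE admE eqE; split; first last.
  split; first by move=> m m2 c; exact: (CEwm_sharp closedE admE eqE m2).
  move=> c /(CEw_lt_CEwm closedE admE eqE)[m m2 cm].
  have [n [P [szP h]]] := CEwm_sharp closedE admE eqE m2 cm.
  by exists m, n, P; split => //; exact: ltnW.
move=> m n P m0 szP; split.
  exact: (main_inequality closedE admE eqE m0 szP).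
exact: (second_inequality closedE admE eqE).
Qed.
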